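(* Let $\mathcal S\subset(0,\infty)\times\mathcal K$ denote the closure of the set of all nontrivial solution pairs $(\lambda,u)$ ($u\neq0$) of the variational inequality $$\int_0^1\Big[\varepsilon u'(v-u)'+\lambda^3\dot W^*\big([1+u]/\lambda\big)(v-u)\Big]ds\ \ge\ 0\qquad\text{for all } v\in\mathcal K ,$$ with $(\lambda,u)\in(0,\infty)\times\mathcal K$, and let $\mathcal C_n$ denote the connected component of $\mathcal S$ containing $(\lambda_n,0)$. Then each $(\lambda_n,0)$, $n=1,2,\ldots$, is a point of global bifurcation, in the sense that each solution branch $\mathcal C_n$ is characterized by at least one of the following: (i) $\mathcal C_n$ is unbounded in $(0,\infty)\times\mathcal H$; (ii) $(\lambda_k,0)\in\mathcal C_n$ for some $k\ne n$.
   Context: Let $W\in C^3(0,\infty)$ satisfy: $W(F)\nearrow\infty$ as $F\searrow0$; $W(F)\nearrow\gamma>0$ as $F\nearrow\infty$; $W(1)=0$ and $W(F)>0$ for $F\ne1$; $W$ is strictly convex on $(0,1/\kappa)$ and strictly concave on $(1/\kappa,\infty)$, where $0<\kappa<1$. Define $W^*(H)=HW(1/H)$ for $H>0$, $W^*(0)=0$, $W^*(H)=+\infty$ for $H<0$. Dots denote derivatives with respect to the argument, and $\dot W^*(0):=\dot W^*(0^+)=\gamma$. Then $W^*\in C^3(0,\infty)$, $W^*(1)=0$, $W^*>0$ on $(0,\infty)\setminus\{1\}$, and $W^*$ is strictly concave on $[0,\kappa)$ and strictly convex on $(\kappa,\infty)$. The constant $\varepsilon>0$ is fixed. $\mathcal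 H=\{v\in H^1(0,1):\int_0^1 v\,ds=0\}$ is the Hilbert space with inner product $\langle u,v\rangle=\int_0^1u'v'\,ds$, and $\mathcal K=\{v\in\mathcal H: v\ge-1\text{ on }[0,1]\}$. For every $\lambda>0$, $u\equiv0$ is a solution of the variational inequality (the trivial solution). The shape of the graph of $\ddot W^*$ is such that for each $n\in\mathbb N$ the characteristic equation $$\frac{\varepsilon n^2\pi^2}{\lambda^2}=-\ddot W^*(1/\lambda)$$ has exactly one root $\lambda=\lambda_n>0$, which is simple and transversal (the two sides, as functions of $1/\lambda$, cross with different slopes), and $1/\kappa<\lambda_1<\lambda_2<\cdots$. *)

(* Defs.v *)
From HB Require Import structures.
From mathcomp Require Import all_boot all_order all_algebra.
From mathcomp Require Import all_classical all_reals all_analysis.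

Set Implicit Arguments.
Unset Strict Implicit.
Unset Printing Implicit Defensive.

Import Order.TTheory GRing.Theory Num.Theory.
Import numFieldNormedType.Exports.

Local Open Scope classical_set_scope.
Local Open Scope ring_scope.

Section Energy.
Context {R : realType}.
Implicit Types (W : R -> R) (H : R).

Definition strictly_convex_on (D : set R) (f : R -> R) : Prop :=
  forall x y t, D x -> D y -> x != y -> 0 < t < 1 ->
    f (t * x + (1 - t) * y) < t * f x + (1 - t) * f y.

Definition strictly_concave_on (D : set R) (f : R -> R) : Prop :=
  strictly_convex_on D (fun x => - f x).

Definition C3_on_pos (f : R -> R) : Prop :=
  (forall k x, (k < 3)%N -> 0 < x -> derivable (derive1n k f) x 1) /\
  (forall x, 0 < x -> {for x, continuous (derive1n 3 f)}).

Record energy_density W (gam kap : R) : Prop := EnergyDensity {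
  energy_C3 : C3_on_pos W;
  energy_cvg0 : W F @[F --> 0^'+] --> +oo;
  energy_mono0 : exists2 d, 0 < d &
    forall x y, 0 < x -> x <= y -> y < d -> W y <= W x;
  energy_gam : 0 < gam;
  energy_cvgy : W F @[F --> +oo] --> gam;
  energy_monoy : exists2 M, 0 < M &
    forall x y, M < x -> x <= y -> W x <= W y;
  energy_1 : W 1 = 0;
  energy_gt0 : forall F, 0 < F -> F != 1 -> 0 < W F;
  energy_kap : 0 < kap < 1;
  energy_convex : strictly_convex_on `]0, kap^-1[ W;
  energy_concave : strictly_concave_on `]kap^-1, +oo[ W }.

Definition Wstar W H : \bar R :=
  if H < 0 then +oo%E else if H == 0 then 0%E else (H * W H^-1)%:E.

(* First derivative of [Wstar] on [0, +oo[, with the value at 0 defined as the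
   limit from the right. [Wstar] is finite on [0, +oo[, so [fine] loses nothing
   there; values at negative arguments are junk. *)
Definition dWstar W H : R :=
  if H == 0 then lim (derive1 (fine \o Wstar W) x @[x --> 0^'+])
  else derive1 (fine \o Wstar W) H.

Definition ddWstar W : R -> R := derive1 (dWstar W).

Definition char_eq (eps : R) W (n : nat) (l : R) : Prop :=
  eps * n%:R ^+ 2 * pi ^+ 2 / l ^+ 2 = - ddWstar W l^-1.

(* [lam n] is the root for n >= 1; [lam 0] is unconstrained. Transversality
   compares the slopes of the two sides as functions of H = 1 / lambda. *)
Record char_roots (eps kap : R) W (lam : nat -> R) : Prop := CharRoots {
  char_root_gt0 : forall n, (0 < n)%N -> 0 < lam n;
  char_rootP : forall n, (0 < n)%N -> char_eq eps W n (lam n);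
  char_root_uniq :
    forall n l, (0 < n)%N -> 0 < l -> char_eq eps W n l -> l = lam n;
  char_root_transversal : forall n, (0 < n)%N ->
    derive1 (fun H => eps * n%:R ^+ 2 * pi ^+ 2 * H ^+ 2) (lam n)^-1
      != derive1 (fun H => - ddWstar W H) (lam n)^-1;
  char_root_kap : kap^-1 < lam 1;
  char_root_incr : forall m n, (0 < m)%N -> (m < n)%N -> lam m < lam n }.

End Energy.

Section Sobolev.
Variable R : realType.

Definition leb01 : {measure set (measurableTypeR R) -> \bar R} :=
  mrestr (@lebesgue_measure R) (measurable_itv `]0%R, 1%R[).

Definition test_function (phi : R -> R) : Prop :=
  [/\ forall x, derivable phi x 1, continuous (derive1 phi) &
    exists K : set R, [/\ compact K, K `<=` `]0, 1[ &
      forall x, ~ K x -> phi x = 0]].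

Definition weak_derivative (u g : R -> R) : Prop :=
  forall phi, test_function phi ->
    \int[lebesgue_measure]_(s in `]0%R, 1%R[) (u s * derive1 phi s) =
    - \int[lebesgue_measure]_(s in `]0%R, 1%R[) (g s * phi s).

(* A zero-mean element of H^1(0,1), presented by its continuous representative
   on [0,1] and a representative of its weak derivative. The values of either
   function off [0,1] are irrelevant. *)
Record h1fun := H1Fun {
  h1val : R -> R;
  h1der : R -> R;
  h1val_cont : {within `[0, 1], continuous h1val};
  h1der_L2 : (h1der : measurableTypeR R -> R) \in Lfun leb01 2%:E;
  h1der_weak : weak_derivative h1val h1der;
  h1val_mean : \int[lebesgue_measure]_(s in `[0%R, 1%R]) h1val s = 0 }.

HB.instance Definition _ := gen_eqMixin h1fun.
HB.instance Definition _ := gen_choiceMixin h1fun.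

Definition L2norm (g : R -> R) : R := fine ('N[leb01]_2%:E[EFin \o g])%E.

Definition h1dist (u v : h1fun) : R := L2norm (h1der u \- h1der v).

Lemma h1distxx u : h1dist u u = 0.
Proof.
rewrite /h1dist /L2norm (_ : _ \o _ = cst 0%E) ?Lnorm0//.
by apply/funext => x /=; rewrite subrr.
Qed.

Lemma h1distC u v : h1dist u v = h1dist v u.
Proof.
rewrite /h1dist /L2norm -oppe_Lnorm; congr (fine (Lnorm _ _ _)).
by apply/funext => x; rewrite /=; congr EFin; rewrite opprB.
Qed.

Lemma h1dist_triangle v u w : h1dist u w <= h1dist u v + h1dist v w.
Proof.
have l2B (f g : h1fun) :
    (h1der f \- h1der g : measurableTypeR R -> R) \in Lfun leb01 2%:E.
  by apply: (rpredB (h1der_L2 f) (h1der_L2 g)); rewrite lee_fin ler1n.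
have finB (f g : h1fun) :
    'N[leb01]_2%:E[EFin \o (h1der f \- h1der g)%R]%E \is a fin_num.
  rewrite ge0_fin_numE ?Lnorm_ge0//.
  by have /andP[_] := l2B f g; rewrite inE.
have mB (f g : h1fun) : measurable_fun [set: measurableTypeR R]
    (h1der f \- h1der g : measurableTypeR R -> R).
  by have /andP[] := l2B f g; rewrite inE.
rewrite /h1dist /L2norm -fineD// fine_le//.
  by rewrite fin_numD !finB.
apply: le_trans (eminkowski leb01 (mB u v) (mB v w) _).
  rewrite le_eqVlt; apply/orP; left; apply/eqP; congr (Lnorm _ _ _).
  by apply/funext => x /=; congr EFin; rewrite addrA subrK.
by rewrite lee_fin ler1n.
Qed.

Let h1dist_ge0 u v : 0 <= h1dist u v.
Proof. by rewrite fine_ge0 ?Lnorm_ge0. Qed.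

Definition h1eq (u v : h1fun) : bool := h1dist u v == 0.

Let h1eq_refl : reflexive h1eq.
Proof. by move=> u; rewrite /h1eq h1distxx. Qed.

Let h1eq_sym : symmetric h1eq.
Proof. by move=> u v; rewrite /h1eq h1distC. Qed.

Let h1eq_trans : transitive h1eq.
Proof.
move=> v u w /eqP uv /eqP vw; rewrite /h1eq eq_le h1dist_ge0 andbT.
by rewrite (le_trans (h1dist_triangle v u w))// uv vw addr0.
Qed.

Canonical h1eq_equiv := EquivRel h1eq h1eq_refl h1eq_sym h1eq_trans.

Local Open Scope quotient_scope.

(* The space of zero-mean functions of H^1(0,1), elements at distance 0 being
   identified, as a metric space for the norm of the inner product. *)
Definition H1m : Type := {eq_quot h1eq}.
HB.instance Definition _ := Choice.on H1m.
HB.instance Definition _ := EqQuotient.on H1m.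

Definition h1m_dist (u v : H1m) : R := h1dist (repr u) (repr v).

Let h1m_distxx u : h1m_dist u u = 0. Proof. exact: h1distxx. Qed.

Let h1m_dist_eq0 u v : h1m_dist u v = 0 -> u = v.
Proof.
move=> uv; rewrite -[u]reprK -[v]reprK; apply/eqP; rewrite eqmodE.
by rewrite /= /h1eq; apply/eqP.
Qed.

Let h1m_distC u v : h1m_dist u v = h1m_dist v u. Proof. exact: h1distC. Qed.

Let h1m_dist_triangle v u w : h1m_dist u w <= h1m_dist u v + h1m_dist v w.
Proof. exact: h1dist_triangle. Qed.

HB.instance Definition _ := @isMetric.Build R H1m h1m_dist
  h1m_distxx h1m_dist_eq0 h1m_distC h1m_dist_triangle.

Definition h1m_fun (u : H1m) : R -> R := h1val (repr u).
Definition h1m_der (u : H1m) : R -> R := h1der (repr u).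

(* |u| = <u, u>^(1/2), the L^2 norm of u' *)
Definition h1m_norm (u : H1m) : R := L2norm (h1m_der u).

Let zero_cont : {within `[0, 1], continuous (cst 0 : R -> R)}.
Proof. by apply: continuous_subspaceT => x; exact: cst_continuous. Qed.

Let zero_L2 : (cst 0 : measurableTypeR R -> R) \in Lfun leb01 2%:E.
Proof.
rewrite inE; apply/andP; split; rewrite inE //=.
by apply: finite_norm_cst0; rewrite lee_fin ler1n.
Qed.

Let zero_weak : weak_derivative (cst 0) (cst 0).
Proof.
move=> phi _; rewrite /Rintegral.
under eq_integral do rewrite mul0r.
under [in RHS]eq_integral do rewrite mul0r.
by rewrite integral0 /= oppr0.
Qed.

Let zero_mean : \int[lebesgue_measure]_(s in `[0%R, 1%R]) (cst 0 s : R) = 0.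
Proof. by rewrite /Rintegral integral0. Qed.

Definition h1m_zero : H1m :=
  \pi_H1m (H1Fun zero_cont zero_L2 zero_weak zero_mean).

End Sobolev.

Coercion h1m_fun : H1m >-> Funclass.
Arguments h1m_zero {R}.

Section Bifurcation.
Context {R : realType}.
Implicit Types (eps : R) (W : R -> R) (u v : H1m R).

Definition obstacle_set : set (H1m R) :=
  [set v : H1m R | forall s, 0 <= s <= 1 -> -1 <= v s].

Definition VI_solution eps W (l : R) u : Prop :=
  [/\ 0 < l, obstacle_set u & forall v, obstacle_set v ->
    0 <= \int[lebesgue_measure]_(s in `[0%R, 1%R])
      (eps * h1m_der u s * (h1m_der v s - h1m_der u s) +
       l ^+ 3 * dWstar W ((1 + u s) / l) * (v s - u s))].

Definition nontrivial_solutions eps W : set (R * H1m R) :=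
  [set p | VI_solution eps W p.1 p.2 /\ p.2 <> h1m_zero].

(* closure relative to ]0, +oo[ * obstacle_set *)
Definition solution_set eps W : set (R * H1m R) :=
  closure (nontrivial_solutions eps W) `&`
  ([set l : R | 0 < l] `*` obstacle_set).

Definition branch eps W (l : R) : set (R * H1m R) :=
  connected_component (solution_set eps W) (l, h1m_zero).

Definition unbounded (C : set (R * H1m R)) : Prop :=
  ~ exists M : R, forall p, C p -> `|p.1| <= M /\ h1m_norm p.2 <= M.

End Bifurcation.

(* Main.v *)
Require Import Defs.
From HB Require Import structures.
From mathcomp Require Import all_boot all_order all_algebra.
From mathcomp Require Import all_classical all_reals all_analysis.
From mathcomp Require Import ring lra.

Set Implicit Arguments.
Unset Strict Implicit.
Unset Printing Implicit Defensive.

Import Order.TTheory GRing.Theory Num.Theory.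
Import numFieldNormedType.Exports.
Import measurable_realfun.

Local Open Scope classical_set_scope.
Local Open Scope ring_scope.

(** The first alternative always holds. The component of the bifurcation point
    contains an explicit connected family of solutions, which leads from there
    to profiles in contact with the obstacle and then, along these, to
    arbitrarily large loads.

    In terms of the strain h = (1 + u) / lambda and of the time y = lambda s, a
    solution away from the obstacle satisfies eps h'' = w'(h) - sigma for a
    constant sigma, with h' = 0 at both ends and total mass, the integral of h,
    equal to one; here w is the dual energy. A solution that makes n monotone
    runs between a minimum a and a maximum b conserves the energy
    eps h'^2 / 2 = (excess of w over its chord on [a, b]). In the angle theta of
    h = (a + b) / 2 - (b - a) / 2 cos theta this reads theta' = speed, where
    speed^2 is 2 / eps times curv, minus the second divided difference of w at
    a, h and b. Divided differences being continuous up to a = b, all pairs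
    q = (b, x) with a = x b and curv positive (the admissible ones) are treated
    alike, the constant profiles x = 1 included. Time (clock) and mass are then
    integrals in the angle; the load is clock q (n pi), and the only equation
    left is mass q (n pi) = 1. On the diagonal x = 1 it is the characteristic
    equation. Where x = 0 the profile touches the obstacle with zero slope and
    may rest there for any duration L without changing its mass, which adds L
    to the load: these are solutions as well, since the multiplier has the
    right sign on the contact set (profile_solution, slope_lo_gt).

    It remains to join the diagonal to x = 0 by parameters of mass one. In a
    rectangle of parameters (b, x) the mass is below one on the side b = del
    (left_side), whereas on b = 1 it exceeds one or the parameter is not
    admissible (right_side). Close to inadmissible parameters the mass is large
    (escape); hence the parameters of mass one form a compact set
    containing the frontier between the two sides, and x = 1 is met only at
    b = 1 / lambda_n. Sperner's lemma on grids, together with the agreement of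
    components and quasi-components in compact sets, shows that the component
    of that point reaches x = 0 (component_crosses).

    A point of the space is reached through its weak derivative (h1_of_der);
    convergence of these, uniform in s, makes the family continuous
    (branch_map_cts). All its members are nontrivial except the bifurcation
    point, which belongs to their closure because a connected set with more than
    one point has no isolated point. *)

(** * Calculus on the real line *)

Section Primitives.
Context {R : realType}.
Implicit Types f F g : R -> R.

Lemma is_derive_cts f x d : is_derive x (1 : R) f d -> {for x, continuous f}.
Proof.
by move=> df; apply: differentiable_continuous; apply/derivable1_diffP; case: df.
Qed.

Lemma mean_value F f x y : (forall z, is_derive z (1 : R) F (f z)) ->
  exists c, [/\ Num.min x y <= c, c <= Num.max x y & F y - F x = f c * (y - x)].
Proof.
move=> dF; wlog xy : x y / x <= y => [H|].
  have /orP[xy|yx] := le_total x y; first exact: H.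
  have [c [c1 c2 e]] := H _ _ yx; exists c; split.
  - by rewrite minC.
  - by rewrite maxC.
  - by rewrite -[LHS]opprB e; ring.
have [|c] := @MVT_segment R F f _ _ xy (fun z _ => dF z).
- by apply: continuous_subspaceT => z; exact: is_derive_cts (dF z).
- rewrite in_itv/= => /andP[xc cy] e; exists c; split => //.
    by rewrite min_l.
  by rewrite max_r.
Qed.

Lemma primitive_unique F G f : (forall z, is_derive z (1 : R) F (f z)) ->
  (forall z, is_derive z (1 : R) G (f z)) -> forall x, F x - F 0 = G x - G 0.
Proof.
move=> dF dG x.
have h z : is_derive z (1 : R) (F - G) 0.
  by rewrite -(subrr (f z)); exact: is_deriveB.
have := @is_derive_0_is_cst R (F - G) x 0 h.
rewrite /= => /(f_equal (fun t => t + G x - F 0)); rewrite !fctE /=.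
by lra.
Qed.

Lemma primitive_exists f : continuous f ->
  exists F, F 0 = 0 /\ forall z, is_derive z (1 : R) F (f z).
Proof.
move=> cf.
have intf (a b : R) : (@lebesgue_measure R).-integrable `[a, b] (EFin \o f).
  apply: continuous_compact_integrable; first exact: segment_compact.
  exact: continuous_subspaceT.
pose P (a x : R) := \int[lebesgue_measure]_(t in `[a, x]) f t.
have dP (a x : R) : a < x -> is_derive x (1 : R) (P a) (f x).
  move=> ax; have x1 : x < x + 1 by rewrite ltrDl.
  have [h1 h2] := continuous_FTC1_closed x1 (intf a _) ax (cf x).
  by apply: DeriveDef; [exact: h1|rewrite -derive1E].
have loc (a x y : R) : a < 0 -> a < x -> a < y -> forall b, b <= a ->
    P a x - P a y = P b x - P b y.
  move=> a0 ax ay b ba.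
  pose l := Num.min x y; pose r := Num.max x y.
  have H u v : a < u -> u <= v -> P a v - P a u = P b v - P b u.
    move=> au; rewrite le_eqVlt => /predU1P[->|uv]; first by rewrite !subrr.
    have h z : z \in `]u, v[ -> is_derive z (1 : R) (P a - P b) 0.
      rewrite in_itv/= => /andP[uz _]; rewrite -(subrr (f z)).
      apply: is_deriveB; apply: dP; first exact: lt_trans uz.
      by apply: le_lt_trans ba _; exact: lt_trans uz.
    have [|c _] := MVT uv h.
      apply: continuous_in_subspaceT => z; rewrite inE/= in_itv/= => /andP[uz _].
      apply: (@is_derive_cts _ _ (f z - f z)).
      apply: is_deriveB; apply: dP; first exact: lt_le_trans uz.
      by apply: le_lt_trans ba _; exact: lt_le_trans uz.
    rewrite mul0r !fctE /=.
    set A := P a v; set B := P b v; set C := P a u; set D := P b u; lra.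
  have [xy|/ltW yx] := leP x y.
    by have := H _ _ ax xy; lra.
  exact: H.
pose F x := P (- `|x| - 1) x - P (- `|x| - 1) 0.
have FE a x : a <= - `|x| - 1 -> F x = P a x - P a 0.
  by move=> ax; rewrite /F; apply: loc => //;
    have := normr_ge0 x; have := ler_norm (- x); rewrite normrN; lra.
exists F; split; first by rewrite /F subrr.
move=> z.
pose a := - `|z| - 2.
have : is_derive z (1 : R) (P a - cst (P a 0)) (f z).
  rewrite -(subr0 (f z)); apply: is_deriveB; apply: dP.
  rewrite /a; have := ler_norm (- z); rewrite normrN; lra.
apply: near_eq_is_derive.
near=> y; rewrite (FE a) //= /a.
have : `|y - z| < 1.
  by rewrite distrC; near: y; apply: (@nbhsx_ballx R R z 1).
have := Num.Theory.ler_normD (y - z) z; rewrite subrK; lra.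
Unshelve. all: by end_near. Qed.

Definition prim f : R -> R :=
  xget (cst 0) [set F | F 0 = 0 /\ forall z, is_derive z (1 : R) F (f z)].

Lemma primP f : continuous f ->
  prim f 0 = 0 /\ forall z, is_derive z (1 : R) (prim f) (f z).
Proof.
move=> /primitive_exists [F hF].
exact: (@xgetPex _ _ [set F | F 0 = 0 /\
  forall z, is_derive z (1 : R) F (f z)]) (ex_intro _ F hF).
Qed.

Lemma prim0 f : continuous f -> prim f 0 = 0.
Proof. by move=> /primP[]. Qed.

Lemma is_derive_prim f z : continuous f -> is_derive z (1 : R) (prim f) (f z).
Proof. by move=> /primP[]. Qed.

Lemma prim_cts f : continuous f -> continuous (prim f).
Proof. by move=> cf x; exact: is_derive_cts (is_derive_prim x cf). Qed.

Lemma primE F f x : continuous f -> (forall z, is_derive z (1 : R) F (f z)) ->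
  prim f x = F x - F 0.
Proof.
move=> cf dF; have := primitive_unique (fun z => is_derive_prim z cf) dF x.
by rewrite prim0// subr0.
Qed.

Lemma is_derive_ext F (a b : R) z : is_derive z (1 : R) F a -> a = b ->
  is_derive z (1 : R) F b.
Proof. by move=> ? <-. Qed.

Lemma is_derive_add F G (a b z : R) : is_derive z (1 : R) F a ->
  is_derive z (1 : R) G b -> is_derive z (1 : R) (fun x => F x + G x) (a + b).
Proof. exact: is_deriveD. Qed.

Lemma is_derive_sub F G (a b z : R) : is_derive z (1 : R) F a ->
  is_derive z (1 : R) G b -> is_derive z (1 : R) (fun x => F x - G x) (a - b).
Proof. exact: is_deriveB. Qed.

Lemma is_derive_scale F (c a z : R) : is_derive z (1 : R) F a ->
  is_derive z (1 : R) (fun x => c * F x) (c * a).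
Proof. exact: is_deriveZ. Qed.

Lemma is_derive_mul F G (a b z : R) : is_derive z (1 : R) F a ->
  is_derive z (1 : R) G b ->
  is_derive z (1 : R) (fun x => F x * G x) (a * G z + F z * b).
Proof.
move=> dF dG; apply: (is_derive_ext (is_deriveM dF dG)).
by rewrite /GRing.scale/= addrC mulrC.
Qed.

Lemma is_derive_chain F G (a b z : R) : is_derive (G z) (1 : R) F a ->
  is_derive z (1 : R) G b -> is_derive z (1 : R) (fun x => F (G x)) (a * b).
Proof. exact: is_derive1_comp. Qed.

Lemma is_derive_recip (z : R) : z != 0 ->
  is_derive z (1 : R) (fun x => x^-1) (- z ^- 2).
Proof.
move=> z0; apply: (is_derive_ext (@is_deriveV R id z 1 1 z0 (is_derive_id z (1 : R)))).
by rewrite /GRing.scale/= mulr1.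
Qed.

Lemma is_derive_pow n (z : R) :
  is_derive z (1 : R) (fun x => x ^+ n) (n%:R * z ^+ n.-1).
Proof.
have h := DeriveDef (@exprn_derivable R n z 1) (@exp_derive R n z 1).
have e : n%:R *: z ^+ n.-1 *: 1 = n%:R * z ^+ n.-1 :> R.
  by rewrite /GRing.scale/= mulr1.
by rewrite -e; exact: h.
Qed.

Lemma is_derive_linear (c z : R) : is_derive z (1 : R) (fun x => c * x) c.
Proof.
apply: (is_derive_ext (is_derive_scale c (is_derive_id z (1 : R)))).
by rewrite mulr1.
Qed.

Lemma derive_ge0_le F f x y : (forall z, is_derive z (1 : R) F (f z)) ->
  x <= y -> (forall z, x <= z <= y -> 0 <= f z) -> F x <= F y.
Proof.
move=> dF xy f0; have [c [+ + e]] := mean_value x y dF.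
rewrite min_l// max_r// => xc cy; rewrite -subr_ge0 e mulr_ge0 ?subr_ge0//.
by apply: f0; rewrite xc.
Qed.

Lemma mean_value_on F f (x y : R) : x < y ->
  (forall z : R, x <= z <= y -> is_derive z (1 : R) F (f z)) ->
  exists2 c, x < c < y & F y - F x = f c * (y - x).
Proof.
move=> xy dF; have [z||c] := @MVT R F f x y xy.
- by rewrite in_itv/= => /andP[/ltW xz /ltW zy]; apply: dF; rewrite xz.
- apply: continuous_in_subspaceT => z; rewrite inE/= in_itv/= => zxy.
  exact: is_derive_cts (dF z zxy).
- by rewrite in_itv/= => ? ?; exists c.
Qed.

Lemma mean_value_open F f (x y : R) : x < y -> continuous F ->
  (forall z : R, x < z < y -> is_derive z (1 : R) F (f z)) ->
  exists2 c, x < c < y & F y - F x = f c * (y - x).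
Proof.
move=> xy cF dF; have [|c] := @MVT R F f x y xy (fun z zxy => dF z zxy).
- exact: continuous_subspaceT.
- by rewrite in_itv/= => ? ?; exists c.
Qed.

Lemma derive_ge0_le_on F f (x y : R) : x <= y ->
  (forall z : R, x <= z <= y -> is_derive z (1 : R) F (f z)) ->
  (forall z, x <= z <= y -> 0 <= f z) -> F x <= F y.
Proof.
rewrite le_eqVlt => /predU1P[-> //|xy] dF f0.
have [c /andP[xc cy] e] := mean_value_on xy dF.
by rewrite -subr_ge0 e mulr_ge0 ?f0 ?subr_ge0 ?ltW// !ltW.
Qed.

Lemma prim_dist_le f g e x : continuous f -> continuous g ->
  (forall z, Num.min 0 x <= z <= Num.max 0 x -> `|f z - g z| <= e) ->
  `|prim f x - prim g x| <= e * `|x|.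
Proof.
move=> cf cg fg.
have h z : is_derive z (1 : R) (prim f - prim g) (f z - g z).
  by apply: is_deriveB; exact: is_derive_prim.
have [c [c1 c2]] := mean_value 0 x h.
rewrite !fctE !prim0// subrr !subr0 => ->; rewrite normrM ler_wpM2r//.
by apply: fg; rewrite c1.
Qed.

Lemma prim_cst (c : R) x : prim (cst c) x = c * x.
Proof.
have d z : is_derive z (1 : R) (fun x => c * x) (cst c z).
  exact: is_derive_linear.
by rewrite (primE x _ d) ?mulr0 ?subr0// => ?; exact: cvg_cst.
Qed.

End Primitives.

(** * Continuity in several variables *)

Section Continuity.
Context {X Y Z : topologicalType}.

Lemma cts_pair (f : X -> Y) (g : X -> Z) x : {for x, continuous f} ->
  {for x, continuous g} -> {for x, continuous (fun z => (f z, g z))}.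
Proof.
move=> cf cg.
exact: (@cvg_pair _ _ _ (nbhs x) (nbhs (f x)) (nbhs (g x)) _ _ _ f g cf cg).
Qed.

Lemma cts_comp (f : X -> Y) (g : Y -> Z) x : {for x, continuous f} ->
  {for f x, continuous g} -> {for x, continuous (fun z => g (f z))}.
Proof. exact: continuous_comp. Qed.

Lemma cts_fst (z : X * Y) : {for z, continuous (fun z : X * Y => z.1)}.
Proof. exact: cvg_fst. Qed.

Lemma cts_snd (z : X * Y) : {for z, continuous (fun z : X * Y => z.2)}.
Proof. exact: cvg_snd. Qed.

Lemma cts_cst (x : X) (y : Y) : {for x, continuous (fun=> y)}.
Proof. exact: cvg_cst. Qed.

End Continuity.

Section RealContinuity.
Context {R : realType} {X : topologicalType}.
Implicit Types (f g : X -> R) (x : X).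

Lemma cts_add f g x : {for x, continuous f} -> {for x, continuous g} ->
  {for x, continuous (fun z => f z + g z)}.
Proof. exact: continuousD. Qed.

Lemma cts_sub f g x : {for x, continuous f} -> {for x, continuous g} ->
  {for x, continuous (fun z => f z - g z)}.
Proof. exact: continuousB. Qed.

Lemma cts_mul f g x : {for x, continuous f} -> {for x, continuous g} ->
  {for x, continuous (fun z => f z * g z)}.
Proof. exact: continuousM. Qed.

Lemma cts_inv f x : f x != 0 -> {for x, continuous f} ->
  {for x, continuous (fun z => (f z)^-1)}.
Proof. exact: cvgV. Qed.

Lemma cts_min f g x : {for x, continuous f} -> {for x, continuous g} ->
  {for x, continuous (fun z => Num.min (f z) (g z))}.
Proof. exact: continuous_min. Qed.

Lemma cts_max f g x : {for x, continuous f} -> {for x, continuous g} ->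
  {for x, continuous (fun z => Num.max (f z) (g z))}.
Proof. exact: continuous_max. Qed.

Lemma cts_norm f x : {for x, continuous f} ->
  {for x, continuous (fun z => `|f z|)}.
Proof. by move=> cf; apply: cts_comp cf _; exact: norm_continuous. Qed.

Lemma cts_sqrt f x : {for x, continuous f} ->
  {for x, continuous (fun z => Num.sqrt (f z))}.
Proof. by move=> cf; apply: cts_comp cf _; exact: sqrt_continuous. Qed.

Lemma cts_cos f x : {for x, continuous f} ->
  {for x, continuous (fun z => cos (f z))}.
Proof. by move=> cf; apply: cts_comp cf _; exact: continuous_cos. Qed.

Lemma cts_sin f x : {for x, continuous f} ->
  {for x, continuous (fun z => sin (f z))}.
Proof. by move=> cf; apply: cts_comp cf _; exact: continuous_sin. Qed.

End RealContinuity.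

Section ParameterDependence.
Context {R : realType} {T : topologicalType}.

(** The tube lemma. *)
Lemma near_compact (X : topologicalType) (K : set X) (P : T -> X -> Prop) (p : T) :
  compact K -> (forall x, K x -> \forall z \near (p, x), P z.1 z.2) ->
  \forall q \near p, forall x, K x -> P q x.
Proof.
move=> cK hP; have := iffLR (compact_near_coveringP K) cK T (nbhs p) P _.
apply => x Kx; have [[A B] [/= pA xB] AB] := hP x Kx.
by exists (B, A) => //= -[y q] /= [By Aq]; exact: (AB (q, y)).
Qed.

Lemma near_uniform (X : topologicalType) (K : set X) (f : T -> X -> R) (p : T) :
  compact K ->
  (forall x, K x -> {for (p, x), continuous (fun z : T * X => f z.1 z.2)}) ->
  forall e, 0 < e -> \forall q \near p, forall x, K x -> `|f q x - f p x| < e.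
Proof.
move=> cK cf e e0.
apply: (near_compact (P := fun q x => `|f q x - f p x| < e) cK) => x Kx.
have e2 : 0 < e / 2 by rewrite divr_gt0.
have /cvgrPdist_lt/(_ _ e2)[[A B] [/= pA xB] AB] := cf x Kx.
exists (A, B) => //= -[q y] /= [Aq By].
have := AB (q, y) (conj Aq By).
have := AB (p, y) (conj (nbhs_singleton pA) By).
rewrite /= => h1 h2.
rewrite -(subrK (f p x) (f q y)) -addrA (le_lt_trans (ler_normD _ _))//.
by rewrite distrC (splitr e) ltrD.
Qed.

Lemma near_fst (X : topologicalType) (p : T) (x : X) (P : T -> Prop) :
  (\forall q \near p, P q) -> \forall z \near (p, x), P z.1.
Proof. by move=> hP; exists (P, setT) => [|z []//]; split=> //; exact: filterT. Qed.

Lemma near_snd (X : topologicalType) (p : T) (x : X) (P : X -> Prop) :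
  (\forall y \near x, P y) -> \forall z \near (p, x), P z.2.
Proof. by move=> hP; exists (setT, P) => [|z []//]; split=> //; exact: filterT. Qed.

Lemma prim_param_cts (f : T -> R -> R) (p : T) :
  (\forall q \near p, continuous (f q)) ->
  (forall x, {for (p, x), continuous (fun z : T * R => f z.1 z.2)}) ->
  forall x, {for (p, x), continuous (fun z : T * R => prim (f z.1) z.2)}.
Proof.
move=> cfq cf x; apply/cvgrPdist_lt => e e0 /=.
have cfp : continuous (f p) by exact: nbhs_singleton cfq.
pose M := `|x| + 1; have M0 : 0 < M by rewrite ltr_pwDr.
have e2 : 0 < e / 2 by rewrite divr_gt0.
have eM : 0 < e / 2 / M by rewrite divr_gt0.
have cK : compact `[- M, M] by exact: segment_compact.
have hu := near_uniform cK (fun x _ => cf x) eM.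
have /cvgrPdist_lt/(_ _ e2) hx := @prim_cts _ _ cfp x.
have n1 := near_snd p (@nbhsx_ballx R R x 1 ltr01).
have n2 := near_snd p hx; have n3 := near_fst x cfq; have n4 := near_fst x hu.
near=> z.
have hz1 : `|z.2| < M.
  rewrite -(subrK x z.2) addrC (le_lt_trans (ler_normD _ _))// ltrD2l.
  by rewrite distrC; near: z.
have hz2 : `|prim (f p) x - prim (f p) z.2| < e / 2.
  by near: z.
have hz3 : `|prim (f p) z.2 - prim (f z.1) z.2| <= e / 2 / M * `|z.2|.
  apply: prim_dist_le => //.
    by near: z.
  move=> y hy.
  have hyM : `[- M, M]%classic y.
    rewrite /= in_itv/= -ler_norml; apply: le_trans (ltW hz1).
    move: hy; have [z0|z0] := leP 0 z.2.
      by move=> /andP[y0 yz]; rewrite !ger0_norm.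
    by move=> /andP[y0 yz]; rewrite !ler0_norm ?lerN2// ltW.
  rewrite distrC ltW//; by move: y hyM {hy}; near: z.
rewrite -(subrK (prim (f p) z.2) (prim (f p) x)) -addrA.
rewrite (le_lt_trans (ler_normD _ _))// (splitr e) ltr_leD//.
apply: le_trans hz3 _; rewrite -[leRHS]mulr1 -mulrA ler_wpM2l ?ltW//.
by rewrite mulrC ltr_pdivrMr// mul1r.
Unshelve. all: by end_near. Qed.

(** That the inverse at y lies within e of t is an open condition on the
    parameter and on y, as it says that Y q (t - e) < y < Y q (t + e). *)
Lemma inverse_param_cts (Y Th : T -> R -> R) (p : T) :
  (\forall q \near p, {homo Y q : x y / x < y} /\ cancel (Th q) (Y q)) ->
  (forall x, {for (p, x), continuous (fun z : T * R => Y z.1 z.2)}) ->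
  forall y, {for (p, y), continuous (fun z : T * R => Th z.1 z.2)}.
Proof.
move=> hq cY y; apply/cvgrPdist_lt => e e0 /=.
pose t := Th p y.
have [hp Kp] := nbhs_singleton hq.
have lo : Y p (t - e) < y by rewrite -[ltRHS]Kp; apply: hp; rewrite ltrBlDr ltrDl.
have hi : y < Y p (t + e) by rewrite -[ltLHS]Kp; apply: hp; rewrite ltrDl.
have cfst x : Y z.1 x @[z --> (p, y)] --> Y p x.
  have cg : {for (p, y), continuous (fun z : T * R => (z.1, x))}.
    by apply: cts_pair; [exact: cts_fst|exact: cts_cst].
  exact: (cts_comp cg (cY x)).
have csnd : (z : T * R).2 @[z --> (p, y)] --> y by exact: cvg_snd.
have n1 := near_fst y hq.
have n2 : \forall z \near (p, y), 0 < z.2 - Y z.1 (t - e).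
  have : z.2 - Y z.1 (t - e) @[z --> (p, y)] --> y - Y p (t - e).
    exact: cvgB.
  by move=> /cvgr_gt; apply; rewrite subr_gt0.
have n3 : \forall z \near (p, y), 0 < Y z.1 (t + e) - z.2.
  have : Y z.1 (t + e) - z.2 @[z --> (p, y)] --> Y p (t + e) - y.
    exact: cvgB.
  by move=> /cvgr_gt; apply; rewrite subr_gt0.
near=> z.
have [hz Kz] : {homo Y z.1 : x y / x < y} /\ cancel (Th z.1) (Y z.1).
  by near: z.
have mono : {mono Y z.1 : x y / x < y}.
  exact: leW_mono (le_mono hz).
have h1 : Y z.1 (t - e) < z.2.
  by rewrite -subr_gt0; near: z.
have h2 : z.2 < Y z.1 (t + e).
  by rewrite -subr_gt0; near: z.
move: h1 h2; rewrite -[z.2]Kz !mono Kz -/t => h1 h2.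
by rewrite distrC ltr_norml; apply/andP; split; lra.
Unshelve. all: by end_near. Qed.

End ParameterDependence.

(** * Components in the plane *)

Section Grid.
Variables (n m : nat) (A U : nat -> nat -> bool).

(** The three labels of Sperner's lemma are A, U outside A, and neither. *)
Definition trichromatic i j :=
  let c := [:: (i, j); (i.+1, j); (i, j.+1); (i.+1, j.+1)] in
  [&& has (fun p => A p.1 p.2) c, has (fun p => ~~ A p.1 p.2 && U p.1 p.2) c
    & has (fun p => ~~ A p.1 p.2 && ~~ U p.1 p.2) c].

(** Count modulo two the edges of a row between the first two labels. A cell
    that is not trichromatic has an even number of them, so that the count is
    the same on all rows; it is odd on the bottom row and zero on the top. *)
Lemma grid_trichromatic :
  (forall j, (j <= m)%N -> A 0 j) -> (forall j, (j <= m)%N -> ~~ A n j) ->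
  (forall i, (i <= n)%N -> U i 0) -> (forall i, (i <= n)%N -> ~~ U i m) ->
  exists i j, [/\ (i < n)%N, (j < m)%N & trichromatic i j].
Proof.
move=> A0 An U0 Um.
pose e p q := let L p := A p.1 p.2 in let M p := ~~ A p.1 p.2 && U p.1 p.2 in
  (L p && M q) || (M p && L q) : bool.
have cell i j : ~~ trichromatic i j ->
    e (i, j.+1) (i.+1, j.+1) =
    e (i, j) (i.+1, j) (+) e (i, j) (i, j.+1) (+) e (i.+1, j) (i.+1, j.+1).
  rewrite /trichromatic /e /=.
  by case: (A i j); case: (A i.+1 j); case: (A i j.+1); case: (A i.+1 j.+1);
    case: (U i j); case: (U i.+1 j); case: (U i j.+1); case: (U i.+1 j.+1).
pose E i j := \big[addb/false]_(k < i) e (nat_of_ord k, j) (k.+1, j).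
have ES i j : E i.+1 j = E i j (+) e (i, j) (i.+1, j).
  by rewrite /E big_ord_recr.
have E0 j : E 0 j = false by rewrite /E big_ord0.
apply: contrapT => H.
have nt i j : (i < n)%N -> (j < m)%N -> ~~ trichromatic i j.
  by move=> i_n jm; apply/negP => t; apply: H; exists i, j.
have row j : (j < m)%N -> E n j.+1 = E n j.
  move=> jm.
  have -> : E n j = E n j (+) e (0, j) (0, j.+1) (+) e (n, j) (n, j.+1).
    rewrite /e /= !A0 ?(ltnW jm)// (negbTE (An _ jm)) (negbTE (An _ (ltnW jm))).
    by rewrite /= andbF !addbF.
  have : (n <= n)%N by [].
  elim: {1 3 4 5 6}n => [|i IH] i_n.
    by rewrite !E0 /= addbb.
  rewrite !ES IH 1?ltnW// cell ?nt//.
  by case: (E i j); case: (e (i, j) _); case: (e (i, j) _);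
    case: (e (0, j) _); case: (e (i.+1, j) _).
have top : E n m = false.
  have : (n <= n)%N by [].
  elim: {1 3}n => [|i IH] i_n; first exact: E0.
  by rewrite ES IH 1?ltnW// /e /= !(negbTE (Um _ _))// 1?ltnW// !andbF.
have bot i : (i <= n)%N -> E i 0 = ~~ A i 0.
  elim: i => [|i IH] i_n; first by rewrite E0 A0.
  rewrite ES IH 1?ltnW// /e /= !U0// 1?ltnW//.
  by case: (A i 0); case: (A i.+1 0).
have all j : (j <= m)%N -> E n j = E n 0.
  by elim: j => [//|j IH] jm; rewrite row// IH// ltnW.
by have := all m (leqnn m); rewrite top bot// (An 0).
Qed.

End Grid.

Section Crossing.
Context {R : realType}.

Definition rectangle (l u : R) : set (R * R) := `[l, u]%classic `*` `[0, 1]%classic.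

Lemma compact_rectangle l u : compact (rectangle l u).
Proof. by apply: compact_setX; exact: segment_compact. Qed.

(** Trichromatic cells of finer and finer grids cluster at a common point of
    both frontiers. *)
Lemma frontiers_meet (l u : R) (A U : set (R * R)) : l < u ->
  (forall x, 0 <= x <= 1 -> A (l, x)) -> (forall x, 0 <= x <= 1 -> ~ A (u, x)) ->
  (forall b, l <= b <= u -> U (b, 0)) -> (forall b, l <= b <= u -> ~ U (b, 1)) ->
  let Q := rectangle l u in
  exists z, [/\ Q z, closure (Q `&` A) z, closure (Q `&` ~` A) z,
    closure (Q `&` U) z & closure (Q `&` ~` U) z].
Proof.
move=> lu Al Au U0 U1 Q.
pose P N (i j : nat) : R * R :=
  (l + (u - l) * (i%:R / N.+1%:R), j%:R / N.+1%:R).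
have ul0 : 0 < u - l by rewrite subr_gt0.
have frac N i : (i <= N.+1)%N -> 0 <= (i%:R / N.+1%:R : R) <= 1.
  move=> iN; rewrite divr_ge0//= ler_pdivrMr ?ltr0n// mul1r ler_nat//.
have bnd N i : (i <= N.+1)%N -> l <= l + (u - l) * (i%:R / N.+1%:R) <= u.
  move=> /frac/andP[h1 h2]; apply/andP; split.
    by rewrite lerDl mulr_ge0// ltW.
  rewrite -lerBrDl -[leRHS]mulr1 ler_wpM2l// ltW//.
have PQ N i j : (i <= N.+1)%N -> (j <= N.+1)%N -> Q (P N i j).
  by move=> iN jN; split; rewrite /= in_itv/=; [exact: bnd|exact: frac].
have H N : exists i j, [/\ (i < N.+1)%N, (j < N.+1)%N &
    trichromatic (fun i j => `[< A (P N i j) >]) (fun i j => `[< U (P N i j) >]) i j].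
  apply: grid_trichromatic => k kN.
  - by apply/asboolP; rewrite /P mul0r mulr0 addr0; apply/Al/frac.
  - apply/asboolPn; rewrite /P divff ?mulr1 ?pnatr_eq0// addrC subrK.
    exact/Au/frac.
  - by apply/asboolP; rewrite /P mul0r; exact/U0/bnd.
  - by apply/asboolPn; rewrite /P divff ?pnatr_eq0//; exact/U1/bnd.
have /choice[i /choice[j hij]] := H.
pose z N := P N (i N) (j N).
have zQ N : Q (z N) by have [? ? _] := hij N; apply: PQ; exact: ltnW.
have [|zz [Qzz clz]] := @compact_rectangle l u (z @ \oo) _.
  by exists 0%N => // N _; exact: zQ.
have near_cell (B : set (R * R)) : nbhs zz B -> exists N, forall p : nat * nat,
    (i N <= p.1 <= (i N).+1)%N -> (j N <= p.2 <= (j N).+1)%N -> B (P N p.1 p.2).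
  move=> /nbhs_ballP[e /= e0 eB].
  have e2 : 0 < e / 2 by rewrite divr_gt0.
  have [N0 hN0] : exists N0 : nat, forall N, (N0 <= N)%N ->
      (u - l + 1) / N.+1%:R < e / 2.
    exists (Num.bound ((u - l + 1) / (e / 2))) => N hN.
    rewrite ltr_pdivrMr ?ltr0n// mulrC -ltr_pdivrMr//.
    have := @archi_boundP R ((u - l + 1) / (e / 2)).
    move=> /(_ _)/lt_le_trans; apply; last by rewrite ler_nat leqW.
    by rewrite divr_ge0// ltW// addr_gt0.
  have [_ [/= [N hN <-] zB]] := clz (z @` [set N | (N0 <= N)%N]) (ball zz (e / 2))
    (ex_intro2 _ _ N0 I (fun N hN => ex_intro2 _ _ N hN erefl))
    (nbhsx_ballx _ _ e2).
  exists N => p hp1 hp2; apply: eB.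
  have step (a b : nat) : (a <= b <= a.+1)%N ->
      `|a%:R / N.+1%:R - b%:R / N.+1%:R : R| <= N.+1%:R^-1.
    move=> /andP[ab ba]; rewrite -mulrBl normrM.
    rewrite [X in _ * X]ger0_norm ?invr_ge0// ler_piMl ?invr_ge0//.
    by rewrite distrC -natrB// normr_nat lern1 leq_subLR addn1.
  have lt1 := hN0 N hN.
  have N1 : 0 < (N.+1%:R^-1 : R) by rewrite invr_gt0 ltr0n.
  have [z1 z2] := zB.
  have e_2 := splitr e.
  have d1 := step _ _ hp1; have d2 := step _ _ hp2.
  split; rewrite /ball /=.
  - rewrite -(subrK (z N).1 zz.1) -addrA (le_lt_trans (ler_normD _ _))//.
    rewrite e_2 ltrD// /z /P /= opprD addrACA subrr add0r -mulrBr normrM.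
    rewrite gtr0_norm//; apply: le_lt_trans lt1.
    apply: (@le_trans _ _ ((u - l) * N.+1%:R^-1)); first by rewrite ler_pM2l.
    by rewrite ler_pM2r// lerDl.
  - rewrite -(subrK (z N).2 zz.2) -addrA (le_lt_trans (ler_normD _ _))//.
    rewrite e_2 ltrD// /z /P /=; apply: le_lt_trans d2 _.
    apply: le_lt_trans lt1; rewrite -[leLHS]mul1r ler_pM2r// lerDr ltW//.
have main (B : set (R * R)) : nbhs zz B -> exists p q r, [/\ B p, Q p & A p] /\
    [/\ B q, Q q, ~ A q & U q] /\ [/\ B r, Q r, ~ A r & ~ U r].
  move=> /near_cell[N hB]; have [iN jN /and3P[]] := hij N.
  have corner p : p \in [:: (i N, j N); ((i N).+1, j N); (i N, (j N).+1);
      ((i N).+1, (j N).+1)] -> B (P N p.1 p.2) /\ Q (P N p.1 p.2).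
    rewrite !inE => /or4P[] /eqP ->; split; (try apply: PQ) => //=;
    (try exact: ltnW); (apply: (hB (_, _)); rewrite /= ?leqnn ?leqnSn//).
  move=> /hasP[p /corner[Bp Qp] /asboolP Ap].
  move=> /hasP[q /corner[Bq Qq] /andP[/asboolPn Aq /asboolP Uq]].
  move=> /hasP[r /corner[Br Qr] /andP[/asboolPn Ar /asboolPn Ur]].
  by exists (P N p.1 p.2), (P N q.1 q.2), (P N r.1 r.2).
exists zz; split => // B /main[p [q [r [[Bp Qp Ap] [[Bq Qq Aq Uq] [Br Qr Ar Ur]]]]]].
- by exists p.
- by exists q.
- by exists q.
- by exists r.
Qed.

End Crossing.

Section QuasiComponents.
Context {R : realType} {T : pseudoMetricType R}.
Implicit Types (Z E : set T) (p : T).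

Definition clopen_part Z p (F : set T) :=
  [/\ closed F, closed (Z `\` F), F `<=` Z & F p].

Lemma clopen_partI Z p F G : clopen_part Z p F -> clopen_part Z p G ->
  clopen_part Z p (F `&` G).
Proof.
move=> [cF cF' FZ Fp] [cG cG' GZ Gp]; split => //.
- exact: closedI.
- by rewrite setDIr; exact: closedU.
- by move=> x [/FZ].
Qed.

(** The finite intersection property, for the clopen parts around a point. *)
Lemma clopen_part_avoids Z p E : compact Z -> closed Z -> Z p -> closed E ->
  (forall x, E x -> exists2 F, clopen_part Z p F & ~ F x) ->
  exists2 F, clopen_part Z p F & F `&` E = set0.
Proof.
move=> cZ clZ Zp clE sep; apply: contrapT => H.
pose D := clopen_part Z p.
have DZ : D Z by split => //; rewrite setDv; exact: closed0.
pose FF := filter_from D (fun F => F `&` E).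
have FFp : ProperFilter FF.
  apply: filter_from_proper.
    apply: filter_from_filter; first by exists Z.
    move=> F G DF DG; exists (F `&` G); first exact: clopen_partI.
    by move=> x [[? ?] ?].
  move=> F DF; apply: contrapT => /nonemptyPn FE0; apply: H; exists F => //.
have FFZ : FF Z by exists Z => // x [].
have [x [Zx clx]] := cZ FF FFp FFZ.
have inF F : D F -> (F `&` E) x.
  move=> DF; have cFE : closed (F `&` E) by apply: closedI => //; case: DF.
  rewrite (iffLR (closure_id (F `&` E)) cFE); rewrite clusterE in clx; apply: clx.
  by exists F.
have [_ Ex] := inF Z DZ.
have [F DF nFx] := sep x Ex.
by have [] := inF F DF.
Qed.

(** Components and quasi-components agree in a compact set: if the intersection
    of all clopen parts around p split into two closed sets, these would have
    disjoint open neighbourhoods, which by compactness cover some clopen part,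
    and then cut a smaller one out of it. *)
Lemma component_separation Z E p : compact Z -> closed Z -> Z p -> closed E ->
  connected_component Z p `&` E = set0 ->
  exists2 F, clopen_part Z p F & F `&` E = set0.
Proof.
move=> cZ clZ Zp clE CE0; pose D := clopen_part Z p.
have DZ : D Z by split => //; rewrite setDv; exact: closed0.
pose Q := \bigcap_(F in D) F.
have Qp : Q p by move=> F [].
have QZ : Q `<=` Z by move=> x; apply.
have clQ : closed Q by apply: closed_bigI => F [].
suff cQ : connected Q.
  apply: clopen_part_avoids => // x Ex.
  apply: contrapT => H; have Qx : Q x.
    move=> F DF; apply: contrapT => nFx; by apply: H; exists F.
  suff : (connected_component Z p `&` E) x by rewrite CE0.
  split=> //; exact: (connected_component_max Qp QZ cQ Qx).
move=> B [y By] [G oG BG] [C cC BC].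
have clB : closed B by rewrite BC; exact: closedI.
have clB' : closed (Q `\` B).
  rewrite BG setDIr setDv set0U setDE; apply: closedI => //.
  exact: open_closedC.
have [|U [V [oU oV BU B'V UV]]] :=
    iffLR (@normal_openP R T) (@pseudometric_normal R T) B (Q `\` B) clB clB'.
  by rewrite setDE setICA setICr setI0.
have [F DF FUV] : exists2 F, D F & F `&` ~` (U `|` V) = set0.
  apply: clopen_part_avoids => //.
    exact/open_closedC/openU.
  move=> x nUV; apply: contrapT => H; apply: nUV.
  have Qx : Q x by move=> F DF; apply: contrapT => nFx; by apply: H; exists F.
  have [Bx|nBx] := pselect (B x); first by left; exact: BU.
  by right; exact: B'V.
have [cF cF' FZ Fp] := DF.
have disj x : U x -> V x -> False.
  by move=> Ux Vx; have : (U `&` V) x by []; rewrite UV.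
have FE x : F x -> U x \/ V x.
  move=> Fx; apply: contrapT => nUV.
  suff : (F `&` ~` (U `|` V)) x by rewrite FUV.
  by split.
have half (A A' : set T) : open A -> open A' -> (forall x, F x -> A x \/ A' x) ->
    (forall x, A x -> A' x -> False) -> A p -> D (F `&` A).
  move=> oA oA' AA' dA Ap; split=> //.
  - have -> : F `&` A = F `&` ~` A'.
      apply/seteqP; split=> x [Fx h]; split=> //.
        by move=> /(dA x h).
      by have [] := AA' x Fx.
    by apply: closedI => //; exact: open_closedC.
  - have -> : Z `\` (F `&` A) = (Z `\` F) `|` (F `&` ~` A).
      apply/seteqP; split=> x.
        move=> [Zx nFA]; have [Fx|] := pselect (F x); last by left.
        by right; split=> // Ax; exact: nFA.
      by move=> [[Zx nFx]|[Fx nAx]]; split=> //; [case|exact: FZ|case].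
    by apply: closedU => //; apply: closedI => //; exact: open_closedC.
  - by move=> x [/FZ].
have [Up|Vp] := FE p Fp.
  have DFU := half U V oU oV FE disj Up.
  apply/seteqP; split=> x; first by rewrite BG => -[].
  move=> Qx; apply: contrapT => nBx.
  by have [_ Ux] := Qx _ DFU; apply: (disj x) => //; exact: B'V.
have DFV : D (F `&` V).
  apply: (half V U) => //; first by move=> x /FE[]; [right|left].
  by move=> x Vx Ux; exact: (disj x).
exfalso; apply: (disj y); first exact: BU.
have Qy : Q y by move: By; rewrite BG => -[].
by have [] := Qy _ DFV.
Qed.

End QuasiComponents.

Section Continuum.
Context {R : realType}.

(** Otherwise a clopen part F of Z contains p and avoids the side x = 0. An open
    set around that side and the rest of Z, whose closure avoids F and the side
    x = 1, has a frontier off Z; but this frontier meets the one of A, which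
    lies in Z. *)
Lemma component_crosses (l u : R) (A Z : set (R * R)) (p : R * R) :
  l < u -> compact Z -> closed Z -> Z `<=` rectangle l u ->
  (forall x, 0 <= x <= 1 -> A (l, x)) -> (forall x, 0 <= x <= 1 -> ~ A (u, x)) ->
  (forall z, rectangle l u z -> closure (rectangle l u `&` A) z ->
     closure (rectangle l u `&` ~` A) z -> Z z) ->
  Z p -> p.2 = 1 -> (forall z, Z z -> z.2 = 1 -> z = p) ->
  exists2 z, connected_component Z p z & z.2 = 0.
Proof.
move=> lu cZ clZ ZQ Al Au AZ Zp p1 pu; apply: contrapT => H.
have clside (c : R) : closed [set z : R * R | z.2 = c].
  apply: (@closed_comp _ _ snd [set c]); last exact: closed_eq.
  by move=> z _; exact: cts_snd.
have [|F [clF clF' FZ Fp] FE] := component_separation cZ clZ Zp (clside 0).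
  apply/seteqP; split=> // z [Cz z0]; apply: H; by exists z.
have [|U [V [oU oV FU FV UV]]] := iffLR (@normal_openP R _)
    (@pseudometric_normal R (R * R)%type)
    ((Z `\` F) `|` [set z : R * R | z.2 = 0]) (F `|` [set z : R * R | z.2 = 1])
    (closedU clF' (clside 0)) (closedU clF (clside 1)).
  apply/seteqP; split=> // z [[[Zz nFz]|/= z0] [Fz|/= z1]] //.
  - by apply: nFz; rewrite (pu z).
  - by have : (F `&` [set z : R * R | z.2 = 0]) z by []; rewrite FE.
  - by move/eqP: z1; rewrite z0 eq_sym oner_eq0.
have disj z : U z -> V z -> False.
  by move=> Uz Vz; have : (U `&` V) z by []; rewrite UV.
have [||z [Qz Az nAz Uz nUz]] := frontiers_meet lu Al Au (U := U).
- by move=> b _; apply: FU; right.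
- by move=> b _ /disj; apply; apply: FV; right.
have Zz := AZ z Qz Az nAz.
have [Fz|nFz] := pselect (F z).
  have Vz : V z by apply: FV; left.
  have [y [[_ Uy] Vy]] := Uz V (open_nbhs_nbhs (conj oV Vz)).
  exact: (disj y).
have Uz' : U z by apply: FU; left.
by have [y [[_ nUy] Uy]] := nUz U (open_nbhs_nbhs (conj oU Uz')).
Qed.

End Continuum.

(** * Integrals over the unit interval *)

Section Integrals.
Context {R : realType}.
Notation mu := (@lebesgue_measure R).
Implicit Types f g p r : R -> R.

Local Notation D := (`]0, 1[%classic : set (measurableTypeR R)).

Lemma measurable_unit_itv : measurable D.
Proof. exact: measurable_itv. Qed.

Lemma lebesgue_measure_unit_itv : lebesgue_measure D = 1%E.
Proof. by rewrite lebesgue_measure_itv/= lte_fin ltr01 oppr0 adde0. Qed.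

Lemma cts_measurable f (E : set (measurableTypeR R)) : measurable E ->
  continuous f -> measurable_fun E f.
Proof.
by move=> mE cf; apply: measurable_funS (continuous_measurable_fun cf).
Qed.

Lemma cts_bounded_itv f (a b : R) : continuous f ->
  exists2 C, 0 < C & forall s, a <= s <= b -> `|f s| <= C.
Proof.
move=> cf; have [ab|ba] := leP a b; last first.
  by exists 1 => // s /andP[/le_trans/[apply]]; rewrite leNgt ba.
have [|c _ h] := @EVT_max R (fun s => `|f s|) a b ab.
  apply: continuous_subspaceT => x.
  exact: (cts_comp (@cf x) (@norm_continuous _ R (f x))).
exists (`|f c| + 1); first by rewrite ltr_wpDl.
by move=> s sab; rewrite (le_trans (h s _))// lerDl.
Qed.

Lemma cts_bounded_set f : continuous f -> [bounded f x | x in D].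
Proof.
move=> /(cts_bounded_itv 0 1)[C C0 hC]; exists C; split; first exact: gtr0_real.
move=> M CM s; rewrite /= in_itv/= => /andP[s0 s1].
by apply: le_trans (hC s _) (ltW CM); rewrite !ltW.
Qed.

Lemma cts_integrable f : continuous f -> mu.-integrable D (EFin \o f).
Proof.
move=> cf; apply: measurable_bounded_integrable.
- exact: measurable_unit_itv.
- have h : (lebesgue_measure D < +oo)%E by rewrite lebesgue_measure_unit_itv ltry.
  exact: h.
- exact: cts_measurable measurable_unit_itv cf.
- exact: cts_bounded_set.
Qed.

Lemma integrable_mul_cts f g : mu.-integrable D (EFin \o f) -> continuous g ->
  mu.-integrable D (EFin \o (fun s => f s * g s)).
Proof.
move=> If cg.
exact: (integrableMl measurable_unit_itv If (cts_measurable measurable_unit_itv cg)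
  (cts_bounded_set cg)).
Qed.

Lemma integrable_measurable f : mu.-integrable D (EFin \o f) ->
  measurable_fun D (f : measurableTypeR R -> R).
Proof. by move=> If; apply/measurable_EFinP; exact: measurable_int If. Qed.

Lemma Rintegral_ae_eq f g :
  measurable_fun D (f : measurableTypeR R -> R) ->
  measurable_fun D (g : measurableTypeR R -> R) ->
  {ae mu, forall s, D s -> f s = g s} ->
  \int[mu]_(s in D) f s = \int[mu]_(s in D) g s.
Proof.
move=> mf mg fg; rewrite /Rintegral; congr fine; apply: ae_eq_integral.
- exact: measurable_unit_itv.
- exact/measurable_EFinP.
- exact/measurable_EFinP.
- by apply: filterS fg => s h Ds /=; rewrite h.
Qed.

Lemma Rintegral_dct (f_ : nat -> R -> R) f g :
  (forall n, measurable_fun D (f_ n : measurableTypeR R -> R)) ->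
  (forall s, D s -> f_ n s @[n --> \oo] --> f s) ->
  mu.-integrable D (EFin \o g) -> (forall n s, D s -> `|f_ n s| <= g s) ->
  mu.-integrable D (EFin \o f) /\
  \int[mu]_(s in D) f_ n s @[n --> \oo] --> \int[mu]_(s in D) f s.
Proof.
move=> mf cf Ig fg.
have mlim : measurable_fun D (f : measurableTypeR R -> R).
  exact: (measurable_fun_cvg mf).
have [||||| If _ Icvg] := @dominated_convergence _ _ R mu D measurable_unit_itv
   (fun n => EFin \o f_ n) (EFin \o f) (EFin \o g).
- by move=> n; exact/measurable_EFinP.
- exact/measurable_EFinP.
- apply: aeW => s Ds; apply: cvg_EFin; last exact: cf.
  by near=> n.
- exact: Ig.
- by apply: aeW => s n Ds /=; rewrite lee_fin fg.
split => //; apply: fine_cvg; rewrite fineK//.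
exact: integrable_fin_num If.
Unshelve. all: by end_near. Qed.

Lemma Rintegral_closed_open f : measurable_fun D (f : measurableTypeR R -> R) ->
  \int[mu]_(s in `[0, 1]) f s = \int[mu]_(s in D) f s.
Proof.
move=> mf; rewrite /Rintegral; congr fine.
have mf' : measurable_fun (`]0, 1]%classic : set (measurableTypeR R)) (EFin \o f).
  by apply/emeasurable_fun_itv_bndo_bndcP; exact/measurable_EFinP.
rewrite -(integral_itv_obnd_cbnd mf').
have mf2 : measurable_fun D (EFin \o f) by exact/measurable_EFinP.
exact/esym/(integral_itv_bndo_bndc mf2).
Qed.

Lemma Rintegral_FTC f F : continuous f -> (forall s, is_derive s (1 : R) F (f s)) ->
  \int[mu]_(s in D) f s = F 1 - F 0.
Proof.
move=> cf dF; rewrite -Rintegral_closed_open; last exact: (cts_measurable measurable_unit_itv).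
have cF : continuous F by move=> x; exact: is_derive_cts (dF x).
rewrite /Rintegral (@continuous_FTC2 R f F 0 1)//.
- exact: continuous_subspaceT.
- split; first by move=> x _; case: (dF x).
    exact/cvg_at_right_filter/cF.
  exact/cvg_at_left_filter/cF.
- by move=> x _; rewrite derive1E; case: (dF x).
Qed.

Lemma Rintegral_unit_cst (c : R) : \int[mu]_(s in D) (cst c s) = c.
Proof.
have cc : continuous (cst c : R -> R) by move=> s; exact: cts_cst.
have := Rintegral_FTC cc (fun s => is_derive_linear c s).
by rewrite mulr1 mulr0 subr0.
Qed.

Lemma cts_integral_eq0 f : continuous f -> (forall s, 0 <= s <= 1 -> 0 <= f s) ->
  \int[mu]_(s in D) f s = 0 -> forall s, D s -> f s = 0.
Proof.
move=> cf f0 If s; rewrite /= in_itv/= => /andP[s0 s1].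
have dF z : is_derive z (1 : R) (prim f) (f z) by exact: is_derive_prim.
have F01 x y : 0 <= x -> x <= y -> y <= 1 -> prim f x <= prim f y.
  move=> x0 xy y1; apply: (derive_ge0_le dF xy) => z /andP[xz zy].
  by rewrite f0// (le_trans x0 xz)/= (le_trans zy).
have E : prim f 1 = prim f 0.
  by apply/eqP; rewrite -subr_eq0 -(Rintegral_FTC cf dF) If.
have cst_near : \forall y \near s, prim f s = prim f y.
  have eqs y : 0 <= y <= 1 -> prim f y = prim f 0.
    move=> /andP[y0 y1]; apply/le_anti; rewrite -{1}E.
    by rewrite F01//= F01.
  near=> y; rewrite !eqs ?(ltW s0) ?(ltW s1)//.
  apply/andP; split; apply: ltW; near: y; [exact: lt_nbhsr|exact: lt_nbhsl].
have := near_eq_is_derive cst_near (is_derive_cst (prim f s) s (1 : R)).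
by case: (dF s) => _ <- [_ ->].
Unshelve. all: by end_near. Qed.

End Integrals.

Section Truncation.
Context {R : realType}.
Implicit Types (t d : R).

(** A truncation of the identity that vanishes near zero; its slope is a
    continuous approximation of the indicator of the nonzero reals. *)
Definition trunc_slope d t : R := Num.min 1 (Num.max 0 (`|t| / d - 1)).
Definition trunc d : R -> R := prim (trunc_slope d).

Lemma trunc_slope_cts d : continuous (trunc_slope d).
Proof.
move=> t; apply: (@cts_min _ _ (cst 1) (fun t => Num.max 0 (`|t| / d - 1))).
  exact: cts_cst.
apply: (@cts_max _ _ (cst 0) (fun t => `|t| / d - 1)); first exact: cts_cst.
apply: (@cts_sub _ _ (fun t => `|t| / d) (cst 1)); last exact: cts_cst.
apply: (@cts_mul _ _ (fun t => `|t|) (cst d^-1)); last exact: cts_cst.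
exact: norm_continuous.
Qed.

Lemma trunc_slope_bound d t : 0 <= trunc_slope d t <= 1.
Proof. by rewrite /trunc_slope le_min ler01 le_max lexx/= ge_min lexx. Qed.

Lemma trunc_slope0 d t : 0 < d -> `|t| <= d -> trunc_slope d t = 0.
Proof.
move=> d0 td; rewrite /trunc_slope max_l ?min_r//.
by rewrite subr_le0 ler_pdivrMr// mul1r.
Qed.

Lemma trunc_slope1 d t : 0 < d -> d + d <= `|t| -> trunc_slope d t = 1.
Proof.
move=> d0 td; have h : 1 <= `|t| / d - 1.
  by rewrite lerBrDr ler_pdivlMr// mulrDl mul1r.
by rewrite /trunc_slope max_r ?min_l// (le_trans ler01).
Qed.

Lemma is_derive_trunc d t : is_derive t (1 : R) (trunc d) (trunc_slope d t).
Proof. exact/is_derive_prim/trunc_slope_cts. Qed.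

Lemma trunc_eq0 d t : 0 < d -> `|t| <= d -> trunc d t = 0.
Proof.
move=> d0 td; have [c [c1 c2]] := mean_value 0 t (is_derive_trunc d).
rewrite /trunc prim0 ?subr0; last exact: trunc_slope_cts.
move=> ->; rewrite trunc_slope0 ?mul0r//; apply: le_trans td.
move: c1 c2; have [t0|/ltW t0] := leP 0 t => c1 c2; first by rewrite !ger0_norm.
by rewrite !ler0_norm ?lerN2.
Qed.

Lemma trunc_dist d t : 0 < d -> `|trunc d t - t| <= d + d.
Proof.
move=> d0; have dT z : is_derive z (1 : R) (fun z => trunc d z - z)
    (trunc_slope d z - 1).
  exact: is_derive_sub (is_derive_trunc d z) (is_derive_id z (1 : R)).
have small z : `|z| <= d + d -> `|trunc d z - z| <= d + d.
  move=> zd; have [c [_ _]] := mean_value 0 z dT.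
  rewrite {2}/trunc prim0 ?subr0; last exact: trunc_slope_cts.
  move=> ->; rewrite normrM -[leRHS]mul1r ler_pM//.
  by have /andP[h0 h1] := trunc_slope_bound d c; rewrite ler_norml; lra.
have [td|/ltW td] := leP `|t| (d + d); first exact: small.
have d20 : 0 <= d + d by rewrite addr_ge0 ?ltW.
have [t0|t0] := leP 0 t.
  move: td; rewrite (ger0_norm t0) => td.
  have [c [+ _ e]] := mean_value (d + d) t dT.
  rewrite min_l// => cd; move: e; rewrite trunc_slope1 ?(ger0_norm (le_trans d20 cd))//.
  rewrite subrr mul0r => /eqP; rewrite subr_eq0 => /eqP ->.
  by apply: (small (d + d)); rewrite ger0_norm.
move: td; rewrite (ltr0_norm t0) => td.
have td' : t <= - (d + d) by rewrite lerNr.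
have [c [_ + e]] := mean_value (- (d + d)) t dT.
rewrite max_l// => cd; move: e.
have c0 : c <= 0 by rewrite (le_trans cd)// oppr_le0.
rewrite trunc_slope1//; last by rewrite ler0_norm// lerNr.
rewrite subrr mul0r => /eqP; rewrite subr_eq0 => /eqP ->.
by apply: (small (- (d + d))); rewrite normrN ger0_norm.
Qed.

End Truncation.

(** * Elements of the space presented by their derivatives *)

Section Parts.
Context {R : realType}.
Notation mu := (@lebesgue_measure R).
Implicit Types (p r : R -> R) (v : h1fun R).

Local Notation D := (`]0, 1[%classic : set (measurableTypeR R)).

Lemma h1der_measurable v : measurable_fun D (h1der v : measurableTypeR R -> R).
Proof.
have /andP[mv _] := h1der_L2 v; rewrite inE in mv.
exact: measurable_funS mv.
Qed.

Lemma h1der_integrable v : mu.-integrable D (EFin \o h1der v).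
Proof.
have leb01T : @leb01 R [set: measurableTypeR R] = 1%E.
  rewrite /leb01 /= /mrestr setTI; exact: lebesgue_measure_unit_itv.
have leb01fin : @leb01 R [set: measurableTypeR R] \is a fin_num.
  by rewrite leb01T.
have h1 := Lfun_subset12 leb01fin (h1der_L2 v).
have /integrableS : (@leb01 R).-integrable [set: measurableTypeR R]
    (EFin \o h1der v).
  exact/Lfun1_integrable.
move=> /(_ D measurableT (measurable_unit_itv (R := R)) (fun x _ => I)).
move=> /integrableP[mv fv]; apply/integrableP; split; first exact: mv.
apply: le_lt_trans fv; rewrite le_eqVlt; apply/orP; left; apply/eqP/esym.
apply: eq_measure_integral => A mA AD.
by rewrite /leb01 /= /mrestr setIidl.
Qed.

Definition clamp (s : R) : R := Num.max 0 (Num.min s 1).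

Lemma clamp_cts : continuous clamp.
Proof.
move=> s; have h : {for s, continuous (fun x : R => Num.max 0 (Num.min x 1))}.
  apply: cts_max; first exact: cts_cst.
  apply: (@cts_min _ _ id); [exact: cvg_id|exact: cts_cst].
exact: h.
Qed.

Lemma clamp_id s : 0 <= s <= 1 -> clamp s = s.
Proof. by move=> /andP[s0 s1]; rewrite /clamp min_l// max_r. Qed.

Lemma clamp_itv s : 0 <= clamp s <= 1.
Proof. by rewrite /clamp le_max lexx/= ge_max ler01/= ge_min lexx orbT. Qed.

Lemma h1val_clamp_cts v : continuous (fun s => h1val v (clamp s)).
Proof.
move=> s.
have cl x : `[0, 1]%classic (clamp x) by rewrite /= in_itv/= clamp_itv.
have /subspace_continuousP/(_ (clamp s) (cl s)) cv := @h1val_cont _ v.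
move=> A /cv nA.
have nA' : nbhs s (clamp @^-1` [set y | `[0, 1]%classic y -> A (h1val v y)]).
  exact: clamp_cts nA.
rewrite nbhs_simpl /=; apply: (filterS _ nA') => z /=; apply; exact: cl.
Qed.

Lemma h1val_integrable v : mu.-integrable D (EFin \o h1val v).
Proof.
apply: eq_integrable (cts_integrable (@h1val_clamp_cts v)).
  exact: measurable_unit_itv.
move=> s; rewrite inE/= in_itv/= => /andP[s0 s1].
by rewrite clamp_id// !ltW.
Qed.

(** Truncating p near its zeros makes it a test function, and the truncation is
    removed by dominated convergence. Differentiability where p vanishes is not
    asked for, as the second derivative of a solution jumps where the contact
    with the obstacle begins. *)
Lemma h1_by_parts v p r : continuous p -> continuous r ->
  (forall s, ~~ (0 < s < 1) -> p s = 0) ->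
  (forall s, p s != 0 -> is_derive s (1 : R) p (r s)) ->
  mu.-integrable D (EFin \o (fun s => h1val v s * (if p s == 0 then 0 else r s))) /\
  \int[mu]_(s in D) (h1val v s * (if p s == 0 then 0 else r s)) =
  - \int[mu]_(s in D) (h1der v s * p s).
Proof.
move=> cp cr p0 dp.
pose d n : R := n.+1%:R^-1.
have d0 n : 0 < d n by rewrite invr_gt0 ltr0n.
pose phi n s := trunc (d n) (p s).
have dphi n s : is_derive s (1 : R) (phi n) (trunc_slope (d n) (p s) * r s).
  have [ps|ps] := eqVneq (p s) 0; last first.
    exact: is_derive_chain (is_derive_trunc (d n) (p s)) (dp s ps).
  rewrite ps trunc_slope0 ?normr0 ?(ltW (d0 n))// mul0r.
  apply: (near_eq_is_derive _ (is_derive_cst (0 : R) s (1 : R))).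
  near=> y; rewrite /phi trunc_eq0//; apply: ltW.
  rewrite -[p y]subr0 -ps distrC; near: y.
  by have /cvgrPdist_lt := cp s; apply.
have dphiE n : derive1 (phi n) = fun s => trunc_slope (d n) (p s) * r s.
  by apply/funext => s; rewrite derive1E; case: (dphi n s).
have cdphi n : continuous (fun s => trunc_slope (d n) (p s) * r s).
  move=> s; apply: (@cts_mul _ _ (fun s => trunc_slope (d n) (p s)) r); last exact: cr.
  apply: (@cts_comp _ _ _ p (trunc_slope (d n))); [exact: cp|exact: trunc_slope_cts].
have cphi n : continuous (phi n) by move=> s; exact: is_derive_cts (dphi n s).
have tphi n : test_function (phi n).
  split; first by move=> s; case: (dphi n s).
    by rewrite dphiE.
  exists (`[0, 1]%classic `&` [set s | d n <= `|p s|]); split.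
  - apply: compact_closedI; first exact: segment_compact.
    apply: (@closed_comp _ _ (fun s => `|p s|) [set t | d n <= t]).
      by move=> s _; exact: cts_norm (cp s).
    exact: closed_ge.
  - move=> s [_ /= dps]; rewrite in_itv/=; apply: contraLR dps => /p0 ->.
    by rewrite normr0 -ltNge.
  - move=> s nK; rewrite /phi trunc_eq0// leNgt; apply/negP => dps; apply: nK.
    split => /=; last exact: ltW.
    rewrite in_itv/=; apply/andP; have : 0 < s < 1.
      by apply: contraLR dps => /p0 ->; rewrite normr0 -leNgt ltW.
    by move=> /andP[/ltW ? /ltW ?].
have weak n := h1der_weak v (tphi n).
have mD := @measurable_unit_itv R.
have mval : measurable_fun D (h1val v : measurableTypeR R -> R).
  by apply/measurable_EFinP; exact: measurable_int (h1val_integrable v).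
have [C C0 hC] := cts_bounded_itv 0 1 cr.
have itvD s : D s -> 0 <= s <= 1 by rewrite /= in_itv/= => /andP[/ltW -> /ltW ->].
have Iabs (f : R -> R) (c : R) : mu.-integrable D (EFin \o f) ->
    mu.-integrable D (EFin \o (fun s => `|f s| * c)).
  move=> If; apply: (@integrable_mul_cts _ (fun s => `|f s|) (cst c)).
    have := integrable_norm If; exact.
  by move=> ?; exact: cts_cst.
have dsmall e : 0 < e -> \forall n \near \oo, d n < e.
  by move=> e0; have /cvgr_lt := @cvg_harmonic R; apply.
have [||||Il liml] := @Rintegral_dct R (fun n s => h1val v s * derive1 (phi n) s)
    (fun s => h1val v s * (if p s == 0 then 0 else r s)) (fun s => `|h1val v s| * C).
- move=> n; rewrite dphiE.
  by apply: measurable_funM => //; exact: cts_measurable.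
- move=> s Ds; apply: cvgM; first exact: cvg_cst.
  have [ps|ps] := eqVneq (p s) 0.
    apply: cvg_near_cst; near=> n.
    by rewrite dphiE ps trunc_slope0 ?normr0 ?mul0r// ltW.
  have ps2 : 0 < `|p s| / 2 by rewrite divr_gt0// normr_gt0.
  apply: cvg_near_cst; apply: filterS (dsmall _ ps2) => n /ltW dn.
  by rewrite dphiE trunc_slope1 ?mul1r// [leRHS]splitr lerD.
- exact/Iabs/h1val_integrable.
- move=> n s Ds; rewrite dphiE normrM ler_wpM2l// normrM -[leRHS]mul1r.
  have /andP[t0 t1] := trunc_slope_bound (d n) (p s).
  by apply: ler_pM => //; [rewrite ger0_norm|exact/hC/itvD].
have [B B0 hB] := cts_bounded_itv 0 1 cp.
have [||||Ir limr] := @Rintegral_dct R (fun n s => h1der v s * phi n s)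
    (fun s => h1der v s * p s) (fun s => `|h1der v s| * (2 + B)).
- move=> n; apply: measurable_funM; first exact: h1der_measurable.
  exact: cts_measurable.
- move=> s Ds; apply: cvgM; first exact: cvg_cst.
  apply/cvgrPdist_lt => e e0; have e2 : 0 < e / 2 by rewrite divr_gt0.
  apply: filterS (dsmall _ e2) => n dn.
  by rewrite distrC (le_lt_trans (trunc_dist _ (d0 n)))// (splitr e) ltrD.
- exact/Iabs/h1der_integrable.
- move=> n s Ds; rewrite normrM ler_wpM2l//.
  rewrite -(subrK (p s) (phi n s)) (le_trans (ler_normD _ _))//.
  rewrite lerD// ?hB ?itvD// (le_trans (trunc_dist _ (d0 n)))//.
  have : d n <= 1 by rewrite invf_le1// ler1n.
  by move: (d n) => t; lra.
split=> //.
apply: (cvg_unique _ liml); first exact: Rhausdorff.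
have -> : (fun n => \int[mu]_(s in D) (h1val v s * derive1 (phi n) s)) =
    (fun n => - \int[mu]_(s in D) (h1der v s * phi n s)).
  by apply/funext => n; exact: weak.
exact: cvgN.
Unshelve. all: by end_near. Qed.

End Parts.

Section Uniqueness.
Context {R : realType}.
Notation mu := (@lebesgue_measure R).
Implicit Types (v f g : h1fun R) (d : R -> R).

Local Notation D := (`]0, 1[%classic : set (measurableTypeR R)).

Lemma cts_eq0_closed d : continuous d -> (forall s, 0 < s < 1 -> d s = 0) ->
  forall s, 0 <= s <= 1 -> d s = 0.
Proof.
move=> cd d0 s /andP[]; rewrite le_eqVlt => /predU1P[<- _|s0].
  have h1 : d x @[x --> 0^'+] --> d 0 by exact/cvg_at_right_filter/cd.
  have h2 : d x @[x --> 0^'+] --> (0 : R).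
    apply: cvg_near_cst; near=> x; apply: d0; apply/andP; split; near: x.
      exact: nbhs_right_gt.
    exact: nbhs_right_lt.
  exact: (cvg_unique _ h1 h2).
rewrite le_eqVlt => /predU1P[->|s1]; last by rewrite d0// s0.
have h1 : d x @[x --> 1^'-] --> d 1 by exact/cvg_at_left_filter/cd.
have h2 : d x @[x --> 1^'-] --> (0 : R).
  apply: cvg_near_cst; near=> x; apply: d0; apply/andP; split; near: x.
    exact: nbhs_left_gt.
  exact: nbhs_left_lt.
exact: (cvg_unique _ h1 h2).
Unshelve. all: by end_near. Qed.

Lemma h1der_sub_Lfun f g :
  (h1der f \- h1der g : measurableTypeR R -> R) \in Lfun (@leb01 R) 2%:E.
Proof. by apply: (rpredB (h1der_L2 f) (h1der_L2 g)); rewrite lee_fin ler1n. Qed.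

Lemma h1dist_eq0_der f g : h1dist f g = 0 ->
  {ae mu, forall s, D s -> h1der f s = h1der g s}.
Proof.
have /andP[mB fin] := h1der_sub_Lfun f g.
move=> fg; have N0 : 'N[@leb01 R]_2%:E[EFin \o (h1der f \- h1der g)%R]%E = 0%E.
  rewrite -[LHS]fineK; last by rewrite ge0_fin_numE ?Lnorm_ge0// inE in fin *.
  by congr EFin.
have : EFin \o (h1der f \- h1der g)%R = \0%E %[ae @leb01 R].
  apply: (Lnorm_eq0_eq0 _ _ N0); last by rewrite lte_fin.
  by apply/measurable_EFinP; rewrite inE in mB.
move=> [A [mA A0 hA]]; exists (A `&` D); split.
- exact: measurableI.
- exact: A0.
- move=> s /= /not_implyP[Ds fgs]; split => //; apply: hA => /= h; apply: fgs.
  by have /= [/eqP] := h I; rewrite subr_eq0 => /eqP.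
Qed.

Lemma h1val_mean_open v : \int[mu]_(s in D) h1val v s = 0.
Proof.
have := h1val_mean v; rewrite Rintegral_closed_open//.
by apply: integrable_measurable; exact: h1val_integrable.
Qed.

(** Testing against the cube of the primitive P of the difference d that
    vanishes at both ends makes the integral of (P d)^2 vanish; so P^2, and
    then d, is constant. *)
Lemma h1dist_eq0_val f g : h1dist f g = 0 ->
  forall s, 0 <= s <= 1 -> h1val f s = h1val g s.
Proof.
move=> fg; have aeder := h1dist_eq0_der fg.
pose d s := h1val f (clamp s) - h1val g (clamp s).
have cd : continuous d.
  move=> s; apply: (@cts_sub _ _ (fun s => h1val f (clamp s))
    (fun s => h1val g (clamp s))); exact: h1val_clamp_cts.
have dD s : D s -> d s = h1val f s - h1val g s.
  by rewrite /= in_itv/= => /andP[/ltW s0 /ltW s1]; rewrite /d clamp_id ?s0.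
pose F := prim d.
have dF z : is_derive z (1 : R) F (d z) by exact: is_derive_prim.
have F0 : F 0 = 0 by exact: prim0.
have F1 : F 1 = 0.
  rewrite -[LHS]subr0 -F0 -(Rintegral_FTC cd dF).
  have -> : \int[mu]_(s in D) d s = \int[mu]_(s in D) (h1val f s - h1val g s).
    by apply: eq_Rintegral => s; rewrite inE => /dD.
  rewrite RintegralB ?h1val_mean_open ?subrr//; try exact: h1val_integrable.
have cF : continuous F by exact: prim_cts.
pose P s := F (clamp s).
have cP : continuous P by move=> s; apply: (cts_comp (@clamp_cts R s)); exact: cF.
have P0 s : ~~ (0 < s < 1) -> P s = 0.
  rewrite negb_and -!leNgt /P /clamp => /orP[s0|s1].
    by rewrite max_l// ge_min s0.
  by rewrite min_r// max_r.
pose p s := P s * (P s * P s); pose r s := 3 * (P s * P s) * d s.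
have cPP : continuous (fun s => P s * P s).
  by move=> s; apply: (@cts_mul _ _ P P); exact: cP.
have cp : continuous p.
  move=> s; apply: (@cts_mul _ _ P (fun s => P s * P s)); [exact: cP|exact: cPP].
have cr : continuous r.
  move=> s; apply: (@cts_mul _ _ (fun s => 3 * (P s * P s)) d); last exact: cd.
  apply: (@cts_mul _ _ (cst 3) (fun s => P s * P s)); [exact: cts_cst|exact: cPP].
have p0 s : ~~ (0 < s < 1) -> p s = 0 by move=> /P0 e; rewrite /p e mul0r.
have dp s : p s != 0 -> is_derive s (1 : R) p (r s).
  move=> ps; have /andP[s0 s1] : 0 < s < 1 by apply: contraNT ps => /p0 ->.
  have near_F : \forall y \near s, F y * (F y * F y) = p y.
    near=> y; rewrite /p /P clamp_id//; apply/andP; split; apply: ltW; near: y.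
      exact: lt_nbhsr.
    exact: lt_nbhsl.
  apply: (near_eq_is_derive near_F).
  apply: (is_derive_ext (is_derive_mul (dF s) (is_derive_mul (dF s) (dF s)))).
  by rewrite /r /P clamp_id ?(ltW s0) ?(ltW s1)//; ring.
have rE s : (if p s == 0 then 0 else r s) = r s.
  case: ifPn => // /eqP; rewrite /p /r => /eqP; rewrite !mulf_eq0 orbb orbb.
  by move=> /eqP ->; rewrite mul0r mulr0 mul0r.
have [If ef] := h1_by_parts f cp cr p0 dp.
have [Ig eg] := h1_by_parts g cp cr p0 dp.
have mD := @measurable_unit_itv R.
have eder : \int[mu]_(s in D) (h1der f s * p s) = \int[mu]_(s in D) (h1der g s * p s).
  apply: Rintegral_ae_eq.
  - by apply: integrable_measurable; apply: integrable_mul_cts cp; exact: h1der_integrable.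
  - by apply: measurable_funM; [exact: h1der_measurable|exact: cts_measurable].
  - by apply: filterS aeder => s h Ds; rewrite h.
have e0 : \int[mu]_(s in D) (d s * r s) = 0.
  transitivity (\int[mu]_(s in D) (h1val f s * (if p s == 0 then 0 else r s) -
      h1val g s * (if p s == 0 then 0 else r s))).
    by apply: eq_Rintegral => s; rewrite inE => /dD ->; rewrite rE mulrBl.
  by rewrite RintegralB// ef eg eder subrr.
have Pd s : 0 < s < 1 -> F s * d s = 0.
  move=> /andP[s0 s1]; have : d s * r s = 0.
    apply: cts_integral_eq0 e0 _ _ => //; last by rewrite /= in_itv/= s0.
      by move=> z; apply: (@cts_mul _ _ d r); [exact: cd|exact: cr].
    move=> z _; rewrite /r; have -> : d z * (3 * (P z * P z) * d z) =
        3 * (P z * d z) ^+ 2 by ring.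
    by rewrite mulr_ge0 ?sqr_ge0.
  rewrite /r; have -> : d s * (3 * (P s * P s) * d s) = 3 * (P s * d s) ^+ 2.
    by ring.
  move=> /eqP; rewrite mulf_eq0 pnatr_eq0/= sqrf_eq0 => /eqP.
  by rewrite /P clamp_id// (ltW s0) (ltW s1).
have FF0 s : 0 <= s <= 1 -> F s = 0.
  move=> /andP[s0 s1].
  have [c [+ + e]] := mean_value 0 s (fun z => is_derive_mul (dF z) (dF z)).
  rewrite min_l// max_r// => c0 cs.
  have Fdc : F c * d c = 0.
    have [->|c0'] := eqVneq c 0; first by rewrite F0 mul0r.
    have [->|c1'] := eqVneq c 1; first by rewrite F1 mul0r.
    by rewrite Pd// lt_neqAle eq_sym c0' c0/= lt_neqAle c1' (le_trans cs).
  move: e; rewrite [d c * _]mulrC Fdc addr0 mul0r F0 mul0r subr0.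
  by move=> /eqP; rewrite mulf_eq0 orbb => /eqP.
move=> s s01; apply/eqP; rewrite -subr_eq0.
have : d s = 0.
  apply: cts_eq0_closed s01 => // z /andP[z0 z1].
  have near_0 : \forall y \near z, 0 = F y.
    near=> y; rewrite FF0//; apply/andP; split; apply: ltW; near: y.
      exact: lt_nbhsr.
    exact: lt_nbhsl.
  have := near_eq_is_derive near_0 (is_derive_cst (0 : R) z (1 : R)).
  by case: (dF z) => _ <- [_ ->].
by rewrite /d clamp_id// => ->.
Unshelve. all: by end_near. Qed.

End Uniqueness.

Section Elements.
Context {R : realType}.
Notation mu := (@lebesgue_measure R).
Implicit Types (p q U : R -> R).

Local Notation D := (`]0, 1[%classic : set (measurableTypeR R)).

(** Solutions have zero slope at both ends, so that their derivatives extend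
    continuously by zero. *)
Definition vanishing p :=
  continuous p /\ forall s, ~~ (0 < s < 1) -> p s = 0.

Lemma vanishing_bounded p : vanishing p -> exists2 C, 0 < C & forall s, `|p s| <= C.
Proof.
move=> [cp p0]; have [C C0 hC] := cts_bounded_itv 0 1 cp; exists C => // s.
have [/andP[/ltW s0 /ltW s1]|/p0 ->] := boolP (0 < s < 1); first by rewrite hC ?s0.
by rewrite normr0 ltW.
Qed.

Lemma leb01_setT : @leb01 R [set: measurableTypeR R] = 1%E.
Proof. by rewrite /leb01 /= /mrestr setTI; exact: lebesgue_measure_unit_itv. Qed.

Lemma Lnorm_le_sup p (C : R) : continuous p -> 0 <= C -> (forall s, `|p s| <= C) ->
  ('N[@leb01 R]_2%:E[EFin \o (p : measurableTypeR R -> R)] <= C%:E)%E.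
Proof.
move=> cp C0 pC; have mp := cts_measurable (@measurableT _ (measurableTypeR R)) cp.
have -> : C%:E = 'N[@leb01 R]_2%:E[EFin \o (cst C : measurableTypeR R -> R)]%E.
  rewrite unlock /= (_ : (fun x => _) = cst (C `^ 2)%:E).
    by rewrite integral_cst//= leb01_setT mule1 /= -powRrM divff ?powRr1.
  by apply/funext => x /=; rewrite ger0_norm.
rewrite unlock /= gt0_ler_poweR ?invr_ge0//.
- by rewrite in_itv/= leey andbT integral_ge0// => x _; exact: poweR_ge0.
- by rewrite in_itv/= leey andbT integral_ge0// => x _; exact: poweR_ge0.
have mc (q : R -> R) : measurable_fun [set: measurableTypeR R] (q : measurableTypeR R -> R) ->
    measurable_fun [set: measurableTypeR R] (fun x => (`|q x| `^ 2)%:E).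
  move=> mq; apply/measurable_EFinP; apply: (measurableT_comp (measurable_powR 2)).
  exact: (measurableT_comp _ mq).
apply: ge0_le_integral.
- exact: measurableT.
- by move=> x _; rewrite /= lee_fin powR_ge0.
- exact: (mc p mp).
- exact: (mc (cst C) (measurable_cst C)).
- by move=> x _; rewrite /= lee_fin ge0_ler_powR ?nnegrE// (ger0_norm C0).
Qed.

Section Element.
Variables (p : R -> R) (vp : vanishing p).

Let cp : continuous p := proj1 vp.
Let P s := prim p s - \int[mu]_(s in D) prim p s.

Let dP s : is_derive s (1 : R) P (p s).
Proof.
apply: (is_derive_ext (is_derive_sub (is_derive_prim s cp)
  (is_derive_cst (\int[mu]_(s in D) prim p s) s (1 : R)))).
by rewrite subr0.
Qed.

Let cP : continuous P.
Proof. by move=> s; exact: is_derive_cts (dP s). Qed.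

Let val_cont : {within `[0, 1], continuous P}.
Proof. exact: continuous_subspaceT cP. Qed.

Let der_L2 : (p : measurableTypeR R -> R) \in Lfun (@leb01 R) 2%:E.
Proof.
rewrite inE; apply/andP; split; rewrite inE /=.
  exact: cts_measurable.
have [C C0 hC] := vanishing_bounded vp.
exact: le_lt_trans (Lnorm_le_sup cp (ltW C0) hC) (ltry _).
Qed.

Let weak : weak_derivative P p.
Proof.
move=> phi [dphi cphi [K [_ K01 phiK]]].
have cph : continuous phi.
  by move=> s; apply/differentiable_continuous/derivable1_diffP.
have phi0 s : ~~ (0 < s < 1) -> phi s = 0.
  move=> s01; apply: phiK => /K01; rewrite /= in_itv/=; exact/negP.
have dphi' s : is_derive s (1 : R) phi (derive1 phi s).
  by rewrite derive1E; exact: derivableP.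
have e : forall s, is_derive s (1 : R) (fun s => P s * phi s)
    (p s * phi s + P s * derive1 phi s).
  by move=> s; exact: is_derive_mul (dP s) (dphi' s).
have c1 : continuous (fun s => p s * phi s).
  by move=> s; apply: cts_mul; [exact: cp|exact: cph].
have c2 : continuous (fun s => P s * derive1 phi s).
  by move=> s; apply: cts_mul; [exact: cP|exact: cphi].
have c3 : continuous (fun s => p s * phi s + P s * derive1 phi s).
  move=> s; apply: (@cts_add _ _ (fun s => p s * phi s)); [exact: c1|exact: c2].
have := Rintegral_FTC c3 e.
rewrite !phi0 ?ltxx ?andbF// !mulr0 subrr.
rewrite RintegralD; [|exact: measurable_unit_itv|exact: cts_integrable|exact: cts_integrable].
by move=> /eqP; rewrite addrC addr_eq0 => /eqP.
Qed.

Let mean : \int[mu]_(s in `[0, 1]) P s = 0.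
Proof.
rewrite Rintegral_closed_open; last exact: (cts_measurable (@measurable_unit_itv R)).
have Icst (c : R) : mu.-integrable D (EFin \o cst c).
  by apply: cts_integrable => s; exact: cts_cst.
rewrite RintegralB; [|exact: measurable_unit_itv| |exact: Icst].
  by rewrite [X in _ - X](Rintegral_unit_cst _) subrr.
by apply: cts_integrable; exact: prim_cts.
Qed.

Definition h1fun_of_der : h1fun R := H1Fun val_cont der_L2 weak mean.

End Element.

Local Open Scope quotient_scope.

(** The value off the vanishing functions is a mere default. *)
Definition h1_of_der p : H1m R :=
  if pselect (vanishing p) is left vp then \pi_(H1m R) (h1fun_of_der vp)
  else h1m_zero.

Lemma h1dist_repr (f : h1fun R) : h1dist (repr (\pi_(H1m R) f)) f = 0.
Proof.
have : repr (\pi_(H1m R) f) == f %[mod H1m R] by rewrite reprK.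
by rewrite eqmodE /= /h1eq => /eqP.
Qed.

Lemma h1m_der_of_der p : vanishing p ->
  {ae mu, forall s, D s -> h1m_der (h1_of_der p) s = p s}.
Proof.
move=> vp; rewrite /h1_of_der; case: pselect => // vp'.
exact: h1dist_eq0_der (h1dist_repr _).
Qed.

Lemma h1m_val_of_der p U : vanishing p ->
  (forall s, is_derive s (1 : R) U (p s)) -> \int[mu]_(s in D) U s = 0 ->
  forall s, 0 <= s <= 1 -> h1m_fun (h1_of_der p) s = U s.
Proof.
move=> vp dU U0 s s01; rewrite /h1_of_der; case: pselect => // vp'.
rewrite /h1m_fun (h1dist_eq0_val (h1dist_repr _) s01) /=.
have cU : continuous U by move=> z; exact: is_derive_cts (dU z).
have E z : prim p z = U z - U 0 by exact: (primE z (proj1 vp) dU).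
rewrite E; have -> : \int[mu]_(s in D) prim p s = - U 0; last by rewrite opprK subrK.
have -> : prim p = (fun z => U z - U 0) by apply/funext.
have Icst (c : R) : mu.-integrable D (EFin \o cst c).
  by apply: cts_integrable => z; exact: cts_cst.
rewrite RintegralB; [|exact: measurable_unit_itv|exact: cts_integrable|exact: Icst].
by rewrite [X in _ - X](Rintegral_unit_cst _) U0 sub0r.
Qed.

Lemma h1m_distE (f g : h1fun R) :
  h1m_dist (\pi_(H1m R) f) (\pi_(H1m R) g) = h1dist f g.
Proof.
have rf := h1dist_repr f; have rg := h1dist_repr g.
rewrite /h1m_dist; apply/le_anti/andP; split.
  apply: le_trans (h1dist_triangle f _ _) _; rewrite rf add0r.
  apply: le_trans (h1dist_triangle g _ _) _.
  by rewrite [h1dist g (repr _)]h1distC rg addr0.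
apply: le_trans (h1dist_triangle (repr (\pi_(H1m R) f)) _ _) _.
rewrite h1distC rf add0r.
by apply: le_trans (h1dist_triangle (repr (\pi_(H1m R) g)) _ _) _; rewrite rg addr0.
Qed.

Lemma h1m_dist_of_der p q (e : R) : vanishing p -> vanishing q -> 0 <= e ->
  (forall s, 0 <= s <= 1 -> `|p s - q s| <= e) ->
  h1m_dist (h1_of_der p) (h1_of_der q) <= e.
Proof.
move=> vp vq e0 pq; rewrite /h1_of_der; case: pselect => // vp'.
case: pselect => // vq'; rewrite h1m_distE /h1dist /L2norm /=.
rewrite -[leRHS]/(fine e%:E) fine_le//.
  rewrite ge0_fin_numE ?Lnorm_ge0//.
  by have /andP[_] := h1der_sub_Lfun (h1fun_of_der vp') (h1fun_of_der vq'); rewrite inE.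
apply: Lnorm_le_sup => //.
  by move=> s; apply: (@cts_sub _ _ p q); [exact: (proj1 vp)|exact: (proj1 vq)].
move=> s; have [/andP[/ltW s0 /ltW s1]|s01] := boolP (0 < s < 1).
  by rewrite pq// s0.
by rewrite /= (proj2 vp)// (proj2 vq)// subrr normr0.
Qed.

Lemma h1_of_der0 : h1_of_der (cst 0) = h1m_zero.
Proof.
have v0 : vanishing (cst 0) by split=> // s; exact: cts_cst.
rewrite /h1_of_der; case: pselect => // v.
apply/eqP; rewrite eqmodE /= /h1eq; apply/eqP.
rewrite /h1dist /L2norm /= (_ : _ \o _ = cst 0%E) ?Lnorm0//.
by apply/funext => x /=; rewrite subrr.
Qed.

Lemma h1m_zero_val s : 0 <= s <= 1 -> h1m_fun (@h1m_zero R) s = 0.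
Proof. by move=> s01; rewrite /h1m_fun (h1dist_eq0_val (h1dist_repr _) s01). Qed.

End Elements.

(** * The dual energy *)

Section Convexity.
Context {R : realType}.
Implicit Types f df : R -> R.

Lemma cts_gt_near f (a C : R) : {for a, continuous f} -> C < f a ->
  exists2 d, 0 < d & forall z, `|z - a| < d -> C < f z.
Proof.
move=> cf Cfa; have : \forall z \near a, C < f z.
  by move/cvgr_gt : cf => /(_ C); exact.
move=> /nbhs_ballP[d /= d0 h]; exists d => // z zd; apply: h.
by rewrite /ball/= distrC.
Qed.

Lemma cts_le_left f (a b C : R) : {for a, continuous f} -> a < b ->
  (forall z, a < z < b -> f z <= C) -> f a <= C.
Proof.
move=> cf ab fC; rewrite leNgt; apply/negP => /(cts_gt_near cf)[d d0 h].
pose m := Num.min d (b - a) / 2.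
have m0 : 0 < m by rewrite divr_gt0// lt_min d0 subr_gt0.
have md : m < d.
  by rewrite ltr_pdivrMr// (le_lt_trans (y := d))// ?ge_min ?lexx//; lra.
have mb : m < b - a.
  rewrite ltr_pdivrMr// (le_lt_trans (y := b - a))// ?ge_min ?lexx ?orbT//; lra.
have := h (a + m); rewrite addrAC subrr add0r gtr0_norm// => /(_ md).
by rewrite ltNge fC//; apply/andP; split; lra.
Qed.

Lemma cts_le_right f (a b C : R) : {for b, continuous f} -> a < b ->
  (forall z, a < z < b -> f z <= C) -> f b <= C.
Proof.
move=> cf ab fC; pose g x := f (- x).
have := @cts_le_left g (- b) (- a) C; rewrite /g opprK; apply.
- apply: (@cts_comp _ _ _ (fun x => - x) f); last by rewrite opprK.
  exact: opp_continuous.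
- by rewrite ltrN2.
- by move=> z /andP[h1 h2]; apply: fC; apply/andP; split; lra.
Qed.

Lemma increasing_closure f (a b : R) : {for a, continuous f} ->
  {for b, continuous f} -> (forall x y, a < x -> x < y -> y < b -> f x < f y) ->
  forall x y, a <= x -> x < y -> y <= b -> f x < f y.
Proof.
move=> cfa cfb h x y ax xy yb.
pose m1 := (2 * x + y) / 3; pose m2 := (x + 2 * y) / 3.
have xm1 : x < m1 by rewrite /m1; lra.
have m12 : m1 < m2 by rewrite /m1 /m2; lra.
have m2y : m2 < y by rewrite /m2; lra.
have le1 : f x <= f m1.
  move: ax; rewrite le_eqVlt => /predU1P[ax|ax].
    rewrite -ax; apply: (cts_le_left cfa (b := m1)); first by rewrite ax.
    by move=> z /andP[az zm1]; apply/ltW/h => //; lra.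
  by apply/ltW/h => //; lra.
have le2 : f m2 <= f y.
  move: yb; rewrite le_eqVlt => /predU1P[yb|yb].
    rewrite -lerN2 yb; apply: (@cts_le_right (fun z => - f z) m2).
    - by apply: (@cts_comp _ _ _ f (fun x => - x)) => //; exact: opp_continuous.
    - by rewrite -yb.
    - by move=> z /andP[az zm1]; rewrite lerN2; apply/ltW/h => //; lra.
  by apply/ltW/h => //; lra.
apply: le_lt_trans le1 _; apply: lt_le_trans le2.
by apply: h => //; lra.
Qed.

(** Continuity of the derivative puts the graph above its tangents; the tangents
    at x and y are then compared at the midpoint, where the graph is strictly
    below the chord. *)
Lemma strictly_convex_slopes f df (D : set R) :
  (forall x y t : R, D x -> D y -> 0 <= t <= 1 -> D (t * x + (1 - t) * y)) ->
  (forall x, D x -> is_derive x (1 : R) f (df x)) ->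
  (forall x, D x -> {for x, continuous df}) -> strictly_convex_on D f ->
  forall x y, D x -> D y -> x < y -> df x < df y.
Proof.
move=> Dc dfP cdf fc.
have tangent a b : D a -> D b -> a != b -> df a * (b - a) <= f b - f a.
  move=> Da Db ab; pose phi t := f (a + t * (b - a)) - t * (f b - f a).
  pose dphi t := df (a + t * (b - a)) * (b - a) - (f b - f a).
  have Dt (t : R) : 0 <= t <= 1 -> D (a + t * (b - a)).
    by move=> t01; rewrite (_ : _ + _ = t * b + (1 - t) * a); [exact: Dc|ring].
  have dphiP (t : R) : 0 <= t <= 1 -> is_derive t (1 : R) phi (dphi t).
    move=> t01; apply: is_derive_sub; last first.
      apply: (is_derive_ext (is_derive_mul (is_derive_id t (1 : R))
        (is_derive_cst (f b - f a) t (1 : R)))).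
      by rewrite mul1r mulr0 addr0.
    apply: (@is_derive_chain _ f (fun t => a + t * (b - a))).
      exact/dfP/Dt.
    apply: (is_derive_ext (is_derive_add (is_derive_cst a t (1 : R))
      (is_derive_mul (is_derive_id t (1 : R)) (is_derive_cst (b - a) t (1 : R))))).
    by rewrite add0r mul1r mulr0 addr0.
  have cdphi : {for 0, continuous dphi}.
    apply: (@cts_sub R R (fun t : R => df (a + t * (b - a)) * (b - a))
      (cst (f b - f a))); last exact: cts_cst.
    apply: (@cts_mul R R (fun t : R => df (a + t * (b - a))) (cst (b - a)));
      last exact: cts_cst.
    apply: (@cts_comp R R R (fun t : R => a + t * (b - a)) df).
      apply: (@cts_add R R (cst a) (fun t : R => t * (b - a))); first exact: cts_cst.
      apply: (@cts_mul R R id (cst (b - a))); last exact: cts_cst.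
      exact: cvg_id.
    by rewrite mul0r addr0; exact: cdf.
  have phi_lt (t : R) : 0 < t < 1 -> phi t <= phi 0.
    move=> t01; have h1 : b != a by rewrite eq_sym.
    have := fc b a t Db Da h1 t01.
    rewrite /phi mul0r addr0 mul0r subr0 (_ : a + _ = t * b + (1 - t) * a); last ring.
    by move=> h; lra.
  suff : dphi 0 <= 0 by rewrite /dphi mul0r addr0 subr_le0.
  rewrite leNgt; apply/negP => /(cts_gt_near cdphi)[d d0 h].
  pose m := Num.min d 1 / 2.
  have m0 : 0 < m by rewrite divr_gt0// lt_min d0 ltr01.
  have md : m < d.
    by rewrite ltr_pdivrMr// (le_lt_trans (y := d))// ?ge_min ?lexx//; lra.
  have m1 : m < 1.
    by rewrite ltr_pdivrMr// (le_lt_trans (y := 1))// ?ge_min ?lexx ?orbT//; lra.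
  have [z /andP[z0 zm]|c /andP[c0 cm] e] := @mean_value_on _ phi dphi _ _ m0.
    by apply: dphiP; rewrite z0/= (le_trans zm) ?ltW.
  have : 0 < dphi c * (m - 0).
    rewrite mulr_gt0 ?subr0//; apply: h; rewrite subr0 gtr0_norm//.
    exact: lt_trans md.
  by rewrite -e subr_gt0 ltNge phi_lt// m0.
move=> x y Dx Dy xy; pose m := (1 / 2) * x + (1 - 1 / 2) * y.
have Dm : D m by apply: Dc => //; lra.
have hx := tangent x m Dx Dm _; have hy := tangent y m Dy Dm _.
have xm : x < m by rewrite /m; lra.
have my : m < y by rewrite /m; lra.
have {hx}hx := hx (negbT (lt_eqF xm)).
have {hy}hy := hy (negbT (gt_eqF my)).
have fm : f m < (1 / 2) * f x + (1 - 1 / 2) * f y.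
  by apply: fc => //; [exact: negbT (lt_eqF xy)|lra].
have e1 : m - x = (y - x) / 2 by rewrite /m; lra.
have e2 : m - y = - ((y - x) / 2) by rewrite /m; lra.
move: hx hy; rewrite e1 e2 mulrN => hx hy.
have h0 : 0 < (y - x) / 2 by rewrite divr_gt0// subr_gt0.
rewrite -(ltr_pM2r h0); move: fm hx hy.
set A := df x * _; set B := df y * _; move: (f x) (f y) (f m) => u v z; lra.
Qed.
End Convexity.

(** What the sequel uses of the dual energy w on [0, +oo[ and of its slope dw,
    extended to the line; H n stands for 1 / lambda_n. The uniqueness of the
    roots of the characteristic equation is used through the order of its two
    sides below and above H n. *)
Record bar_potential {R : realType} (eps kap : R) (w dw ddw : R -> R)
    (H : nat -> R) : Prop := BarPotential {
  bp_dw : forall x, is_derive x (1 : R) w (dw x);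
  bp_dw_cts : continuous dw;
  bp_ddw : forall x : R, 0 < x -> is_derive x (1 : R) dw (ddw x);
  bp_ddw_cts : forall x, 0 < x -> {for x, continuous ddw};
  bp_decr : forall x y, 0 <= x -> x < y -> y <= kap -> dw y < dw x;
  bp_incr : forall x y, kap <= x -> x < y -> dw x < dw y;
  bp_w1 : w 1 = 0;
  bp_dw1 : dw 1 = 0;
  bp_ge0 : forall x, 0 <= x -> 0 <= w x;
  bp_H : forall n, (0 < n)%N -> 0 < H n < 1;
  bp_root : forall n, (0 < n)%N -> eps * n%:R ^+ 2 * pi ^+ 2 * H n ^+ 2 = - ddw (H n);
  bp_below : forall n x, (0 < n)%N -> 0 < x < H n ->
    eps * n%:R ^+ 2 * pi ^+ 2 * x ^+ 2 < - ddw x;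
  bp_above : forall n x, (0 < n)%N -> H n < x ->
    - ddw x < eps * n%:R ^+ 2 * pi ^+ 2 * x ^+ 2 }.

Section Energy.
Context {R : realType}.
Variables (W : R -> R) (gam kap : R).
Hypothesis hW : energy_density W gam kap.

Let W1 : R -> R := derive1 W.
Let W2 : R -> R := derive1 W1.

Let dW (y : R) : 0 < y -> is_derive y (1 : R) W (W1 y).
Proof.
move=> y0; have [h _] := energy_C3 hW.
by rewrite /W1 derive1E; apply: derivableP; exact: (h 0%N).
Qed.

Let dW1 (y : R) : 0 < y -> is_derive y (1 : R) W1 (W2 y).
Proof.
move=> y0; have [h _] := energy_C3 hW.
by rewrite /W2 derive1E; apply: derivableP; exact: (h 1%N).
Qed.

Let cW2 y : 0 < y -> {for y, continuous W2}.
Proof.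
move=> y0; have [h _] := energy_C3 hW.
by apply/differentiable_continuous/derivable1_diffP; exact: (h 2%N).
Qed.

Let kap0 : 0 < kap. Proof. by have /andP[] := energy_kap hW. Qed.
Let kap1 : kap < 1. Proof. by have /andP[] := energy_kap hW. Qed.

(* The tangent to the graph of W at F = 1 / x meets the axis F = 0 at g1 x,
   which is the slope at x of x W(1 / x). *)
Let g0 (x : R) := x * W x^-1.
Let g1 (x : R) := W x^-1 - W1 x^-1 * x^-1.
Let g2 (x : R) := W2 x^-1 * (x^-1 * x^-1 * x^-1).

Let dcomp (f : R -> R) (df x : R) : 0 < x -> is_derive x^-1 (1 : R) f df ->
  is_derive x (1 : R) (fun x => f x^-1) (- (df * (x^-1 * x^-1))).
Proof.
move=> x0 dfx; apply: (is_derive_ext (is_derive_chain dfx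
  (is_derive_recip (lt0r_neq0 x0)))).
by rewrite mulrN -exprVn expr2.
Qed.

Let dg0 (x : R) : 0 < x -> is_derive x (1 : R) g0 (g1 x).
Proof.
move=> x0; have x0' : 0 < x^-1 by rewrite invr_gt0.
apply: (is_derive_ext (is_derive_mul (is_derive_id x (1 : R))
  (dcomp x0 (dW x0')))).
by rewrite /g1; field; rewrite lt0r_neq0.
Qed.

Let dg1 (x : R) : 0 < x -> is_derive x (1 : R) g1 (g2 x).
Proof.
move=> x0; have x0' : 0 < x^-1 by rewrite invr_gt0.
apply: (is_derive_ext (is_derive_sub (dcomp x0 (dW x0'))
  (is_derive_mul (dcomp x0 (dW1 x0')) (is_derive_recip (lt0r_neq0 x0))))).
by rewrite /g2; field; rewrite lt0r_neq0.
Qed.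

Let cinv (x : R) : 0 < x -> {for x, continuous (fun x : R => x^-1)}.
Proof. by move=> x0; exact: is_derive_cts (is_derive_recip (lt0r_neq0 x0)). Qed.

Let cg2 x : 0 < x -> {for x, continuous g2}.
Proof.
move=> x0; have x0' : 0 < x^-1 by rewrite invr_gt0.
apply: (@cts_mul R R (fun x : R => W2 x^-1) (fun x : R => x^-1 * x^-1 * x^-1)).
  exact: (@cts_comp R R R (fun x : R => x^-1) W2 x (cinv x0) (cW2 x0')).
apply: (@cts_mul R R (fun x : R => x^-1 * x^-1) (fun x : R => x^-1)); last exact: cinv.
by apply: (@cts_mul R R (fun x : R => x^-1) (fun x : R => x^-1)); exact: cinv.
Qed.

Let fineE x : 0 < x -> (fine \o Wstar W) x = g0 x.
Proof. by move=> x0; rewrite /= /Wstar ltNge (ltW x0)/= gt_eqF. Qed.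

Let near_pos (x : R) : 0 < x -> \forall y \near x, 0 < y.
Proof. by move=> x0; exact: lt_nbhsr. Qed.

Let dWstarE x : 0 < x -> dWstar W x = g1 x.
Proof.
move=> x0; rewrite /dWstar gt_eqF// derive1E.
have : is_derive x (1 : R) (fine \o Wstar W) (g1 x).
  apply: (near_eq_is_derive _ (dg0 x0)).
  by apply: filterS (near_pos x0) => y y0; rewrite fineE.
by case.
Qed.

Let dWstar_der (x : R) : 0 < x -> is_derive x (1 : R) (dWstar W) (g2 x).
Proof.
move=> x0; apply: (near_eq_is_derive _ (dg1 x0)).
by apply: filterS (near_pos x0) => y y0; rewrite dWstarE.
Qed.

Let ddWstarE x : 0 < x -> ddWstar W x = g2 x.
Proof. by move=> x0; rewrite /ddWstar derive1E; case: (dWstar_der x0). Qed.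

Let W1_decr x y : kap^-1 < x -> x < y -> W1 y < W1 x.
Proof.
move=> kx xy; rewrite -ltrN2.
have Dpos z : kap^-1 < z -> 0 < z by apply: lt_trans; rewrite invr_gt0.
apply: (@strictly_convex_slopes R (fun x => - W x) (fun x => - W1 x)
  [set z | kap^-1 < z] _ _ _ _ x y) => //=.
- move=> u v t ku kv /andP[t0 t1].
  have [-> |t0'] := eqVneq t 0; first by rewrite mul0r add0r subr0 mul1r.
  have h : 0 < t by rewrite lt_neqAle eq_sym t0'.
  have h1 : t * kap^-1 < t * u by rewrite ltr_pM2l.
  have h2 : (1 - t) * kap^-1 <= (1 - t) * v by rewrite ler_wpM2l ?subr_ge0// ltW.
  by move: h1 h2; rewrite mulrBl mul1r; lra.
- by move=> z /Dpos z0; exact: is_deriveN (dW z0).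
- move=> z /Dpos z0; apply: (@cts_comp _ _ _ W1 (fun x => - x)).
    exact: is_derive_cts (dW1 z0).
  exact: opp_continuous.
- move=> u v t ku kv uv t01; apply: (energy_concave hW) => //=.
    by rewrite in_itv/= ku.
  by rewrite in_itv/= kv.
- exact: lt_trans xy.
Qed.

Let W1_incr x y : 0 < x -> x < y -> y < kap^-1 -> W1 x < W1 y.
Proof.
move=> x0 xy yk.
apply: (@strictly_convex_slopes R W W1 `]0, kap^-1[%classic _ _ _ _ x y) => //=.
- move=> u v t; rewrite !in_itv/= => /andP[u0 uk] /andP[v0 vk] /andP[t0 t1].
  have [-> |t0'] := eqVneq t 0; first by rewrite mul0r add0r subr0 mul1r v0.
  have h : 0 < t by rewrite lt_neqAle eq_sym t0'.
  have h1 : t * u < t * kap^-1 by rewrite ltr_pM2l.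
  have h2 : (1 - t) * v <= (1 - t) * kap^-1 by rewrite ler_wpM2l ?subr_ge0// ltW.
  have h3 : 0 < t * u by rewrite mulr_gt0.
  have h4 : 0 <= (1 - t) * v by rewrite mulr_ge0 ?subr_ge0// ltW.
  by move: h1 h2 h3 h4; rewrite !mulrBl !mul1r; lra.
- by move=> z; rewrite in_itv/= => /andP[z0 _]; exact: dW.
- by move=> z; rewrite in_itv/= => /andP[z0 _]; exact: is_derive_cts (dW1 z0).
- exact: (energy_convex hW).
- by rewrite in_itv/= x0 (lt_trans xy).
- by rewrite in_itv/= yk (lt_trans x0).
Qed.

(* Differences of tangent intercepts, by the mean value theorem. *)
Let intercept F1 F2 : 0 < F1 -> F1 < F2 -> exists2 c, F1 < c < F2 &
  (W F2 - W1 F2 * F2) - (W F1 - W1 F1 * F1) =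
  (W1 c - W1 F2) * F2 + (W1 F1 - W1 c) * F1.
Proof.
move=> F0 F12; have [z /andP[z0 _]|c c12 e] := @mean_value_on _ W W1 _ _ F12.
  by apply: dW; exact: lt_le_trans z0.
by exists c => //; move: e; lra.
Qed.

Let g1_decr x y : 0 < x -> x < y -> y < kap -> g1 y < g1 x.
Proof.
move=> x0 xy yk; have y0 := lt_trans x0 xy.
have y0' : 0 < y^-1 by rewrite invr_gt0.
have yx : y^-1 < x^-1 by rewrite ltf_pV2.
have ky : kap^-1 < y^-1 by rewrite ltf_pV2.
have [c /andP[yc cx] e] := intercept y0' yx.
rewrite -subr_gt0 /g1 e addr_gt0// mulr_gt0//; first last.
- by rewrite subr_gt0; exact: W1_decr.
- exact: lt_trans yx.
- by rewrite subr_gt0; apply: W1_decr => //; exact: lt_trans yc.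
Qed.

Let g1_incr x y : kap < x -> x < y -> g1 x < g1 y.
Proof.
move=> kx xy; have x0 := lt_trans kap0 kx; have y0 := lt_trans x0 xy.
have y0' : 0 < y^-1 by rewrite invr_gt0.
have yx : y^-1 < x^-1 by rewrite ltf_pV2.
have ky : x^-1 < kap^-1 by rewrite ltf_pV2.
have [c /andP[yc cx] e] := intercept y0' yx.
have h1 : (W1 c - W1 x^-1) * x^-1 < 0.
  rewrite pmulr_llt0 ?subr_lt0; last exact: lt_trans yx.
  by apply: W1_incr => //; exact: lt_trans yc.
have h2 : (W1 y^-1 - W1 c) * y^-1 < 0.
  rewrite pmulr_llt0// subr_lt0; apply: W1_incr => //; exact: lt_trans ky.
by move: e; rewrite /g1; lra.
Qed.

Let W_near_gam e : 0 < e -> exists2 M, 0 < M & forall y, M < y -> `|W y - gam| < e.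
Proof.
move=> e0; have /cvgrPdist_lt/(_ _ e0)[M [_ hM]] := energy_cvgy hW.
exists (Num.max M 1); first by rewrite lt_max ltr01 orbT.
by move=> y; rewrite gt_max => /andP[My _]; rewrite distrC; exact: hM.
Qed.

(* By concavity the term F W'(F) lies between multiples of the increments of W
   over [F / 2, F] and [F, 2 F], all of which tend to zero. *)
Let g1_near_gam e : 0 < e -> exists2 d, 0 < d & forall x, 0 < x < d -> `|g1 x - gam| < e.
Proof.
move=> e0; have e5 : 0 < e / 6 by rewrite divr_gt0.
have [M M0 hM] := W_near_gam e5.
pose N := 2 * (M + kap^-1); have k0 : 0 < kap^-1 by rewrite invr_gt0.
have N0 : 0 < N by rewrite mulr_gt0// addr_gt0.
exists N^-1; first by rewrite invr_gt0.
move=> x /andP[x0 xN]; rewrite /g1; set F := x^-1.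
have NF : N < F by rewrite -[N]invrK ltf_pV2 ?posrE ?invr_gt0.
have F0 : 0 < F by exact: lt_trans NF.
have NE : N = 2 * M + 2 * kap^-1 by rewrite /N mulrDr.
have F_2 : F / 2 < F by lra.
have F2 : F < 2 * F by lra.
have [z /andP[z0 _]|c1 /andP[a1 b1] e1] := @mean_value_on _ W W1 _ _ F_2.
  by apply: dW; lra.
have [z /andP[z0 _]|c2 /andP[a2 b2] e2] := @mean_value_on _ W W1 _ _ F2.
  by apply: dW; lra.
have h1 : W1 F * F <= 2 * (W F - W (F / 2)).
  have : W1 F <= W1 c1 by apply/ltW/W1_decr => //; lra.
  rewrite -(ler_pM2r F0) e1; set A := W1 F * F; set B := W1 c1; lra.
have h2 : W (2 * F) - W F <= W1 F * F.
  have : W1 c2 <= W1 F by apply/ltW/W1_decr => //; lra.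
  rewrite -(ler_pM2r F0) e2; set A := W1 F * F; set B := W1 c2; lra.
have hF := hM F _; have hF2 := hM (F / 2) _; have h2F := hM (2 * F) _.
have {}hF : `|W F - gam| < e / 6 by apply: hF; lra.
have {}hF2 : `|W (F / 2) - gam| < e / 6 by apply: hF2; lra.
have {}h2F : `|W (2 * F) - gam| < e / 6 by apply: h2F; lra.
move: hF hF2 h2F h1 h2; rewrite !ltr_norml.
move: (W F) (W (F / 2)) (W (2 * F)) (W1 F * F) => p q r s.
by move=> /andP[? ?] /andP[? ?] /andP[? ?] ? ?; apply/andP; split; lra.
Qed.

Let dWstar0 : dWstar W 0 = gam.
Proof.
rewrite /dWstar eqxx; apply/cvg_lim; first exact: Rhausdorff.
apply/cvgrPdist_lt => e /g1_near_gam[d d0 hd].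
near=> x; have x0 : 0 < x by near: x; exact: nbhs_right_gt.
have -> : derive1 (fine \o Wstar W) x = dWstar W x by rewrite /dWstar gt_eqF.
rewrite dWstarE// distrC; apply: hd; rewrite x0/=; near: x; exact: nbhs_right_lt.
Unshelve. all: by end_near. Qed.

Let ddWstar_cts x : 0 < x -> {for x, continuous (ddWstar W)}.
Proof.
move=> x0; apply/cvgrPdist_lt => e e0.
have /cvgrPdist_lt/(_ _ e0) h := cg2 x0.
by apply: filterS2 h (near_pos x0) => y hy y0; rewrite !ddWstarE.
Qed.

(** The slope of the dual energy, extended by its value at the origin to
    negative arguments: this makes the potential continuously differentiable on
    the line, across the value where the obstacle is touched. *)
Definition wslope (x : R) : R := dWstar W (Num.max x 0).

Definition wpot : R -> R := prim wslope.

Let wslope_pos x : 0 < x -> wslope x = g1 x.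
Proof. by move=> x0; rewrite /wslope max_l ?ltW// dWstarE. Qed.

Let wslope_npos x : x <= 0 -> wslope x = gam.
Proof. by move=> x0; rewrite /wslope max_r// dWstar0. Qed.

Let wslope_der (x : R) : 0 < x -> is_derive x (1 : R) wslope (ddWstar W x).
Proof.
move=> x0; rewrite ddWstarE//; apply: (near_eq_is_derive _ (dg1 x0)).
by apply: filterS (near_pos x0) => y y0; rewrite wslope_pos.
Qed.

Lemma wslope_cts : continuous wslope.
Proof.
move=> x; have [x0|x0] := ltP 0 x; first exact: is_derive_cts (wslope_der x0).
have H e : 0 < e -> exists2 d, 0 < d & forall y, y < d -> `|wslope y - gam| < e.
  move=> e0; have [d d0 hd] := g1_near_gam e0; exists d => // y yd.
  have [y0|y0] := ltP 0 y; first by rewrite wslope_pos// hd// y0.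
  by rewrite wslope_npos// subrr normr0.
apply/cvgrPdist_lt => e /H[d d0 hd]; rewrite wslope_npos//.
have xd : x < d by exact: le_lt_trans d0.
by apply: filterS (lt_nbhsl xd) => y yd; rewrite distrC hd.
Qed.

Lemma is_derive_wpot x : is_derive x (1 : R) wpot (wslope x).
Proof. exact/is_derive_prim/wslope_cts. Qed.

Lemma wpot0 : wpot 0 = 0.
Proof. by rewrite /wpot prim0//; exact: wslope_cts. Qed.

Let wpot_near0 e : 0 < e -> exists2 d, 0 < d & forall x, 0 < x < d -> `|wpot x| < e.
Proof.
move=> e0; have cw : {for 0, continuous wpot} by exact: is_derive_cts (is_derive_wpot 0).
have /cvgrPdist_lt/(_ _ e0) := cw; rewrite wpot0 => /nbhs_ballP[d /= d0 hd].
exists d => // x /andP[x0 xd]; have := hd x; rewrite /ball/= !sub0r !normrN.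
by rewrite (gtr0_norm x0); exact.
Qed.

Lemma wpotE x : 0 < x -> wpot x = x * W x^-1.
Proof.
move=> x0.
(* wpot - g0 is constant on the positive half-line and tends to zero at 0. *)
have cst y : 0 < y -> wpot x - g0 x = wpot y - g0 y.
  have lt_case u v : 0 < u -> u < v -> wpot v - g0 v = wpot u - g0 u.
    move=> u0 uv.
    have [z /andP[uz _]|c /andP[uc _] e] := @mean_value_on _
        (fun x => wpot x - g0 x) (fun x => wslope x - g1 x) u v uv.
      exact: is_derive_sub (is_derive_wpot z) (dg0 (lt_le_trans u0 uz)).
    have {}e : (wpot v - g0 v) - (wpot u - g0 u) = 0.
      by rewrite e wslope_pos ?subrr ?mul0r// (lt_trans u0).
    by move/eqP: e; rewrite subr_eq0 => /eqP.
  move=> y0; have [xy|yx|->//] := ltgtP x y; last exact: lt_case.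
  by rewrite -(lt_case x y).
apply/eqP; rewrite -subr_eq0 -normr_le0 leNgt; apply/negP.
set e := `| _ |; move=> e0.
have e3 : 0 < e / 2 by rewrite divr_gt0.
have [d d0 hd] := wpot_near0 e3.
have g1' : 0 < (1 : R) by [].
have [M M0 hM] := W_near_gam g1'.
pose C := `|gam| + 1; have C0 : 0 < C by rewrite ltr_wpDl.
pose y := Num.min (Num.min (d / 2) (M + 1)^-1) (e / 2 / C).
have y0 : 0 < y by rewrite !lt_min !divr_gt0// invr_gt0 addr_gt0.
have [[yd yM] yC] : (y <= d / 2 /\ y <= (M + 1)^-1) /\ y <= e / 2 / C.
  by split; [split|]; rewrite /y !ge_min lexx ?orbT.
suff : e < e by rewrite ltxx.
rewrite {1}/e -/(g0 x) (cst y y0) (le_lt_trans (ler_normB _ _))//.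
rewrite (splitr e) ltr_leD//; first by apply: hd; rewrite y0; lra.
have hW1 : `|W y^-1| <= C.
  have : `|W y^-1 - gam| < 1.
    apply: hM; rewrite -[M]invrK ltf_pV2 ?posrE ?invr_gt0//.
    apply: le_lt_trans yM _; rewrite ltf_pV2 ?posrE//; lra.
  by have := ler_normB (W y^-1) gam; have := lerB_dist (W y^-1) gam; rewrite /C; lra.
rewrite /g0 normrM gtr0_norm//; apply: (@le_trans _ _ (y * C)).
  by rewrite ler_pM2l.
by rewrite -ler_pdivlMr.
Qed.

Variables (eps : R) (lam : nat -> R).
Hypothesis heps : 0 < eps.
Hypothesis hlam : char_roots eps kap W lam.

Let c n : R := eps * n%:R ^+ 2 * pi ^+ 2.
Let H n : R := (lam n)^-1.

Let c_lt m n : (m < n)%N -> c m < c n.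
Proof.
move=> mn; rewrite /c ltr_pM2r ?exprn_gt0 ?pi_gt0// ltr_pM2l//.
by rewrite ltr_pXn2r ?nnegrE// ltr_nat.
Qed.

Let lam0 n : (0 < n)%N -> 0 < lam n. Proof. exact: (char_root_gt0 hlam). Qed.

Let H0 n : (0 < n)%N -> 0 < H n. Proof. by move=> /lam0; rewrite invr_gt0. Qed.

Let H_decr m n : (0 < m)%N -> (m < n)%N -> H n < H m.
Proof.
move=> m0 mn; rewrite /H ltf_pV2 ?posrE ?lam0//; last exact: leq_trans mn.
exact: (char_root_incr hlam).
Qed.

Let H1 n : (0 < n)%N -> H n < kap.
Proof.
move=> n0; have h1 : H 1 < kap.
  rewrite /H -[kap]invrK ltf_pV2 ?posrE ?invr_gt0 ?lam0//.
  exact: (char_root_kap hlam).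
have [->//|n1] := eqVneq n 1%N.
by apply: lt_trans h1; apply: H_decr => //; rewrite ltn_neqAle eq_sym n1.
Qed.

Let root n : (0 < n)%N -> c n * H n ^+ 2 = - ddWstar W (H n).
Proof.
by move=> n0; have := char_rootP hlam n0; rewrite /char_eq /H exprVn -/(c n).
Qed.

Let unique n x : (0 < n)%N -> 0 < x -> c n * x ^+ 2 = - ddWstar W x -> x = H n.
Proof.
move=> n0 x0 e; have xV : 0 < x^-1 by rewrite invr_gt0.
have e' : char_eq eps W n x^-1 by rewrite /char_eq invrK -/(c n) -e exprVn invrK.
by rewrite /H -(char_root_uniq hlam n0 xV e') invrK.
Qed.

Let f n (x : R) := - ddWstar W x - c n * x ^+ 2.

Let cf n x : 0 < x -> {for x, continuous (f n)}.
Proof.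
move=> x0; apply: (@cts_sub R R (fun x : R => - ddWstar W x) (fun x : R => c n * x ^+ 2)).
  apply: (@cts_comp R R R (ddWstar W) (fun x => - x)); last exact: opp_continuous.
  exact: ddWstar_cts.
apply: (@cts_mul R R (cst (c n)) (fun x : R => x ^+ 2)); first exact: cts_cst.
exact: exprn_continuous.
Qed.

(* The difference of the two sides of the characteristic equation changes sign
   only at its root. *)
Let crossing n x y : (0 < n)%N -> 0 < x -> 0 < y -> 0 < f n x -> f n y < 0 ->
  Num.min x y < H n < Num.max x y.
Proof.
move=> n0 x0 y0 fx fy.
have mM : Num.min x y <= Num.max x y by rewrite ge_min !le_max lexx.
have m0 : 0 < Num.min x y by rewrite lt_min x0.
have [||z] := @IVT R (f n) (Num.min x y) (Num.max x y) 0 mM.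
- apply: continuous_in_subspaceT => z; rewrite inE/= in_itv/= => /andP[mz _].
  by apply: cf; exact: lt_le_trans mz.
- have [xy|xy|xy] := ltgtP x y.
  + by rewrite ge_min le_max (ltW fx) (ltW fy) orbT.
  + by rewrite ge_min le_max (ltW fx) (ltW fy) orbT.
  + by move: fx fy; rewrite xy => /lt_trans/[apply]; rewrite ltxx.
rewrite in_itv/= => /andP[mz zM] fz.
have zH : z = H n.
  apply: unique => //; first exact: lt_le_trans mz.
  by move/eqP: fz; rewrite subr_eq0 => /eqP ->.
have zx : z != x by apply: contraTneq fx => <-; rewrite fz ltxx.
have zy : z != y by apply: contraTneq fy => <-; rewrite fz ltxx.
rewrite -zH; apply/andP; split.
  by rewrite lt_neqAle mz andbT minEle; case: ifP => _; rewrite eq_sym.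
by rewrite lt_neqAle zM andbT maxEle; case: ifP.
Qed.

Let wslope_decr x y : 0 <= x -> x < y -> y <= kap -> wslope y < wslope x.
Proof.
move=> x0 xy yk; rewrite -ltrN2.
have cN z : {for z, continuous (fun z => - wslope z)}.
  apply: (@cts_comp R R R wslope (fun x => - x)); last exact: opp_continuous.
  exact: wslope_cts.
apply: (@increasing_closure R (fun z => - wslope z) 0 kap) => // u v u0 uv vk.
have v0 := lt_trans u0 uv.
by rewrite ltrN2 !wslope_pos//; exact: g1_decr.
Qed.

Let wslope_incr x y : kap <= x -> x < y -> wslope x < wslope y.
Proof.
move=> kx xy.
apply: (@increasing_closure R wslope kap (y + 1)) => //; try exact: wslope_cts.
  move=> u v u0 uv vk; have u0' := lt_trans kap0 u0; have v0 := lt_trans u0' uv.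
  by rewrite !wslope_pos//; exact: g1_incr.
by rewrite lerDl.
Qed.

Let wpot1 : wpot 1 = 0.
Proof. by rewrite wpotE// invr1 (energy_1 hW) mulr0. Qed.

Let wpot_ge0 x : 0 <= x -> 0 <= wpot x.
Proof.
rewrite le_eqVlt => /predU1P[<-|x0]; first by rewrite wpot0.
have [->|x1] := eqVneq x 1; first by rewrite wpot1.
rewrite wpotE// mulr_ge0 ?(ltW x0)// ltW// (energy_gt0 hW) ?invr_gt0//.
by rewrite invr_eq1.
Qed.

Let wslope1 : wslope 1 = 0.
Proof.
  have h : is_derive (1 : R) (1 : R) wpot 0.
    apply: (@derive1_at_min R wpot 0 2 1) => //.
    - by move=> z _; case: (is_derive_wpot z).
    - by rewrite in_itv/= ltr01 ltr1n.
    - by move=> t; rewrite in_itv/= => /andP[t0 _]; rewrite wpot1 wpot_ge0// ltW.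
  by case: h => _ <-; case: (is_derive_wpot 1).
Qed.

(* The potential vanishes to first order at 1 and is positive at 2. *)
Let convex_point : exists2 x, 1 < x & 0 < ddWstar W x.
Proof.
have lt12 : 1 < 2 :> R by rewrite ltr1n.
have [z _|u /andP[u1 _] e] := @mean_value_on _ wpot wslope _ _ lt12.
  exact: is_derive_wpot.
have w2 : 0 < wpot 2.
  rewrite wpotE// mulr_gt0// (energy_gt0 hW) ?invr_gt0// invr_eq1.
  by rewrite gt_eqF.
have su : 0 < wslope u by move: e w2; rewrite wpot1; lra.
have [z /andP[z1 _]|x /andP[x1 xu] e2] := @mean_value_on _ wslope (ddWstar W) _ _ u1.
  by apply: wslope_der; exact: lt_le_trans z1.
exists x => //; move: su.
have -> : wslope u = ddWstar W x * (u - 1) by rewrite -e2 wslope1 subr0.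
by rewrite pmulr_lgt0// subr_gt0.
Qed.

(** Below H n, the sign of the difference of the two sides is known at H (n+1),
    by the characteristic equation there; above H n, at a point of convexity
    beyond 1. *)
Lemma energy_potential : bar_potential eps kap wpot wslope (ddWstar W) H.
Proof.
have f_neq0 n x : (0 < n)%N -> 0 < x -> x != H n -> f n x != 0.
  move=> n0 x0; apply: contra_neq => /eqP; rewrite subr_eq0 => /eqP e.
  exact: unique.
split.
- exact: is_derive_wpot.
- exact: wslope_cts.
- exact: wslope_der.
- exact: ddWstar_cts.
- exact: wslope_decr.
- exact: wslope_incr.
- exact: wpot1.
- exact: wslope1.
- exact: wpot_ge0.
- by move=> n n0; rewrite H0//= (lt_trans (H1 n0)).
- exact: root.
- move=> n x n0 /andP[x0 xH]; rewrite -/(c n) -subr_gt0 -/(f n x).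
  have m0 : (0 < n.+1)%N by [].
  have Hm : 0 < H n.+1 by exact: H0.
  have fm : 0 < f n (H n.+1).
    by rewrite /f -root// subr_gt0 ltr_pM2r ?exprn_gt0// c_lt.
  rewrite lt_neqAle eq_sym f_neq0 ?lt_eqF//= leNgt; apply/negP => fx.
  have /andP[_] := crossing n0 Hm x0 fm fx.
  by rewrite lt_max !ltNge (ltW xH) (ltW (H_decr n0 (ltnSn n))).
- move=> n x n0 xH; rewrite -/(c n) -subr_lt0 -/(f n x).
  have x0 : 0 < x by exact: lt_trans (H0 n0) xH.
  have [y y1 wy] := convex_point.
  have y0 : 0 < y by exact: lt_trans y1.
  have fy : f n y < 0.
    have cn : 0 <= c n.
      rewrite /c; apply: mulr_ge0; last exact: sqr_ge0.
      apply: mulr_ge0; last exact: sqr_ge0.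
      exact: ltW.
    rewrite /f; have : 0 <= c n * y ^+ 2 by rewrite mulr_ge0 ?sqr_ge0.
    by move: wy; lra.
  rewrite lt_neqAle f_neq0 ?gt_eqF//= leNgt; apply/negP => fx.
  have /andP[+ _] := crossing n0 x0 y0 fx fy.
  rewrite gt_min !ltNge (ltW xH)/= => /negP; apply.
  by rewrite ltW// (lt_trans (H1 n0))// (lt_trans kap1).
Qed.

End Energy.

(** * Divided differences *)

Section DividedDifferences.
Context {R : realType}.
Variables (w dw : R -> R).
Hypotheses (dwP : forall x, is_derive x (1 : R) w (dw x)) (cdw : continuous dw).

(** First divided differences of w, written as averages of its derivative so
    as to make sense and be continuous on the diagonal. *)
Definition divdiff (x y : R) : R := prim (fun s => dw (x + s * (y - x))) 1.

Let integrand_cts (x y : R) : continuous (fun s : R => dw (x + s * (y - x))).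
Proof.
move=> s; apply: (@cts_comp R R R (fun s : R => x + s * (y - x)) dw); last exact: cdw.
apply: (@cts_add R R (cst x) (fun s : R => s * (y - x))); first exact: cts_cst.
apply: (@cts_mul R R id (cst (y - x))); last exact: cts_cst.
exact: cvg_id.
Qed.

Lemma divdiffE x y : (y - x) * divdiff x y = w y - w x.
Proof.
have h (s : R) : is_derive s (1 : R) (fun s => w (x + s * (y - x)))
    ((y - x) * dw (x + s * (y - x))).
  rewrite mulrC; apply: (@is_derive_chain _ w (fun s => x + s * (y - x))) => //.
  apply: (is_derive_ext (is_derive_add (is_derive_cst x s (1 : R))
    (is_derive_mul (is_derive_id s (1 : R)) (is_derive_cst (y - x) s (1 : R))))).
  by rewrite add0r mul1r mulr0 addr0.
have h2 (s : R) : is_derive s (1 : R)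
    (fun s => (y - x) * prim (fun s => dw (x + s * (y - x))) s)
    ((y - x) * dw (x + s * (y - x))).
  exact/is_derive_scale/is_derive_prim/integrand_cts.
have := primitive_unique h2 h 1.
by rewrite /divdiff prim0 ?mulr0 ?subr0 ?mul0r ?mul1r ?addr0 ?[x + _]addrC ?subrK.
Qed.

Lemma divdiffxx x : divdiff x x = dw x.
Proof.
rewrite /divdiff (_ : (fun s => _) = cst (dw x)) ?prim_cst ?mulr1//.
by apply/funext => s; rewrite subrr mulr0 addr0.
Qed.

Lemma divdiffC x y : divdiff x y = divdiff y x.
Proof.
have [->//|xy] := eqVneq x y.
have h : y - x != 0 by rewrite subr_eq0 eq_sym.
apply: (mulfI h); rewrite divdiffE -[y - x]opprB mulNr divdiffE.
by rewrite opprB.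
Qed.

Lemma divdiff_cts (z : R * R) : {for z, continuous (fun z : R * R => divdiff z.1 z.2)}.
Proof.
pose f (z : R * R) (s : R) := dw (z.1 + s * (z.2 - z.1)).
have cf (s : R) : {for (z, s), continuous (fun u : (R * R) * R => f u.1 u.2)}.
  have c1 : {for (z, s), continuous (fun u : (R * R) * R => u.1.1)}.
    by apply: (@cts_comp _ _ _ (fun u : (R * R) * R => u.1) (fun u => u.1));
      [exact: cts_fst|exact: cts_fst].
  have c2 : {for (z, s), continuous (fun u : (R * R) * R => u.1.2)}.
    by apply: (@cts_comp _ _ _ (fun u : (R * R) * R => u.1) (fun u => u.2));
      [exact: cts_fst|exact: cts_snd].
  apply: (@cts_comp _ _ _ (fun u : (R * R) * R => u.1.1 + u.2 * (u.1.2 - u.1.1)) dw);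
    last exact: cdw.
  apply: (@cts_add _ _ (fun u : (R * R) * R => u.1.1)) => //.
  apply: (@cts_mul _ _ (fun u : (R * R) * R => u.2)); first exact: cts_snd.
  exact: (@cts_sub _ _ (fun u : (R * R) * R => u.1.2)).
have nf : \forall q \near z, continuous (f q).
  by apply: filterE => q; exact: integrand_cts.
have cprim := @prim_param_cts R _ f z nf cf 1.
have cpair : {for z, continuous (fun z : R * R => (z, 1 : R))}.
  by apply: cts_pair; [exact: cvg_id|exact: cts_cst].
exact: (cts_comp cpair cprim).
Qed.

(** On the diagonal the second divided difference is half the second derivative;
    the estimate is uniform over arguments among which dw is affine up to e. *)
Lemma divdiff_taylor (d2 e a b h : R) (I : set R) :
  (forall x y t, I x -> I y -> 0 <= t <= 1 -> I (x + t * (y - x))) ->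
  (forall u v, I u -> I v -> `|dw u - dw v - d2 * (u - v)| <= e * `|u - v|) ->
  0 <= e -> I a -> I b -> I h ->
  `|divdiff a h - divdiff h b + d2 / 2 * (b - a)| <= e * `|b - a|.
Proof.
move=> Ic hI e0 Ia Ib Ih; rewrite [divdiff a h]divdiffC.
pose F s := prim (fun s => dw (h + s * (a - h))) s -
  prim (fun s => dw (h + s * (b - h))) s - (d2 / 2 * (a - b)) * (s * s).
pose f s := dw (h + s * (a - h)) - dw (h + s * (b - h)) - (d2 * (a - b)) * s.
have dF (s : R) : is_derive s (1 : R) F (f s).
  apply: is_derive_sub.
    by apply: is_derive_sub; apply: is_derive_prim; exact: integrand_cts.
  apply: (is_derive_ext (is_derive_scale _ (is_derive_mul (is_derive_id s (1 : R))
    (is_derive_id s (1 : R))))).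
  by field.
have [c [+ + E]] := mean_value 0 1 dF.
rewrite min_l ?max_r// => c0 c1.
move: E; rewrite /F /f mul0r mulr0 !prim0 ?subrr ?subr0 ?mulr1;
  try exact: integrand_cts.
rewrite -/(divdiff h a) -/(divdiff h b) => E.
have -> : divdiff h a - divdiff h b + d2 / 2 * (b - a) =
    divdiff h a - divdiff h b - d2 / 2 * (a - b) by ring.
rewrite E.
have := hI (h + c * (a - h)) (h + c * (b - h)) _ _.
have -> : h + c * (a - h) - (h + c * (b - h)) = c * (a - b) by ring.
move=> /(_ (Ic _ _ _ Ih Ia _) (Ic _ _ _ Ih Ib _)); rewrite c0 c1 => /(_ isT isT).
have -> : d2 * (c * (a - b)) = d2 * (a - b) * c by ring.
move=> /le_trans; apply; rewrite ler_wpM2l// normrM distrC ger0_norm//.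
by rewrite ler_piMl.
Qed.

End DividedDifferences.

(** * Clamped functions and square roots *)

Section ClampedDerivatives.
Context {R : realType}.
Implicit Types f df : R -> R.

Lemma is_derive_dist f (x d : R) :
  (forall e, 0 < e -> \forall y \near x, `|f y - f x - d * (y - x)| <= e * `|y - x|) ->
  is_derive x (1 : R) f d.
Proof.
move=> hf; have h : h^-1 *: (f (h *: (1 : R) + x) - f x) @[h --> 0^'] --> d.
  apply/cvgrPdist_le => e e0; have /nbhs_ballP[r /= r0 hr] := hf e e0.
  exists r => //= t /=; rewrite sub0r normrN => tr t0.
  have := hr (t *: 1 + x); rewrite /ball /= opprD addrCA subrr addr0 normrN.
  rewrite [t *: 1](mulr1 t) => /(_ tr); rewrite addrK => ht.
  rewrite -(ler_pM2r (x := `|t|)) ?normr_gt0// -normrM; apply: le_trans ht.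
  rewrite -normrN; rewrite le_eqVlt; apply/orP; left; apply/eqP; congr (`|_|).
  by rewrite /GRing.scale /=; field.
apply: DeriveDef; first by apply/cvg_ex; exists d.
exact: cvg_lim.
Qed.

Lemma is_derive_le f (x d e : R) : is_derive x (1 : R) f d -> 0 < e ->
  \forall y \near x, `|f y - f x - d * (y - x)| <= e * `|y - x|.
Proof.
move=> [df <-] e0; have /cvgrPdist_le/(_ _ e0) := df.
move=> [r /= r0 hr]; apply/nbhs_ballP; exists r => //= y yr.
have [->|yx] := eqVneq y x; first by rewrite !subrr mulr0 subr0 normr0 mulr0.
have yr' : `|y - x| < r by rewrite distrC.
have := hr (y - x); rewrite /= sub0r normrN => /(_ yr').
rewrite subr_eq0 => /(_ yx).
rewrite [(y - x) *: 1](mulr1 _) subrK => ht.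
rewrite -(ler_pM2r (x := `|y - x|)) ?normr_gt0 ?subr_eq0// -normrM in ht.
apply: le_trans ht; rewrite -normrN; rewrite le_eqVlt; apply/orP; left; apply/eqP; congr (`|_|).
by rewrite /GRing.scale /= -/(derive f x 1); field; rewrite subr_eq0.
Qed.

(** A profile that rests stays differentiable, since it starts with zero slope. *)
Lemma is_derive_max f df (l y : R) : (forall z, is_derive z (1 : R) f (df z)) ->
  df l = 0 -> is_derive y (1 : R) (fun y => f (Num.max y l)) (df (Num.max y l)).
Proof.
move=> dF dl; apply: is_derive_dist => e e0; have [yl|ly|->] := ltgtP y l.
- have : \forall z \near y, z < l by exact: lt_nbhsl.
  apply: filterS => z zl; rewrite (max_r (ltW zl)) dl mul0r !subrr normr0.
  by rewrite mulr_ge0// ltW.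
- have h : \forall z \near y, l < z by exact: lt_nbhsr.
  have := is_derive_le (dF y) e0; apply: filterS2 h => z lz.
  by rewrite (max_l (ltW lz)).
- have := is_derive_le (dF l) e0; apply: filterS => z.
  rewrite dl !mul0r !subr0; have [zl _|lz//] := leP z l.
  by rewrite subrr normr0 mulr_ge0// ltW.
Qed.

Lemma is_derive_min f df (h y : R) : (forall z, is_derive z (1 : R) f (df z)) ->
  df h = 0 -> is_derive y (1 : R) (fun y => f (Num.min y h)) (df (Num.min y h)).
Proof.
move=> dF dh; have dN (z : R) : is_derive z (1 : R) (fun z => f (- z)) (- df (- z)).
  apply: (is_derive_ext (is_derive_chain (dF (- z)) (is_deriveN (is_derive_id z (1 : R))))).
  by rewrite mulrN1.
have dNh : - df (- - h) = 0 by rewrite opprK dh oppr0.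
have := is_derive_max (- y) dN dNh => hm.
have := is_derive_chain hm (is_deriveN (is_derive_id y (1 : R))).
by rewrite mulrN1 opprK oppr_max !opprK; under [X in is_derive _ _ X]eq_fun do
  rewrite oppr_max !opprK.
Qed.

(** Locally the root is plus or minus the usual one. Applied to the energy
    integral, this avoids differentiating the angular speed. *)
Lemma is_derive_root (S E : R -> R) (x r : R) : continuous S ->
  (forall y, S y ^+ 2 = E y) -> S x != 0 -> is_derive x (1 : R) E (2 * S x * r) ->
  is_derive x (1 : R) S r.
Proof.
wlog S0 : S r / 0 < S x => [Hw|cS SE Sx dE].
  move=> cS SE Sx dE; have [S0|S0|S0] := ltgtP (S x) 0; last by rewrite S0 eqxx in Sx.
    have cN : continuous (fun y => - S y) by move=> y; exact: cvgN (cS y).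
    have := Hw (fun y => - S y) (- r); rewrite oppr_gt0 => /(_ S0 cN).
    have SE' y : (- S y) ^+ 2 = E y by rewrite sqrrN.
    have -> : 2 * - S x * - r = 2 * S x * r by ring.
    rewrite oppr_eq0 => /(_ SE' Sx dE) dN.
    by have := is_deriveN dN; rewrite opprK => dNN; apply: (is_derive_ext dNN); rewrite opprK.
  exact: Hw.
have Ex : 0 < E x by rewrite -SE exprn_gt0.
have := is_derive_chain (is_derive1_sqrt Ex) dE.
have -> : Num.sqrt (E x) = S x by rewrite -SE sqrtr_sqr gtr0_norm.
have -> : (2 * S x)^-1 * (2 * S x * r) = r by rewrite mulrA mulVf ?mul1r// mulf_neq0.
move=> dQ; apply: (near_eq_is_derive _ dQ).
have : \forall y \near x, 0 < S y by have /cvgr_gt := cS x; apply.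
by apply: filterS => y y0; rewrite -SE sqrtr_sqr gtr0_norm.
Qed.

Lemma sin_eq0_multiple n (t : R) : 0 <= t <= n%:R * pi -> sin t = 0 ->
  exists k : nat, t = k%:R * pi.
Proof.
elim: n t => [|n IHn] t /andP[t0 tn] st.
  by exists 0%N; rewrite mul0r; apply/eqP; rewrite eq_le t0 andbT; move: tn; rewrite mul0r.
have [tp|pt] := ltP t pi.
  exists 0%N; rewrite mul0r; apply/eqP/negPn/negP => tn0.
  by have := @sin_gt0_pi R t; rewrite st ltxx lt_neqAle eq_sym tn0 t0 tp => /(_ isT).
have [||k e] := IHn (t - pi).
- by rewrite subr_ge0 pt/= lerBlDr -[X in _ + X]mul1r -mulrDl natr1.
- by have := sinDpi (t - pi); rewrite subrK st => /esym/eqP; rewrite oppr_eq0 => /eqP.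
by exists k.+1; rewrite -natr1 mulrDl mul1r -e subrK.
Qed.

End ClampedDerivatives.

(** * The time map of monotone profiles *)

Section TimeMap.
Context {R : realType}.
Variables (eps kap : R) (w dw ddw : R -> R) (H : nat -> R).
Hypothesis eps0 : 0 < eps.
Hypothesis hp : bar_potential eps kap w dw ddw H.
Implicit Types (q z : R * R).

Let dwP := bp_dw hp.
Let cdw := @bp_dw_cts _ _ _ _ _ _ _ hp.
Notation dd := (divdiff dw).
Notation mu := (@lebesgue_measure R).
Local Notation D := (`]0, 1[%classic : set (measurableTypeR R)).

(** A point q = (b, x) of the parameter plane stands for the monotone profiles
    of the strain running from lo q = x b up to b; height q c is the strain
    at the angle of cosine c. *)
Definition lo q : R := q.2 * q.1.
Definition height q (c : R) : R := (lo q + q.1) / 2 - (q.1 - lo q) / 2 * c.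

(** Minus the second divided difference of w at lo q, height q c and q.1. The
    kinetic energy of a profile is (h - lo q) (q.1 - h) times this. *)
Definition curv q (c : R) : R :=
  if q.2 == 1 then - ddw q.1 / 2
  else (dd (lo q) (height q c) - dd (height q c) q.1) / (q.1 - lo q).

Lemma lo_cts z : {for z, continuous lo}.
Proof. by apply: cts_mul; [exact: cts_snd|exact: cts_fst]. Qed.

Lemma gap_cts z : {for z, continuous (fun q => q.1 - lo q)}.
Proof. by apply: cts_sub; [exact: cts_fst|exact: lo_cts]. Qed.

Lemma height_cts (u : (R * R) * R) :
  {for u, continuous (fun u : (R * R) * R => height u.1 u.2)}.
Proof.
have c1 : {for u, continuous (fun u : (R * R) * R => lo u.1)}.
  by apply: (@cts_comp _ _ _ (fun u : (R * R) * R => u.1) lo);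
    [exact: cts_fst|exact: lo_cts].
have c2 : {for u, continuous (fun u : (R * R) * R => u.1.1)}.
  by apply: (@cts_comp _ _ _ (fun u : (R * R) * R => u.1) (fun u => u.1));
    [exact: cts_fst|exact: cts_fst].
apply: (@cts_sub _ _ (fun u : (R * R) * R => (lo u.1 + u.1.1) / 2)).
  apply: (@cts_mul _ _ (fun u : (R * R) * R => lo u.1 + u.1.1) (cst 2^-1));
    last exact: cts_cst.
  exact: (@cts_add _ _ (fun u : (R * R) * R => lo u.1)).
apply: (@cts_mul _ _ (fun u : (R * R) * R => (u.1.1 - lo u.1) / 2)); last exact: cts_snd.
apply: (@cts_mul _ _ (fun u : (R * R) * R => u.1.1 - lo u.1) (cst 2^-1));
  last exact: cts_cst.
exact: (@cts_sub _ _ (fun u : (R * R) * R => u.1.1)).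
Qed.

Lemma gapE q : q.1 - lo q = q.1 * (1 - q.2).
Proof. by rewrite /lo; ring. Qed.

Lemma gap_neq0 q : 0 < q.1 -> (q.1 - lo q == 0) = (q.2 == 1).
Proof.
by move=> b0; rewrite gapE mulf_eq0 gt_eqF//= subr_eq0 eq_sym.
Qed.

Let ddw_near (b e : R) : 0 < b -> 0 < e -> exists2 d, 0 < d & forall y, `|b - y| < d ->
  0 < y /\ `|ddw b - ddw y| < e.
Proof.
move=> b0 e0; have /cvgrPdist_lt/(_ _ e0) h1 := bp_ddw_cts hp b0.
have h2 : \forall y \near b, 0 < y by exact: lt_nbhsr.
have : \forall y \near b, `|ddw b - ddw y| < e /\ 0 < y.
  by apply: filterS2 h1 h2.
move=> /nbhs_ballP[d /= d0 hd].
by exists d => // y /hd[].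
Qed.

(** On the diagonal, by the Taylor estimate for divided differences. *)
Lemma curv_cts z c : 0 < z.1 ->
  {for (z, c), continuous (fun u : (R * R) * R => curv u.1 u.2)}.
Proof.
move=> b0; have [x1|x1] := eqVneq z.2 1; last first.
  have hne : \forall u \near (z, c),
      (dd (lo u.1) (height u.1 u.2) - dd (height u.1 u.2) u.1.1) / (u.1.1 - lo u.1) =
      curv u.1 u.2.
    have : \forall q \near z, 0 < `|q.2 - 1|.
      have : {for z, continuous (fun q : R * R => `|q.2 - 1|)}.
        apply: cts_norm; apply: (@cts_sub _ _ (fun q : R * R => q.2) (cst 1)).
          exact: cts_snd.
        exact: cts_cst.
      by move=> /cvgr_gt; apply; rewrite normr_gt0 subr_eq0.
    move=> /(near_fst c); apply: filterS => u.
    by rewrite normr_gt0 subr_eq0 /curv => /negbTE ->.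
  have cq f : {for z, continuous f} ->
      {for (z, c), continuous (fun u : (R * R) * R => f u.1 : R)}.
    move=> cf; apply: (@cts_comp _ _ _ (fun u : (R * R) * R => u.1) f).
      exact: cts_fst.
    exact: cf.
  have cdd f g : {for (z, c), continuous f} -> {for (z, c), continuous g} ->
      {for (z, c), continuous (fun u : (R * R) * R => dd (f u) (g u))}.
    move=> cf cg; apply: (@cts_comp _ _ _ (fun u => (f u, g u))
      (fun z : R * R => dd z.1 z.2)); first exact: cts_pair.
    exact: divdiff_cts.
  have cF : {for (z, c), continuous (fun u : (R * R) * R =>
      (dd (lo u.1) (height u.1 u.2) - dd (height u.1 u.2) u.1.1) / (u.1.1 - lo u.1))}.
    apply: (@cts_mul _ _ (fun u : (R * R) * R =>
      dd (lo u.1) (height u.1 u.2) - dd (height u.1 u.2) u.1.1)).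
      apply: (@cts_sub _ _ (fun u : (R * R) * R => dd (lo u.1) (height u.1 u.2))).
        by apply: cdd; [exact/cq/lo_cts|exact: height_cts].
      by apply: cdd; [exact: height_cts|exact/cq/cts_fst].
    apply: (@cts_inv _ _ (fun u : (R * R) * R => u.1.1 - lo u.1)).
      by rewrite /= gap_neq0.
    exact/(cq (fun q => q.1 - lo q))/gap_cts.
  apply/cvgrPdist_lt => e e0; have /cvgrPdist_lt/(_ _ e0) h := cF.
  have h0 := nbhs_singleton hne.
  by apply: filterS2 h hne => u; rewrite h0 => + <-.
apply/cvgrPdist_lt => e' e0'; pose e := e' / 2.
have e0 : 0 < e by rewrite divr_gt0.
have ee : e < e' by rewrite /e; lra.
have [d d0 hd] := ddw_near b0 e0.
pose I := [set y | `|z.1 - y| < d].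
have Ic x y t : I x -> I y -> 0 <= t <= 1 -> I (x + t * (y - x)).
  rewrite /I /= => Ix Iy /andP[t0 t1].
  have -> : z.1 - (x + t * (y - x)) = (1 - t) * (z.1 - x) + t * (z.1 - y) by ring.
  apply: le_lt_trans (ler_normD _ _) _; rewrite !normrM (ger0_norm t0).
  rewrite ger0_norm ?subr_ge0//.
  have [->|tn] := eqVneq t 0; first by rewrite mul0r addr0 subr0 mul1r.
  have tp : 0 < t by rewrite lt_neqAle eq_sym tn.
  have h1 : t * `|z.1 - y| < t * d by rewrite ltr_pM2l.
  have h2 : (1 - t) * `|z.1 - x| <= (1 - t) * d by rewrite ler_wpM2l ?subr_ge0// ltW.
  by move: h1 h2; rewrite [(1 - t) * d]mulrBl mul1r; lra.
have hI u v : I u -> I v -> `|dw u - dw v - ddw z.1 * (u - v)| <= e * `|u - v|.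
  wlog uv : u v / v < u => [Hw|Iu Iv].
    move=> Iu Iv; have [uv|vu|->] := ltgtP v u.
    - exact: Hw.
    - rewrite -normrN distrC; have := Hw v u vu Iv Iu.
      by congr (`|_| <= _); ring.
    - by rewrite !subrr mulr0 subrr normr0 mulr0.
  have Imid y : v <= y <= u -> I y.
    move=> /andP[vy yu]; have := Ic v u ((y - v) / (u - v)) Iv Iu.
    rewrite divfK ?subr_eq0 ?gt_eqF// [v + _]addrC subrK; apply.
    by rewrite divr_ge0 ?subr_ge0// ?ler_pdivrMr ?subr_gt0// ?mul1r ?lerD2r// ltW.
  have [y vyu|y /andP[vy yu] E] := @mean_value_on _ dw ddw _ _ uv.
    by apply: (bp_ddw hp); have [] := hd y (Imid y vyu).
  rewrite E -mulrBl normrM ler_wpM2r// distrC ltW//.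
  by have [] := hd y (Imid y _); rewrite ?(ltW vy) ?(ltW yu).
have near_I (f : (R * R) * R -> R) : {for (z, c), continuous f} -> f (z, c) = z.1 ->
    \forall u \near (z, c), I (f u).
  by move=> /cvgrPdist_lt/(_ _ d0) h fz; apply: filterS h => u; rewrite fz.
have lz : lo z = z.1 by rewrite /lo x1 mul1r.
have n1 : \forall u \near (z, c), I u.1.1.
  apply: (near_I (fun u => u.1.1)); last by [].
  by apply: (@cts_comp _ _ _ (fun u : (R * R) * R => u.1) (fun u => u.1));
    [exact: cts_fst|exact: cts_fst].
have n2 : \forall u \near (z, c), I (lo u.1).
  apply: (near_I (fun u => lo u.1)); last by [].
  by apply: (@cts_comp _ _ _ (fun u : (R * R) * R => u.1) lo);
    [exact: cts_fst|exact: lo_cts].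
have n3 : \forall u \near (z, c), I (height u.1 u.2).
  apply: (near_I (fun u => height u.1 u.2)); first exact: height_cts.
  by rewrite /= /height lz subrr mul0r mul0r subr0; field.
apply: filterS3 n1 n2 n3 => u Ib Ia Ih.
have [b0' hb] := hd _ Ib.
rewrite {1}/curv x1 eqxx /curv; case: ifPn => [_|x1'].
  rewrite -mulrBl normrM [X in _ * X]ger0_norm ?invr_ge0// opprK addrC distrC.
  apply: le_lt_trans ee; rewrite ler_pdivrMr//; move: hb; set t := `| _ |; lra.
have ab : u.1.1 - lo u.1 != 0 by rewrite gap_neq0.
have := divdiff_taylor dwP cdw Ic hI (ltW e0) Ia Ib Ih.
set T := dd _ _ - dd _ _ => hT; apply: le_lt_trans ee.
have -> : - ddw z.1 / 2 - T / (u.1.1 - lo u.1) =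
    - ((T + ddw z.1 / 2 * (u.1.1 - lo u.1)) / (u.1.1 - lo u.1)).
  by field.
by rewrite normrN normrM normfV ler_pdivrMr// normr_gt0.
Qed.

(** The parameters of genuine profiles: the kinetic energy is positive, to
    first order also at both ends. *)
Definition admissible : set (R * R) :=
  [set q | 0 < q.1 /\ forall c, -1 <= c <= 1 -> 0 < curv q c].

Lemma near_lower_pos z : 0 < z.1 -> \forall q \near z, 0 < q.1.
Proof. by move=> z0; have /cvgr_gt := @cts_fst R R z; apply. Qed.

Lemma admissible_near z : admissible z -> \forall q \near z, admissible q.
Proof.
move=> [b0 hz].
have hc : \forall q \near z, forall c, `[-1, 1]%classic c -> 0 < curv q c.
  apply: (near_compact (P := fun q c => 0 < curv q c) (@segment_compact R (-1) 1)).
  move=> c; rewrite /= in_itv/= => c1.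
  by have /cvgr_gt := curv_cts (c := c) b0; apply; exact: hz.
apply: filterS2 (near_lower_pos b0) hc => q q0 hq; split=> [//|c c1].
by apply: hq; rewrite /= in_itv/=.
Qed.

(** Conservation of energy, eps h'^2 / 2 = kinetic energy, written for the angle
    theta of h = height q (cos theta), where (h - lo q) (q.1 - h) is a multiple
    of sin theta squared. *)
Definition speed q (t : R) : R := Num.sqrt (2 * curv q (cos t) / eps).

Definition strain q (t : R) : R := height q (cos t).
Definition clock q : R -> R := prim (fun t => (speed q t)^-1).
Definition mass q : R -> R := prim (fun t => (speed q t)^-1 * strain q t).
(** The inverse of the clock, which is onto as the speed is bounded. *)
Definition angle q (y : R) : R := xget 0 [set t | clock q t = y].

Lemma cos_itv (t : R) : -1 <= cos t <= 1.
Proof. by rewrite cos_geN1 cos_le1. Qed.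

Lemma speed_sqr q t : admissible q -> speed q t ^+ 2 = 2 * curv q (cos t) / eps.
Proof.
move=> [_ hq]; rewrite /speed sqr_sqrtr//; apply: divr_ge0; last exact: ltW.
by rewrite ltW// mulr_gt0// hq// cos_itv.
Qed.

Lemma speed_gt0 q t : admissible q -> 0 < speed q t.
Proof.
by move=> [_ hq]; rewrite sqrtr_gt0 divr_gt0// mulr_gt0// hq// cos_itv.
Qed.

Lemma speed_cts2 z t : 0 < z.1 ->
  {for (z, t), continuous (fun u : (R * R) * R => speed u.1 u.2)}.
Proof.
move=> b0; apply: (@cts_sqrt _ _ (fun u : (R * R) * R => 2 * curv u.1 (cos u.2) / eps)).
apply: (@cts_mul _ _ (fun u : (R * R) * R => 2 * curv u.1 (cos u.2)) (cst eps^-1));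
  last exact: cts_cst.
apply: (@cts_mul _ _ (cst 2) (fun u : (R * R) * R => curv u.1 (cos u.2))).
  exact: cts_cst.
apply: (@cts_comp _ _ _ (fun u : (R * R) * R => (u.1, cos u.2))
  (fun u : (R * R) * R => curv u.1 u.2)); last exact: curv_cts.
apply: cts_pair; first exact: cts_fst.
apply: (@cts_cos _ _ (fun u : (R * R) * R => u.2)); exact: cts_snd.
Qed.

Lemma strain_cts2 (u : (R * R) * R) :
  {for u, continuous (fun u : (R * R) * R => strain u.1 u.2)}.
Proof.
apply: (@cts_comp _ _ _ (fun u : (R * R) * R => (u.1, cos u.2))
  (fun u : (R * R) * R => height u.1 u.2)); last exact: height_cts.
apply: cts_pair; first exact: cts_fst.
apply: (@cts_cos _ _ (fun u : (R * R) * R => u.2)); exact: cts_snd.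
Qed.

Lemma cts_section (f : (R * R) * R -> R) q t : {for (q, t), continuous f} ->
  {for t, continuous (fun t => f (q, t))}.
Proof.
move=> cf; apply: (@cts_comp _ _ _ (fun t : R => (q, t)) f); last exact: cf.
by apply: cts_pair; [exact: cts_cst|exact: cvg_id].
Qed.

Let slowness_cts2 z t : admissible z ->
  {for (z, t), continuous (fun u : (R * R) * R => (speed u.1 u.2)^-1)}.
Proof.
move=> az; apply: (@cts_inv _ _ (fun u : (R * R) * R => speed u.1 u.2)).
  by rewrite gt_eqF// speed_gt0.
by apply: speed_cts2; case: az.
Qed.

Let density_cts2 z t : admissible z ->
  {for (z, t), continuous (fun u : (R * R) * R => (speed u.1 u.2)^-1 * strain u.1 u.2)}.
Proof.
move=> az; apply: (@cts_mul _ _ (fun u : (R * R) * R => (speed u.1 u.2)^-1)).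
  exact: slowness_cts2.
exact: strain_cts2.
Qed.

Let slowness_cts q : admissible q -> continuous (fun t => (speed q t)^-1).
Proof. by move=> aq t; exact: cts_section (slowness_cts2 aq). Qed.

Let density_cts q : admissible q -> continuous (fun t => (speed q t)^-1 * strain q t).
Proof. by move=> aq t; exact: cts_section (density_cts2 aq). Qed.

Lemma is_derive_clock q t : admissible q ->
  is_derive t (1 : R) (clock q) (speed q t)^-1.
Proof. by move=> /slowness_cts cq; exact: is_derive_prim. Qed.

Lemma is_derive_mass q t : admissible q ->
  is_derive t (1 : R) (mass q) ((speed q t)^-1 * strain q t).
Proof. by move=> /density_cts cq; exact: is_derive_prim. Qed.

Lemma clock0 q : admissible q -> clock q 0 = 0.
Proof. by move=> /slowness_cts cq; rewrite /clock prim0. Qed.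

Lemma mass0 q : admissible q -> mass q 0 = 0.
Proof. by move=> /density_cts cq; rewrite /mass prim0. Qed.

Lemma clock_incr q : admissible q -> {homo clock q : x y / x < y}.
Proof.
move=> aq x y xy.
have [c _ e] := mean_value_on xy (fun t _ => is_derive_clock t aq).
by rewrite -subr_gt0 e mulr_gt0 ?subr_gt0// invr_gt0 speed_gt0.
Qed.

Lemma clock_inj q : admissible q -> injective (clock q).
Proof. by move=> aq; exact/inc_inj/le_mono/clock_incr. Qed.

Lemma clock_surj q y : admissible q -> exists t, clock q t = y.
Proof.
move=> aq; have [b0 _] := aq.
have cc : continuous (curv q).
  by move=> c; exact: cts_section (curv_cts (c := c) b0).
have [C C0 hC] := cts_bounded_itv (-1) 1 cc.
pose S := Num.sqrt (2 * C / eps).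
have S0 : 0 < S by rewrite sqrtr_gt0 divr_gt0// mulr_gt0.
have hS t : S^-1 <= (speed q t)^-1.
  rewrite lef_pV2 ?posrE ?speed_gt0//.
  rewrite ler_sqrt; last by rewrite divr_ge0 ?ltW// mulr_gt0.
  rewrite ler_pM2r ?invr_gt0// ler_pM2l//.
  by apply: le_trans (hC _ (cos_itv t)); exact: ler_norm.
have ccl : continuous (clock q) by move=> t; exact: is_derive_cts (is_derive_clock t aq).
pose M := `|y| * S; have M0 : 0 <= M by rewrite mulr_ge0// ltW.
have dF (s : R) : is_derive s (1 : R) (fun t => clock q t - S^-1 * t)
    ((speed q s)^-1 - S^-1).
  exact: is_derive_sub (is_derive_clock s aq) (is_derive_linear S^-1 s).
have F0 t : 0 <= (speed q t)^-1 - S^-1 by rewrite subr_ge0.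
have SM : S^-1 * M = `|y| by rewrite /M mulrCA mulVf ?mulr1// gt_eqF.
have h1 : `|y| <= clock q M.
  have := derive_ge0_le dF M0 (fun t _ => F0 t).
  by rewrite clock0// mulr0 subr0 SM; lra.
have h2 : clock q (- M) <= - `|y|.
  have MN : - M <= 0 by rewrite oppr_le0.
  have := derive_ge0_le dF MN (fun t _ => F0 t).
  by rewrite clock0// mulr0 subr0 mulrN SM; lra.
have MM : - M <= M by lra.
have [||t _ e] := @IVT R (clock q) (- M) M y MM.
- exact: continuous_subspaceT.
- have := ler_norm y; have := ler_norm (- y); rewrite normrN => n1 n2.
  by rewrite ge_min le_max; apply/andP; split; apply/orP; [left|right]; lra.
by exists t.
Qed.

Lemma angleK q : admissible q -> cancel (angle q) (clock q).
Proof.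
by move=> aq y; exact: (xgetPex 0 (clock_surj y aq)).
Qed.

Lemma clockK q : admissible q -> cancel (clock q) (angle q).
Proof. by move=> aq t; apply: (clock_inj aq); rewrite angleK. Qed.

Lemma angle0 q : admissible q -> angle q 0 = 0.
Proof. by move=> aq; rewrite -[in LHS](clock0 aq) clockK. Qed.

Lemma is_derive_angle q y : admissible q ->
  is_derive y (1 : R) (angle q) (speed q (angle q y)).
Proof.
move=> aq; rewrite -[speed _ _]invrK -[in X in is_derive X](angleK aq y).
apply: is_derive_inverse.
- by apply: filterE => t; exact: clockK.
- by apply: filterE => t; exact: is_derive_cts (is_derive_clock t aq).
- exact: is_derive_clock.
- by rewrite invr_eq0 gt_eqF// speed_gt0.
Qed.

Lemma clock_cts2 z t : admissible z ->
  {for (z, t), continuous (fun u : (R * R) * R => clock u.1 u.2)}.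
Proof.
move=> az; apply: (prim_param_cts (f := fun q t => (speed q t)^-1)).
  by apply: filterS (admissible_near az) => q aq; exact: slowness_cts.
by move=> s; exact: slowness_cts2.
Qed.

Lemma mass_cts2 z t : admissible z ->
  {for (z, t), continuous (fun u : (R * R) * R => mass u.1 u.2)}.
Proof.
move=> az; apply: (prim_param_cts (f := fun q t => (speed q t)^-1 * strain q t)).
  by apply: filterS (admissible_near az) => q aq; exact: density_cts.
by move=> s; exact: density_cts2.
Qed.

Lemma angle_cts2 z y : admissible z ->
  {for (z, y), continuous (fun u : (R * R) * R => angle u.1 u.2)}.
Proof.
move=> az; apply: (inverse_param_cts (Y := clock)).
  apply: filterS (admissible_near az) => q aq; split; first exact: clock_incr.
  exact: angleK.
by move=> s; exact: clock_cts2.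
Qed.

Lemma curv_diag (b c : R) : curv (b, 1) c = - ddw b / 2.
Proof. by rewrite /curv eqxx. Qed.

Lemma strain_diag (b t : R) : strain (b, 1) t = b.
Proof. by rewrite /strain /height /lo /= mul1r; field. Qed.

Lemma speed_diag (b t : R) : speed (b, 1) t = Num.sqrt (- ddw b / eps).
Proof. by rewrite /speed curv_diag; congr Num.sqrt; field; rewrite gt_eqF. Qed.

Lemma admissible_diag (b : R) : 0 < b -> 0 < - ddw b -> admissible (b, 1).
Proof. by move=> b0 d0; split => // c _; rewrite curv_diag divr_gt0. Qed.

Lemma clock_diag (b t : R) : clock (b, 1) t = (Num.sqrt (- ddw b / eps))^-1 * t.
Proof.
rewrite /clock (_ : (fun t => _) = cst (Num.sqrt (- ddw b / eps))^-1) ?prim_cst//.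
by apply/funext => s; rewrite speed_diag.
Qed.

Lemma mass_diag (b t : R) : mass (b, 1) t = (Num.sqrt (- ddw b / eps))^-1 * b * t.
Proof.
rewrite /mass (_ : (fun t => _) = cst ((Num.sqrt (- ddw b / eps))^-1 * b)) ?prim_cst//.
by apply/funext => s; rewrite speed_diag strain_diag.
Qed.

Let charE n (x : R) : (0 < n)%N -> 0 < x ->
  n%:R * pi * x = Num.sqrt (eps * n%:R ^+ 2 * pi ^+ 2 * x ^+ 2 / eps).
Proof.
move=> n0 x0; rewrite -[LHS]ger0_norm; last first.
  by rewrite mulr_ge0 ?(ltW x0)// mulr_ge0 ?pi_ge0.
rewrite -sqrtr_sqr; congr Num.sqrt; rewrite !exprMn.
by field; rewrite gt_eqF.
Qed.

Lemma diag_below n (b : R) : (0 < n)%N -> 0 < b < H n ->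
  admissible (b, 1) /\ mass (b, 1) (n%:R * pi) < 1.
Proof.
move=> n0 bH; have /andP[b0 _] := bH; have hb := bp_below hp n0 bH.
have d0 : 0 < - ddw b.
  apply: le_lt_trans hb; do 2 (apply: mulr_ge0; last exact: sqr_ge0).
  by apply: mulr_ge0; [exact: ltW|exact: sqr_ge0].
split; first exact: admissible_diag.
rewrite mass_diag mulrAC -mulrA mulrC ltr_pdivrMr ?sqrtr_gt0 ?divr_gt0// mul1r.
by rewrite charE// ltr_sqrt ?divr_gt0// ltr_pM2r ?invr_gt0.
Qed.

Lemma diag_above n (b : R) : (0 < n)%N -> H n < b -> admissible (b, 1) ->
  1 < mass (b, 1) (n%:R * pi).
Proof.
move=> n0 bH [b0 /(_ 0)]; rewrite curv_diag => hc; have hb := bp_above hp n0 bH.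
have d0 : 0 < - ddw b.
  have : 0 < - ddw b / 2 by apply: hc; lra.
  by rewrite pmulr_lgt0// invr_gt0.
rewrite mass_diag mulrAC -mulrA mulrC ltr_pdivlMr ?sqrtr_gt0 ?divr_gt0// mul1r.
rewrite charE// ltr_sqrt ?ltr_pM2r ?invr_gt0//.
by rewrite divr_gt0// (lt_trans d0).
Qed.

(** Along the diagonal the speed is constant, and the condition of unit mass is
    the characteristic equation. *)
Lemma diag_root n : (0 < n)%N -> [/\ admissible (H n, 1),
  mass (H n, 1) (n%:R * pi) = 1 & clock (H n, 1) (n%:R * pi) = (H n)^-1].
Proof.
move=> n0; have /andP[h0 _] := bp_H hp n0; have e := bp_root hp n0.
have np : 0 < n%:R * pi :> R by rewrite mulr_gt0 ?ltr0n ?pi_gt0.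
have d0 : 0 < - ddw (H n).
  by rewrite -e mulr_gt0 ?exprn_gt0// mulr_gt0 ?exprn_gt0 ?pi_gt0// mulr_gt0//
    exprn_gt0// ltr0n.
have npi : pi != 0 :> R by rewrite gt_eqF ?pi_gt0.
have nn : n%:R != 0 :> R by rewrite pnatr_eq0 -lt0n.
have nH : H n != 0 by rewrite gt_eqF.
rewrite mass_diag clock_diag -e -charE//; split.
- exact: admissible_diag.
- by move: npi nn nH; move: (pi : R) (n%:R : R) (H n) => p m h p0 m0 h1; field;
    rewrite p0 m0 h1.
- by move: npi nn nH; move: (pi : R) (n%:R : R) (H n) => p m h p0 m0 h1; field;
    rewrite p0 m0 h1.
Qed.

(** At the upper end b = 1, where w vanishes to first order, a chord starting at
    x < 1 lies below the graph only if w x is negative. *)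
Lemma right_side n (x : R) : (0 < n)%N -> 0 <= x <= 1 -> admissible (1, x) ->
  1 < mass (1, x) (n%:R * pi).
Proof.
move=> n0 /andP[x0]; have /andP[_ hH] := bp_H hp n0.
rewrite le_eqVlt => /predU1P[->|x1]; first exact: diag_above.
move=> [_ /(_ (-1))]; rewrite /curv /height /lo /= lt_eqF// mulr1.
have -> : (x + 1) / 2 - (1 - x) / 2 * -1 = 1 by field.
rewrite divdiffxx (bp_dw1 hp) subr0 => hc.
have h1x : 0 < 1 - x by rewrite subr_gt0.
have : 0 < dd x 1 / (1 - x) by apply: hc; lra.
rewrite pmulr_lgt0 ?invr_gt0// => h.
have : 0 < (1 - x) * dd x 1 by rewrite mulr_gt0.
rewrite (divdiffE dwP cdw) (bp_w1 hp) sub0r oppr_gt0 ltNge.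
by rewrite (bp_ge0 hp).
Qed.

Lemma height_itv q c : 0 < q.1 -> 0 <= q.2 <= 1 -> -1 <= c <= 1 ->
  lo q <= height q c <= q.1.
Proof.
move=> b0 /andP[x0 x1] /andP[c0 c1]; rewrite /height.
have g0 : 0 <= q.1 - lo q by rewrite gapE mulr_ge0 ?subr_ge0// ltW.
have h1 : 0 <= (q.1 - lo q) * (1 - c) by rewrite mulr_ge0// subr_ge0.
have h2 : 0 <= (q.1 - lo q) * (1 + c) by rewrite mulr_ge0//; lra.
by move: h1 h2; rewrite mulrBr mulrDr !mulr1; lra.
Qed.

Lemma lo_ge0 q : 0 < q.1 -> 0 <= q.2 <= 1 -> 0 <= lo q <= q.1.
Proof.
move=> b0 /andP[x0 x1]; rewrite /lo mulr_ge0 ?(ltW b0)//=.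
by rewrite -[leRHS]mul1r ler_pM2r.
Qed.

(** Below the m-th bifurcation strain, w plus a quartic is concave, and the
    divided differences of the quartic are explicit. *)
Lemma curv_lower_bound m q c : (0 < m)%N -> 0 < q.1 < H m -> 0 <= q.2 <= 1 ->
  -1 <= c <= 1 -> eps * m%:R ^+ 2 * pi ^+ 2 / 12 * q.1 ^+ 2 <= curv q c.
Proof.
move=> m0 bH x01 c01; have /andP[b0 bH'] := bH.
pose K : R := eps * m%:R ^+ 2 * pi ^+ 2 / 12.
have K12 : eps * m%:R ^+ 2 * pi ^+ 2 = 12 * K by rewrite /K [RHS]mulrC divfK ?pnatr_eq0.
have K0 : 0 <= K.
  rewrite /K; apply: divr_ge0 => //; apply: mulr_ge0; last exact: sqr_ge0.
  by apply: mulr_ge0; [exact: ltW|exact: sqr_ge0].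
have below x : 0 < x < H m -> 12 * K * x ^+ 2 < - ddw x.
  by move=> xH; have := bp_below hp m0 xH; rewrite K12.
rewrite -/K /curv; case: ifPn => [_|x1].
  have : 12 * K * q.1 ^+ 2 < - ddw q.1 := below _ bH.
  have : 0 <= K * q.1 ^+ 2 by rewrite mulr_ge0 ?sqr_ge0.
  set t := q.1 ^+ 2; lra.
have /andP[a0 ab] := lo_ge0 b0 x01.
have /andP[ah hb] := height_itv b0 x01 c01.
set a := lo q in a0 ab ah *; set h := height q c in ah hb *; set b := q.1 in ab hb bH b0 bH' *.
have h0 : 0 <= h := le_trans a0 ah.
have ab' : 0 < b - a.
  by rewrite lt_neqAle subr_ge0 ab andbT eq_sym gap_neq0.
pose phi (t : R) := w t + K * t ^+ 4; pose dphi (t : R) := dw t + 4 * K * t ^+ 3.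
have X4 (t : R) : is_derive t (1 : R) (fun t => K * t ^+ 4) (4 * K * t ^+ 3).
  by apply: (is_derive_ext (is_derive_scale K (is_derive_pow 4 t))); ring.
have X3 (t : R) : is_derive t (1 : R) (fun t => 4 * K * t ^+ 3) (12 * K * t ^+ 2).
  by apply: (is_derive_ext (is_derive_scale (4 * K) (is_derive_pow 3 t))); ring.
have dphiP t : is_derive t (1 : R) phi (dphi t) by exact: is_derive_add (dwP t) (X4 t).
have cdphi : continuous dphi.
  move=> t; apply: (@cts_add R R dw (fun t : R => 4 * K * t ^+ 3)); first exact: cdw.
  exact: is_derive_cts (X3 t).
have decr s t : 0 <= s -> s <= t -> t <= b -> dphi t <= dphi s.
  move=> s0; rewrite le_eqVlt => /predU1P[->//|st] tb.
  have [z /andP[sz zt]|z /andP[sz zt] e] := @mean_value_open R dphi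
      (fun t => ddw t + 12 * K * t ^+ 2) s t st cdphi.
    apply: is_derive_add (X3 z); apply: bp_ddw hp _ _; exact: le_lt_trans sz.
  rewrite -subr_le0 e pmulr_lle0 ?subr_gt0//.
  have : 12 * K * z ^+ 2 < - ddw z.
    by apply: below; rewrite (le_lt_trans s0)//= (lt_trans zt)// (le_lt_trans tb).
  lra.
have ddphi s t : s <= t -> exists2 z, s <= z <= t &
    dd s t + K * (s ^+ 3 + s ^+ 2 * t + s * t ^+ 2 + t ^+ 3) = dphi z.
  rewrite le_eqVlt => /predU1P[<-|st].
    by exists s; rewrite ?lexx// divdiffxx /dphi; ring.
  have [z /andP[sz zt] e] := mean_value_on st (fun y _ => dphiP y).
  exists z; first by rewrite !ltW.
  have hne : t - s != 0 by rewrite subr_eq0 gt_eqF.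
  apply: (mulfI hne); rewrite mulrDr (divdiffE dwP cdw) [RHS]mulrC -e /phi.
  by ring.
have [u /andP[au uh] eu] := ddphi a h ah.
have [v /andP[hv vb] ev] := ddphi h b hb.
have uv : dphi v <= dphi u.
  by apply: decr => //; [exact: le_trans au|exact: le_trans hv].
rewrite ler_pdivlMr//.
have -> : dd a h - dd h b = (dphi u - dphi v) +
    K * (b - a) * (b ^+ 2 + (b * a + a ^+ 2 + h * (b + a) + h ^+ 2)).
  by rewrite -eu -ev; ring.
have p1 : 0 <= b * a + a ^+ 2 + h * (b + a) + h ^+ 2.
  have b0' := ltW b0.
  apply: addr_ge0; last exact: sqr_ge0.
  apply: addr_ge0; last by apply: mulr_ge0 => //; exact: addr_ge0.
  by apply: addr_ge0; [exact: mulr_ge0|exact: sqr_ge0].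
have p2 : 0 <= K * (b - a) * (b * a + a ^+ 2 + h * (b + a) + h ^+ 2).
  by rewrite mulr_ge0// mulr_ge0// ltW.
have -> : K * b ^+ 2 * (b - a) = K * (b - a) * b ^+ 2 by ring.
rewrite [K * (b - a) * (b ^+ 2 + _)]mulrDr; move: p2 uv.
move: (K * (b - a) * b ^+ 2) (K * (b - a) * (b * a + _ + _ + _)) (dphi u) (dphi v).
by move=> *; lra.
Qed.

(** The quartic bound for the mode 3 n makes the speed at least 6 / 5 n pi b,
    whence a mass of at most 5 / 6. *)
Lemma left_side n (x : R) : (0 < n)%N -> 0 <= x <= 1 ->
  let q := (H (3 * n) / 2, x) in admissible q /\ mass q (n%:R * pi) < 1.
Proof.
move=> n0 x01 q; have m0 : (0 < 3 * n)%N by rewrite muln_gt0.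
have /andP[Hm0 _] := bp_H hp m0.
have b0 : 0 < q.1 by rewrite /q divr_gt0.
have bH : 0 < q.1 < H (3 * n) by rewrite b0 /q /=; lra.
have hc c := curv_lower_bound m0 bH x01 (c := c).
set K := eps * _ * _ / 12 in hc.
have n0' : 0 < n%:R :> R by rewrite ltr0n.
have K0 : 0 < K * q.1 ^+ 2.
  rewrite mulr_gt0 ?exprn_gt0// divr_gt0// mulr_gt0 ?exprn_gt0 ?pi_gt0//.
  by rewrite mulr_gt0// exprn_gt0// ltr0n.
have aq : admissible q.
  by split=> // c c01; exact: lt_le_trans K0 (hc c c01).
split=> //; pose S : R := 6 / 5 * n%:R * pi * q.1.
have S0 : 0 < S by rewrite !mulr_gt0 ?pi_gt0.
have hS t : S <= speed q t.
  rewrite -(ler_pXn2r (n := 2)) ?nnegrE ?(ltW S0) ?(ltW (speed_gt0 t aq))//.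
  rewrite speed_sqr// ler_pdivlMr//.
  pose U : R := eps * (n%:R ^+ 2 * (pi ^+ 2 * q.1 ^+ 2)).
  have U0 : 0 <= U.
    by rewrite /U mulr_ge0 ?(ltW eps0)// mulr_ge0 ?sqr_ge0// mulr_ge0 ?sqr_ge0.
  have eK : K * q.1 ^+ 2 = 3 / 4 * U.
    by rewrite /K /U natrM; move: (pi : R) (n%:R : R) => p m; field.
  have eS : S ^+ 2 * eps = 36 / 25 * U.
    by rewrite /S /U; move: (pi : R) (n%:R : R) => p m; field.
  have := hc (cos t) (cos_itv t); rewrite eK eS.
  move: {eK eS} U U0 (curv q (cos t)) => u u0 v; lra.
have np : 0 <= n%:R * pi :> R by rewrite mulr_ge0 ?pi_ge0.
have dF (t : R) : is_derive t (1 : R) (fun t => S^-1 * q.1 * t - mass q t)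
    (S^-1 * q.1 - (speed q t)^-1 * strain q t).
  exact: is_derive_sub (is_derive_linear _ t) (is_derive_mass t aq).
have F0 t : 0 <= S^-1 * q.1 - (speed q t)^-1 * strain q t.
  have /andP[a0 _] := lo_ge0 b0 x01.
  have /andP[ah hb] := height_itv b0 x01 (cos_itv t).
  rewrite subr_ge0; apply: ler_pM => //.
  - by rewrite invr_ge0 ltW// speed_gt0.
  - exact: le_trans ah.
  - by rewrite lef_pV2 ?posrE ?speed_gt0.
have := derive_ge0_le dF np (fun t _ => F0 t).
rewrite mass0// mulr0 subrr subr_ge0 => /le_lt_trans; apply.
have -> : S^-1 * q.1 * (n%:R * pi) = 5 / 6.
  have npi : pi != 0 :> R by rewrite gt_eqF ?pi_gt0.
  rewrite /S; move: npi (gt_eqF n0') (gt_eqF b0).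
  move: (pi : R) (n%:R : R) q.1 => p m' b p0 /negbT m0' /negbT b0'.
  by field; rewrite p0 m0' b0'.
by lra.
Qed.

(** The kinetic energy of a profile is the excess of w over its chord. *)
Definition kinetic q (h : R) := w h - w (lo q) - dd (lo q) q.1 * (h - lo q).

Lemma is_derive_kinetic q (h : R) : is_derive h (1 : R) (kinetic q) (dw h - dd (lo q) q.1).
Proof.
apply: (is_derive_ext (is_derive_sub (is_derive_sub (dwP h)
  (is_derive_cst (w (lo q)) h (1 : R))) (is_derive_scale (dd (lo q) q.1)
  (is_derive_sub (is_derive_id h (1 : R)) (is_derive_cst (lo q) h (1 : R)))))).
by rewrite !subr0 mulr1.
Qed.

Let kinetic_lo q : kinetic q (lo q) = 0.
Proof. by rewrite /kinetic !subrr mulr0 subr0. Qed.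

Let kinetic_hi q : kinetic q q.1 = 0.
Proof. by rewrite /kinetic -(divdiffE dwP cdw) mulrC subrr. Qed.

Lemma kineticE q c : q.2 != 1 -> 0 < q.1 ->
  kinetic q (height q c) = (height q c - lo q) * (q.1 - height q c) * curv q c.
Proof.
move=> x1 b0; rewrite /curv (negbTE x1).
have g : q.1 - lo q != 0 by rewrite gap_neq0.
set h := height q c.
have e1 := divdiffE dwP cdw (lo q) h; have e2 := divdiffE dwP cdw h q.1.
have e3 : dd (lo q) q.1 = ((h - lo q) * dd (lo q) h + (q.1 - h) * dd h q.1) / (q.1 - lo q).
  by apply: (mulfI g); rewrite (divdiffE dwP cdw) e1 e2 mulrC divfK//; lra.
by rewrite /kinetic e3 -e1; field.
Qed.

Lemma slope_lo_gt q : admissible q -> q.2 < 1 -> dd (lo q) q.1 < dw (lo q).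
Proof.
move=> [b0 /(_ 1)] + x1; have -> : -1 <= (1 : R) <= 1 by apply/andP; split; lra.
move=> /(_ isT); rewrite /curv (lt_eqF x1) /height.
have -> : (lo q + q.1) / 2 - (q.1 - lo q) / 2 * 1 = lo q by field.
have g0 : 0 < q.1 - lo q by rewrite gapE mulr_gt0// subr_gt0.
by rewrite divdiffxx pmulr_lgt0 ?invr_gt0// subr_gt0.
Qed.

(** The slope of w takes a value at most once on each side of kap. Were the
    kinetic energy to vanish between the ends, the slope would equal that of the
    chord there and, by Rolle's theorem, on both sides of this point; at the
    lower end, the chord cannot be tangent to w for a similar reason. *)
Lemma curv_zero_hi q c : 0 < q.1 -> 0 <= q.2 < 1 ->
  (forall c, -1 <= c <= 1 -> 0 <= curv q c) -> -1 <= c <= 1 -> curv q c = 0 -> c = -1.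
Proof.
move=> b0 /andP[x0 x1] hq c01 qc.
have x1' : q.2 != 1 by rewrite lt_eqF.
have x01 : 0 <= q.2 <= 1 by rewrite x0 ltW.
have /andP[a0 ab] := lo_ge0 b0 x01.
have g0 : 0 < q.1 - lo q by rewrite gapE mulr_gt0// subr_gt0.
have ab' : lo q < q.1 by rewrite -subr_gt0.
set sig := dd (lo q) q.1.
have V0 h : lo q <= h <= q.1 -> 0 <= kinetic q h.
  move=> /andP[ah hb].
  have [c' c'01 <-] : exists2 c', -1 <= c' <= 1 & height q c' = h.
    exists ((lo q + q.1 - 2 * h) / (q.1 - lo q)); last first.
      by rewrite /height; field; rewrite gt_eqF.
    by rewrite ler_pdivlMr// ler_pdivrMr//; apply/andP; split; lra.
  have /andP[h1 h2] := height_itv b0 x01 c'01.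
  by rewrite kineticE// mulr_ge0 ?hq// mulr_ge0// subr_ge0.
have lo_slope : sig < dw (lo q).
  have := hq 1; rewrite /curv (negbTE x1') /height.
  have -> : (lo q + q.1) / 2 - (q.1 - lo q) / 2 * 1 = lo q by field.
  have -> : -1 <= (1 : R) <= 1 by apply/andP; split; lra.
  rewrite divdiffxx pmulr_lge0 ?invr_gt0// subr_ge0 => /(_ isT).
  rewrite le_eqVlt => /predU1P[sE|//]; exfalso.
  have [ak|ka] := ltP (lo q) kap.
    pose m := Num.min q.1 kap.
    have am : lo q < m by rewrite lt_min ab' ak.
    have [y /andP[ay ym] e] := mean_value_on am (fun y _ => is_derive_kinetic q y).
    have hy : dw y < dw (lo q).
      by apply: bp_decr hp _ _ _ _ _ => //; rewrite (le_trans (ltW ym))// ge_min lexx orbT.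
    have := V0 m; rewrite (ltW am) ge_min lexx/= => /(_ isT).
    rewrite leNgt => /negP; apply; move: e; rewrite kinetic_lo subr0 => ->.
    by rewrite pmulr_llt0 ?subr_gt0// subr_lt0 sE.
  have [y /andP[ay yb] e] := mean_value_on ab' (fun y _ => is_derive_kinetic q y).
  have hy : dw (lo q) < dw y by exact: bp_incr hp _ _ ka ay.
  move: e; rewrite kinetic_lo kinetic_hi subrr => /esym/eqP.
  rewrite mulf_eq0 (gt_eqF g0) orbF subr_eq0 => /eqP yE.
  by move: hy; rewrite yE -sE ltxx.
apply/eqP/negPn/negP => c1; have /andP[c0 c1'] := c01.
have c0' : -1 < c by rewrite lt_neqAle eq_sym c1.
pose h := height q c.
have hb : h < q.1.
  have : 0 < (q.1 - lo q) * (1 + c) by rewrite mulr_gt0//; lra.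
  by rewrite /h /height mulrDr mulr1; lra.
have /andP[] := height_itv b0 x01 c01; rewrite -/h le_eqVlt => /predU1P[ha|ah] _.
  move: qc; rewrite /curv (negbTE x1') -/h -ha divdiffxx => /eqP.
  by rewrite mulf_eq0 invr_eq0 (gt_eqF g0) orbF gt_eqF// subr_gt0.
have Vh : kinetic q h = 0 by rewrite kineticE// qc mulr0.
have dVh : dw h = sig.
  have e : is_derive h (1 : R) (kinetic q) 0.
    apply: (@derive1_at_min R (kinetic q) (lo q) q.1 h ab).
    - by move=> t _; case: (is_derive_kinetic q t).
    - by rewrite in_itv/= ah.
    - by move=> t; rewrite in_itv/= => /andP[t1 t2]; rewrite Vh V0// !ltW.
  apply/eqP; rewrite -subr_eq0; apply/eqP.
  by case: e => _ <-; case: (is_derive_kinetic q h).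
have crit u v : u < v -> kinetic q u = 0 -> kinetic q v = 0 -> exists2 y, u < y < v & dw y = sig.
  move=> uv Vu Vv; have [y uyv e] := mean_value_on uv (fun y _ => is_derive_kinetic q y).
  exists y => //; move: e; rewrite Vu Vv subrr => /esym/eqP.
  by rewrite mulf_eq0 [v - u == 0]gt_eqF ?subr_gt0// orbF subr_eq0 => /eqP.
have [y1 /andP[ay1 y1h] e1] := crit _ _ ah (kinetic_lo q) Vh.
have [y2 /andP[hy2 y2b] e2] := crit _ _ hb Vh (kinetic_hi q).
have [hk|kh] := leP h kap.
  have : dw h < dw y1 by apply: bp_decr hp _ _ _ y1h hk; rewrite (le_trans a0)// ltW.
  by rewrite dVh e1 ltxx.
have : dw h < dw y2 by exact: bp_incr hp _ _ (ltW kh) hy2.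
by rewrite dVh e2 ltxx.
Qed.

(** The kinetic energy is compared with its linearization at the upper end, by
    the mean value theorem for the slope of w. *)
Lemma curv_upper_bound q (C t : R) : admissible q -> 0 <= q.2 < 1 ->
  (forall y, q.1 / 2 <= y <= q.1 -> `|ddw y| <= C) -> 0 <= C -> cos t <= 0 ->
  curv q (cos t) <= 2 * curv q (-1) + C * (1 + cos t).
Proof.
move=> [b0 hq] /andP[x0 x1] hC C0 ct0.
have x1' : q.2 != 1 by rewrite lt_eqF.
have x01 : 0 <= q.2 <= 1 by rewrite x0 ltW.
have /andP[a0 ab] := lo_ge0 b0 x01.
have g0 : 0 < q.1 - lo q by rewrite gapE mulr_gt0// subr_gt0.
have ct := cos_itv t; have /andP[ct1 _] := ct.
move: ct1; rewrite le_eqVlt => /predU1P[<-|ct1].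
  have : 0 < curv q (-1) by apply: hq; apply/andP; split; lra.
  by rewrite subrr mulr0 addr0; lra.
set c := cos t in ct ct0 ct1 *; set k := curv q c.
have k0 : 0 <= k by rewrite /k ltW// hq.
set a := lo q in a0 ab g0 *; set b := q.1 in ab g0 hC b0 *.
pose r := (b - a) / 2; have r0 : 0 < r by rewrite /r divr_gt0.
have h1 : height q c - a = r * (1 - c) by rewrite /height -/a -/b /r; field.
have h2 : b - height q c = r * (1 + c) by rewrite /height -/a -/b /r; field.
set h := height q c in h1 h2.
have hb : h < b by rewrite -subr_gt0 h2 mulr_gt0//; lra.
have bh : b / 2 <= h.
  have : 0 <= r * (- c) by rewrite mulr_ge0 ?(ltW r0)// oppr_ge0.
  by move: h1; rewrite mulrBr mulr1 mulrN /r; lra.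
have [y /andP[hy yb] e] := mean_value_on hb (fun y _ => is_derive_kinetic q y).
have [|y' /andP[yy' y'b] e'] := @mean_value_on _ dw ddw _ _ yb.
  move=> u /andP[yu _]; apply: bp_ddw hp _ _.
  by apply: lt_le_trans yu; apply: lt_trans hy; apply: lt_le_trans bh; rewrite divr_gt0.
have kE : h - a != 0 -> (h - a) * k = dd a b - dw y.
  move=> _; have bh0 : b - h != 0 by rewrite subr_eq0 gt_eqF.
  apply: (mulfI bh0); move: e; rewrite kinetic_hi kineticE// -/h -/a -/b -/k.
  by move=> e; rewrite mulrA [(b - h) * (h - a)]mulrC; lra.
have k1 : (b - a) * curv q (-1) = dd a b - dw b.
  rewrite /curv (negbTE x1') /height -/a -/b.
  have -> : (a + b) / 2 - (b - a) / 2 * -1 = b by field.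
  by rewrite divdiffxx mulrC divfK// gt_eqF.
have ha0 : h - a != 0 by rewrite h1 mulf_neq0 ?gt_eqF//; lra.
have dd' : dw b - dw y <= C * (b - h).
  have hy' : ddw y' <= C.
    apply: le_trans (ler_norm _) (hC _ _).
    by rewrite (ltW y'b) andbT (le_trans bh)// ltW// (lt_trans hy).
  rewrite e'; apply: (@le_trans _ _ (C * (b - y))).
    by rewrite ler_wpM2r// subr_ge0 ltW.
  by rewrite ler_wpM2l// lerD2l lerN2 ltW.
have : (h - a) * k <= (b - a) * curv q (-1) + C * (b - h).
  by rewrite (kE ha0) k1; lra.
rewrite h1 h2 (_ : b - a = r * 2); last by rewrite /r; field.
have -> : r * 2 * curv q (-1) + C * (r * (1 + c)) =
  r * (2 * curv q (-1) + C * (1 + c)) by ring.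
rewrite -mulrA ler_pM2l// => /(le_trans _); apply.
by rewrite mulrBl mul1r lerBrDr gerDl mulr_le0_ge0.
Qed.

Lemma cos_near_pi (t : R) : t <= pi -> 1 + cos t <= (pi - t) ^+ 2.
Proof.
move=> tpi.
have [c [+ + e]] := mean_value pi t (@is_derive_cos R).
rewrite min_r// max_l// => tc cpi.
have [d [_ _ e']] := mean_value pi c (@is_derive_sin R).
have E : 1 + cos t = cos d * (pi - c) * (t - pi).
  rewrite -[1]opprK -(cospi R) addrC e; rewrite sinpi subr0 in e'.
  by rewrite e'; move: (pi : R) (cos d) => p k; ring.
have c_t : `|pi - c| <= pi - t by rewrite ger0_norm ?subr_ge0// lerD2l lerN2.
have t_t : `|t - pi| = pi - t by rewrite distrC ger0_norm ?subr_ge0.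
rewrite E; apply: le_trans (ler_norm _) _; rewrite !normrM t_t expr2.
rewrite ler_wpM2r ?subr_ge0// -[leRHS]mul1r; apply: ler_pM => //.
by rewrite ler_norml; exact: cos_itv.
Qed.

Lemma cos_le0_past_pihalf (t : R) : pi / 2 <= t <= pi -> cos t <= 0.
Proof.
move=> /andP[t1 t2]; have -> : t = (t - pi / 2) + pi / 2 by rewrite subrK.
rewrite cosDpihalf oppr_le0 sin_ge0_pi// subr_ge0 t1/=.
by have := pi_gt0 R; lra.
Qed.

Lemma strain_ge0 q t : admissible q -> 0 <= q.2 <= 1 -> 0 <= strain q t.
Proof.
move=> [b0 _] x01; have /andP[a0 _] := lo_ge0 b0 x01.
by have /andP[ah _] := height_itv b0 x01 (cos_itv t); exact: le_trans ah.
Qed.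

Lemma mass_mono q s t : admissible q -> 0 <= q.2 <= 1 -> s <= t -> mass q s <= mass q t.
Proof.
move=> aq x01 st; apply: (derive_ge0_le (fun y => is_derive_mass y aq) st) => y _.
by rewrite mulr_ge0 ?strain_ge0// invr_ge0 ltW// speed_gt0.
Qed.

Lemma mass_ge_linear q (m s : R) : admissible q -> 0 <= m -> 0 < s ->
  (forall t, m <= strain q t) -> (forall t, speed q t <= s) ->
  m / s * pi <= mass q pi.
Proof.
move=> aq m0 s0 hm hs.
have dF (t : R) : is_derive t (1 : R) (fun t => mass q t - m / s * t)
    ((speed q t)^-1 * strain q t - m / s).
  exact: is_derive_sub (is_derive_mass t aq) (is_derive_linear _ t).
have F0 t : 0 <= (speed q t)^-1 * strain q t - m / s.
  rewrite subr_ge0 mulrC; apply: ler_pM => //; first by rewrite invr_ge0 ltW.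
  by rewrite lef_pV2 ?posrE ?speed_gt0.
have := derive_ge0_le dF (pi_ge0 R) (fun t _ => F0 t).
by rewrite mass0// mulr0 subr0 subr_ge0.
Qed.

(** The integral of m / (s + B (pi - t)) over the second half of a run is a
    logarithm, which diverges as s tends to zero. *)
Lemma mass_ge_log q (m s B : R) : admissible q -> 0 <= q.2 <= 1 -> 0 <= m ->
  0 < s -> 0 < B ->
  (forall t, pi / 2 <= t <= pi -> m <= strain q t) ->
  (forall t, pi / 2 <= t <= pi -> speed q t <= s + B * (pi - t)) ->
  m / B * (ln (s + B * (pi / 2)) - ln s) <= mass q pi.
Proof.
move=> aq x01 m0 s0 B0 hm hs; have p0 := pi_gt0 R.
have half : pi / 2 <= pi :> R by lra.
have den (t : R) : t <= pi -> 0 < s + B * (pi - t).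
  by move=> tp; rewrite ltr_wpDr// mulr_ge0 ?subr_ge0// ltW.
have dF (t : R) : pi / 2 <= t <= pi ->
    is_derive t (1 : R) (fun t => mass q t + m / B * ln (s + B * (pi - t)))
    ((speed q t)^-1 * strain q t + m / B * ((s + B * (pi - t))^-1 * (- B))).
  move=> /andP[_ tp]; apply: is_derive_add; first exact: is_derive_mass.
  apply: is_derive_scale; apply: (@is_derive_chain _ (@ln R) (fun t => s + B * (pi - t))).
    exact/is_derive1_ln/den.
  apply: (is_derive_ext (is_derive_add (is_derive_cst s t (1 : R))
    (is_derive_scale B (is_derive_sub (is_derive_cst (pi : R) t (1 : R))
      (is_derive_id t (1 : R)))))).
  by rewrite add0r sub0r mulrN1.
have F0 (t : R) : pi / 2 <= t <= pi ->
    0 <= (speed q t)^-1 * strain q t + m / B * ((s + B * (pi - t))^-1 * (- B)).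
  move=> tt; have /andP[_ tp] := tt; have d0 := den t tp.
  have -> : m / B * ((s + B * (pi - t))^-1 * - B) = - ((s + B * (pi - t))^-1 * m).
    move: (s + _) d0 => d d0; field; rewrite !gt_eqF//.
  rewrite subr_ge0; apply: ler_pM => //; last exact: hm.
    by rewrite invr_ge0 ltW.
  by rewrite lef_pV2 ?posrE ?speed_gt0// hs.
have := derive_ge0_le_on half dF F0.
rewrite subrr mulr0 addr0 (_ : pi - pi / 2 = pi / 2 :> R); last by lra.
have : 0 <= mass q (pi / 2).
  rewrite -(mass0 aq); apply: mass_mono => //; lra.
rewrite mulrBr; move: (mass q _) (mass q _) (m / B * _) (m / B * _) => *; lra.
Qed.

(** If curv takes a negative value at z, no parameter near z is admissible.
    Otherwise it vanishes somewhere: either z is diagonal and the speed is small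
    throughout, or the speed nearly vanishes, at a linear rate, at the upper
    end, where the strain is not small. *)
Lemma escape n (z : R * R) : (0 < n)%N -> 0 < z.1 -> 0 <= z.2 <= 1 -> ~ admissible z ->
  \forall q \near z, 0 <= q.2 <= 1 -> admissible q -> 1 < mass q (n%:R * pi).
Proof.
move=> n0 b0 /andP[x0 x1] naz.
have near_curv c e : curv z c < e -> \forall q \near z, curv q c < e.
  have cc : {for z, continuous (fun q => curv q c)}.
    apply: (@cts_comp _ _ _ (fun q => (q, c)) (fun u : (R * R) * R => curv u.1 u.2)).
      by apply: cts_pair; [exact: cvg_id|exact: cts_cst].
    exact: curv_cts.
  by move=> he; move/cvgr_lt : cc; apply.
have [[c c01 cneg]|npos] := pselect (exists2 c, -1 <= c <= 1 & curv z c < 0).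
  by apply: filterS (near_curv c 0 cneg) => q qc _ [_ /(_ c c01)]; rewrite ltNge ltW.
have hz c : -1 <= c <= 1 -> 0 <= curv z c.
  by move=> c01; rewrite leNgt; apply/negP => cneg; apply: npos; exists c.
have [c c01 cz] : exists2 c, -1 <= c <= 1 & curv z c = 0.
  apply: contrapT => nex; apply: naz; split => // c c01.
  rewrite lt_neqAle hz// andbT; apply/eqP => /esym cz; apply: nex; by exists c.
have pi_n : pi <= n%:R * pi :> R.
  by rewrite -[leLHS]mul1r ler_wpM2r ?pi_ge0// ler1n.
have near_b : \forall q \near z, z.1 / 2 < q.1 /\ q.1 < 2 * z.1.
  have h1 : \forall q \near z, z.1 / 2 < q.1.
    have /cvgr_gt := @cts_fst R R z; apply; lra.
  have h2 : \forall q \near z, q.1 < 2 * z.1.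
    have /cvgr_lt := @cts_fst R R z; apply; lra.
  exact: filterS2 h1 h2.
have p2 := pi_ge2 R.
move: x1; rewrite le_eqVlt => /predU1P[x1|x1].
  (* Degeneration on the diagonal: the speed is uniformly small. *)
  have curv0 c' : curv z c' = 0.
    by move: cz; rewrite /curv x1 eqxx.
  (* A speed below z.1 / 8 and a strain above z.1 / 4 give a mass above 2 pi. *)
  pose s := z.1 / 8; have s0 : 0 < s by rewrite divr_gt0.
  have e0 : 0 < eps * s ^+ 2 / 2 by rewrite divr_gt0// mulr_gt0// exprn_gt0.
  have nc := near_uniform (f := curv) (@segment_compact R (-1) 1)
    (fun c' _ => curv_cts (c := c') b0) e0.
  have nlo : \forall q \near z, z.1 / 4 < lo q.
    have /cvgr_gt := @lo_cts z; apply; rewrite /lo x1 mul1r; lra.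
  apply: filterS3 nc near_b nlo => q qc [qb1 qb2] qlo qx aq.
  have [qb0 _] := aq.
  have h1 t : z.1 / 4 <= strain q t.
    by have /andP[h _] := height_itv qb0 qx (cos_itv t); exact: le_trans (ltW qlo) h.
  have h2 t : speed q t <= s.
    rewrite -(ler_pXn2r (n := 2)) ?nnegrE ?(ltW s0) ?(ltW (speed_gt0 t aq))//.
    rewrite speed_sqr// ler_pdivrMr//.
    have := qc (cos t); rewrite /= in_itv/= cos_itv curv0 subr0 => /(_ isT) h.
    by have := ler_norm (curv q (cos t)); lra.
  have z40 : 0 <= z.1 / 4 by rewrite divr_ge0// ltW.
  have := mass_ge_linear aq z40 s0 h1 h2.
  have -> : z.1 / 4 / s = 2 by rewrite /s; field; rewrite gt_eqF.
  have := mass_mono aq qx pi_n.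
  move: p2; move: (pi : R) (mass q _) (mass q _) => *; lra.
(* Degeneration at the upper end of a genuine profile. *)
have xz : 0 <= z.2 < 1 by rewrite x0.
have c1 := curv_zero_hi b0 xz hz c01 cz.
rewrite {}c1 {c01} in cz.
have cddw : continuous (fun y => ddw (Num.max y (z.1 / 4))).
  have z4 : 0 < z.1 / 4 by rewrite divr_gt0.
  move=> y; apply: (@cts_comp _ _ _ (fun y => Num.max y (z.1 / 4)) ddw).
    by apply: (@cts_max _ _ id (cst (z.1 / 4))); [exact: cvg_id|exact: cts_cst].
  by apply: (bp_ddw_cts hp); rewrite lt_max z4 orbT.
have [C C0 hC] := cts_bounded_itv (z.1 / 4) (2 * z.1) cddw.
pose B := Num.sqrt (2 * C / eps).
have B0 : 0 < B by rewrite sqrtr_gt0 divr_gt0// mulr_gt0.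
have B2 : B ^+ 2 = 2 * C / eps by rewrite sqr_sqrtr// divr_ge0 ?(ltW eps0)// mulr_ge0// ltW.
pose E := expR (4 * B / z.1); have E0 : 0 < E by exact: expR_gt0.
(* With this s the logarithm in mass_ge_log exceeds 4 B / z.1, the inverse of
   its coefficient. *)
pose s := B * (pi / 2) / E.
have s0 : 0 < s by rewrite divr_gt0// mulr_gt0// divr_gt0// pi_gt0.
have e0 : curv z (-1) < eps * s ^+ 2 / 4.
  by rewrite cz divr_gt0// mulr_gt0// exprn_gt0.
have nx : \forall q \near z, q.2 < 1.
  by have /cvgr_lt := @cts_snd R R z; apply.
apply: filterS3 (near_curv _ _ e0) near_b nx => q qc [qb1 qb2] qx1 qx aq.
have [qb0 _] := aq; have /andP[qx0 _] := qx.
have h1 t : pi / 2 <= t <= pi -> z.1 / 4 <= strain q t.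
  move=> /cos_le0_past_pihalf ct; have /andP[a0 ab] := lo_ge0 qb0 qx.
  have : 0 <= (q.1 - lo q) * (- cos t) by rewrite mulr_ge0 ?subr_ge0// oppr_ge0.
  by rewrite /strain /height mulrN; lra.
have h2 t : pi / 2 <= t <= pi -> speed q t <= s + B * (pi - t).
  move=> tt; have ct := cos_le0_past_pihalf tt; have /andP[_ tp] := tt.
  have tp0 : 0 <= B * (pi - t) by rewrite mulr_ge0 ?subr_ge0// ltW.
  have sB0 : 0 <= s + B * (pi - t) by rewrite addr_ge0// ltW.
  rewrite -(ler_pXn2r (n := 2)) ?nnegrE ?(ltW (speed_gt0 t aq))//.
  rewrite speed_sqr// ler_pdivrMr//.
  have hCq y : q.1 / 2 <= y <= q.1 -> `|ddw y| <= C.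
    move=> /andP[y1 y2]; have := hC y; rewrite max_l; last by lra.
    by apply; apply/andP; split; lra.
  have qx01 : 0 <= q.2 < 1 by rewrite qx0.
  have ub := curv_upper_bound aq qx01 hCq (ltW C0) ct.
  have cp := cos_near_pi tp.
  have : C * (1 + cos t) <= C * (pi - t) ^+ 2 by rewrite ler_pM2l.
  have -> : (s + B * (pi - t)) ^+ 2 * eps =
    eps * s ^+ 2 + 2 * eps * (s * (B * (pi - t))) + eps * B ^+ 2 * (pi - t) ^+ 2.
    by move: (pi - t) => u; ring.
  have -> : eps * B ^+ 2 * (pi - t) ^+ 2 = 2 * (C * (pi - t) ^+ 2).
    by rewrite B2 mulrA; congr (_ * _); field; rewrite gt_eqF.
  have : 0 <= 2 * eps * (s * (B * (pi - t))).
    by rewrite mulr_ge0// mulr_ge0// ltW.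
  move: ub qc; move: (curv q _) (curv q _) (C * (1 + _)) (C * (_ ^+ 2)) (2 * eps * _) (eps * _).
  by move=> *; lra.
have z40 : 0 <= z.1 / 4 by rewrite divr_ge0// ltW.
have := mass_ge_log aq qx z40 s0 B0 h1 h2.
have hln : 4 * B / z.1 < ln (s + B * (pi / 2)) - ln s.
  have -> : s + B * (pi / 2) = s * (1 + E).
    by rewrite mulrDr mulr1 /s divfK// gt_eqF.
  rewrite lnM ?posrE ?addr_gt0// [ln s + _]addrC addrK -[ltLHS]expRK.
  by rewrite ltr_ln ?posrE ?addr_gt0// -/E ltrDr.
have hB : z.1 / 4 / B * (4 * B / z.1) = 1 by field; rewrite !gt_eqF.
have hpos : 0 < z.1 / 4 / B by rewrite divr_gt0// divr_gt0.
have := mass_mono aq qx pi_n.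
have : 1 < z.1 / 4 / B * (ln (s + B * (pi / 2)) - ln s).
  by rewrite -{1}hB ltr_pM2l.
move: (mass q _) (mass q _) (z.1 / 4 / B * _) => *; lra.
Qed.

(** * Solutions and the branch they form *)

Lemma sin_multiple n : sin (n%:R * pi) = 0 :> R.
Proof.
elim: n => [|n IHn]; first by rewrite mul0r sin0.
by rewrite -natr1 mulrDl mul1r sinDpi IHn oppr0.
Qed.

(** A profile turns at the angles 0, pi, ..., n pi; before time 0 it rests at
    its lower end for a duration L, which is the contact with the obstacle. *)
Definition load n q L : R := clock q (n%:R * pi) + L.
Definition time n q L s : R :=
  Num.max (Num.min (load n q L * s - L) (clock q (n%:R * pi))) 0.
Definition phase n q L s : R := angle q (time n q L s).
Definition strain_slope q t : R := (q.1 - lo q) / 2 * sin t * speed q t.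
Definition disp n q L s : R := load n q L * strain q (phase n q L s) - 1.
Definition disp_slope n q L s : R :=
  load n q L ^+ 2 * strain_slope q (phase n q L s).

Lemma is_derive_strain q y : admissible q ->
  is_derive y (1 : R) (fun y => strain q (angle q y)) (strain_slope q (angle q y)).
Proof.
move=> aq; have d1 := is_derive_chain (is_derive_cos (angle q y))
  (is_derive_angle y aq).
apply: (is_derive_ext (is_derive_sub (is_derive_cst ((lo q + q.1) / 2) y (1 : R))
  (is_derive_scale ((q.1 - lo q) / 2) d1))).
by rewrite /strain_slope; ring.
Qed.

Section Fixed.
Variables (n : nat) (q : R * R) (L : R).
Hypothesis n0 : (0 < n)%N.
Hypothesis aq : admissible q.
Hypothesis L0 : 0 <= L.
Notation T := (clock q (n%:R * pi)).
Notation l := (load n q L).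

Lemma clock_gt0 : 0 < T.
Proof.
rewrite -(clock0 aq); apply: (clock_incr aq).
by rewrite mulr_gt0 ?ltr0n ?pi_gt0.
Qed.

Lemma load_gt0 : 0 < l.
Proof. by rewrite ltr_wpDr// clock_gt0. Qed.

Lemma time_start s : l * s <= L -> time n q L s = 0.
Proof. by move=> h; rewrite /time max_r// ge_min subr_le0 h. Qed.

Lemma time_end s : 1 <= s -> time n q L s = T.
Proof.
move=> s1; rewrite /time min_r; first by rewrite max_l// ltW// clock_gt0.
by rewrite lerBrDr -/l -[leLHS]mulr1 ler_pM2l// load_gt0.
Qed.

Lemma time_itv s : 0 <= time n q L s <= T.
Proof.
have T0 : 0 <= T by rewrite ltW// clock_gt0.
by rewrite /time le_max lexx orbT ge_max T0 ge_min lexx orbT.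
Qed.

Lemma angle_T : angle q T = n%:R * pi.
Proof. by rewrite clockK. Qed.

Lemma strain_slope_start : strain_slope q (angle q 0) = 0.
Proof. by rewrite /strain_slope angle0// sin0 mulr0 mul0r. Qed.

Lemma strain_slope_end : strain_slope q (angle q T) = 0.
Proof. by rewrite /strain_slope angle_T sin_multiple mulr0 mul0r. Qed.

Lemma is_derive_profile s : is_derive s (1 : R)
  (fun s => strain q (phase n q L s)) (strain_slope q (phase n q L s) * l).
Proof.
pose f y := strain q (angle q y); pose df y := strain_slope q (angle q y).
have d1 y : is_derive y (1 : R) (fun y => f (Num.max y 0)) (df (Num.max y 0)).
  apply: is_derive_max; last exact: strain_slope_start.
  by move=> z; exact: is_derive_strain.
have d2 y : is_derive y (1 : R) (fun y => f (Num.max (Num.min y T) 0))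
    (df (Num.max (Num.min y T) 0)).
  apply: (is_derive_min (f := fun y => f (Num.max y 0)) (df := fun y => df (Num.max y 0)) y d1).
  by rewrite max_l ?ltW ?clock_gt0//; exact: strain_slope_end.
have d3 := is_derive_sub (is_derive_linear l s) (is_derive_cst L s (1 : R)).
apply: (is_derive_ext (@is_derive_chain R (fun y => f (Num.max (Num.min y T) 0))
  (fun s => l * s - L) _ _ s (d2 _) d3)).
by rewrite subr0.
Qed.

Lemma is_derive_disp s :
  is_derive s (1 : R) (disp n q L) (disp_slope n q L s).
Proof.
apply: (is_derive_ext (is_derive_sub (is_derive_scale l (is_derive_profile s))
  (is_derive_cst (1 : R) s (1 : R)))).
by rewrite /disp_slope; ring.
Qed.

Lemma profile_cts : continuous (fun s => strain q (phase n q L s)).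
Proof. by move=> s; exact: is_derive_cts (is_derive_profile s). Qed.

End Fixed.

Lemma time_cts3 n q L s : admissible q ->
  {for (q, L, s), continuous (fun u : R * R * R * R => time n u.1.1 u.1.2 u.2)}.
Proof.
move=> aq; pose X := (R * R * R * R)%type.
have c1 : {for (q, L, s), continuous (fun u : X => u.1)} by exact: cts_fst.
have cq : {for (q, L, s), continuous (fun u : X => u.1.1)}.
  by apply: (@cts_comp _ _ _ (fun u : X => u.1) (fun u => u.1)); [exact: c1|exact: cts_fst].
have cL : {for (q, L, s), continuous (fun u : X => u.1.2)}.
  by apply: (@cts_comp _ _ _ (fun u : X => u.1) (fun u => u.2)); [exact: c1|exact: cts_snd].
have cT : {for (q, L, s), continuous (fun u : X => clock u.1.1 (n%:R * pi))}.
  apply: (@cts_comp _ _ _ (fun u : X => (u.1.1, n%:R * pi : R))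
    (fun v : R * R * R => clock v.1 v.2)); last exact: clock_cts2.
  by apply: cts_pair => //; exact: cts_cst.
apply: (@cts_max _ _ (fun u : X => Num.min (load n u.1.1 u.1.2 * u.2 - u.1.2)
  (clock u.1.1 (n%:R * pi))) (cst 0)); last exact: cts_cst.
apply: (@cts_min _ _ (fun u : X => load n u.1.1 u.1.2 * u.2 - u.1.2)); last exact: cT.
apply: (@cts_sub _ _ (fun u : X => load n u.1.1 u.1.2 * u.2)); last exact: cL.
apply: (@cts_mul _ _ (fun u : X => load n u.1.1 u.1.2)); last exact: cts_snd.
exact: (@cts_add _ _ (fun u : X => clock u.1.1 (n%:R * pi))).
Qed.

Lemma load_cts2 n q L : admissible q ->
  {for (q, L), continuous (fun u : R * R * R => load n u.1 u.2)}.
Proof.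
move=> aq; apply: (@cts_add _ _ (fun u : R * R * R => clock u.1 (n%:R * pi)));
  last exact: cts_snd.
apply: (@cts_comp _ _ _ (fun u : R * R * R => (u.1, n%:R * pi : R))
  (fun v : R * R * R => clock v.1 v.2)); last exact: clock_cts2.
by apply: cts_pair; [exact: cts_fst|exact: cts_cst].
Qed.

Lemma disp_slope_cts3 n q L s : admissible q ->
  {for (q, L, s), continuous (fun u : R * R * R * R => disp_slope n u.1.1 u.1.2 u.2)}.
Proof.
move=> aq; have [b0 _] := aq; pose X := (R * R * R * R)%type.
have c1 : {for (q, L, s), continuous (fun u : X => u.1)} by exact: cts_fst.
have cq : {for (q, L, s), continuous (fun u : X => u.1.1)}.
  by apply: (@cts_comp _ _ _ (fun u : X => u.1) (fun u => u.1)); [exact: c1|exact: cts_fst].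
have cl : {for (q, L, s), continuous (fun u : X => load n u.1.1 u.1.2)}.
  apply: (@cts_comp _ _ _ (fun u : X => u.1) (fun v : R * R * R => load n v.1 v.2)).
    exact: c1.
  exact: load_cts2.
have cth : {for (q, L, s), continuous (fun u : X => phase n u.1.1 u.1.2 u.2)}.
  apply: (@cts_comp _ _ _ (fun u : X => (u.1.1, time n u.1.1 u.1.2 u.2))
    (fun v : R * R * R => angle v.1 v.2)); last exact: angle_cts2.
  by apply: cts_pair => //; exact: time_cts3.
have cg : {for (q, L, s), continuous (fun u : X => u.1.1.1 - lo u.1.1)}.
  apply: (@cts_comp _ _ _ (fun u : X => u.1.1) (fun q : R * R => q.1 - lo q)).
    exact: cq.
  exact: gap_cts.
have cs : {for (q, L, s), continuous (fun u : X => speed u.1.1 (phase n u.1.1 u.1.2 u.2))}.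
  apply: (@cts_comp _ _ _ (fun u : X => (u.1.1, phase n u.1.1 u.1.2 u.2))
    (fun v : R * R * R => speed v.1 v.2)); last exact: speed_cts2.
  exact: cts_pair.
apply: (@cts_mul _ _ (fun u : X => load n u.1.1 u.1.2 ^+ 2)).
  exact: (@cts_mul _ _ (fun u : X => load n u.1.1 u.1.2)).
apply: (@cts_mul _ _ (fun u : X => (u.1.1.1 - lo u.1.1) / 2 * sin (phase n u.1.1 u.1.2 u.2)));
  last exact: cs.
apply: (@cts_mul _ _ (fun u : X => (u.1.1.1 - lo u.1.1) / 2)).
  apply: (@cts_mul _ _ (fun u : X => u.1.1.1 - lo u.1.1) (cst 2^-1)) => //.
  exact: cts_cst.
exact: (@cts_sin _ _ (fun u : X => phase n u.1.1 u.1.2 u.2)).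
Qed.

Section Solution.
Variables (n : nat) (q : R * R) (L : R).
Hypothesis n0 : (0 < n)%N.
Hypothesis aq : admissible q.
Hypothesis L0 : 0 <= L.
Notation T := (clock q (n%:R * pi)).
Notation l := (load n q L).
Notation p := (disp_slope n q L).
Notation U := (disp n q L).
Notation h := (fun s => strain q (phase n q L s)).

Lemma disp_slope_cts : continuous p.
Proof.
move=> s; apply: (@cts_comp _ _ _ (fun s : R => (q, L, s))
  (fun u : R * R * R * R => disp_slope n u.1.1 u.1.2 u.2)).
  by apply: cts_pair; [exact: cts_cst|exact: cvg_id].
exact: disp_slope_cts3.
Qed.

Lemma disp_slope_off s : ~~ (0 < s < 1) -> p s = 0.
Proof.
rewrite /disp_slope /phase negb_and -!leNgt => /orP[s0|s1].
  rewrite time_start// ?strain_slope_start ?mulr0//.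
  by apply: le_trans L0; rewrite mulr_ge0_le0// ltW// load_gt0.
by rewrite time_end// strain_slope_end// mulr0.
Qed.

Lemma vanishing_disp_slope : vanishing p.
Proof. by split; [exact: disp_slope_cts|exact: disp_slope_off]. Qed.

Lemma disp_slope_sqr s : q.2 != 1 ->
  p s ^+ 2 = 2 * l ^+ 4 / eps * kinetic q (h s).
Proof.
move=> x1; have [b0 _] := aq; rewrite /strain kineticE//.
rewrite /disp_slope /strain_slope; set t := phase n q L s.
have -> : (l ^+ 2 * ((q.1 - lo q) / 2 * sin t * speed q t)) ^+ 2 =
  l ^+ 4 * ((q.1 - lo q) / 2) ^+ 2 * sin t ^+ 2 * speed q t ^+ 2 by ring.
rewrite speed_sqr// sin2cos2 /height; move: (cos t) => c.
by field; rewrite gt_eqF.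
Qed.

(** Energy conservation gives the Euler equation off the turning points. *)
Lemma is_derive_disp_slope s : q.2 != 1 -> p s != 0 ->
  is_derive s (1 : R) p (l ^+ 3 / eps * (dw (h s) - dd (lo q) q.1)).
Proof.
move=> x1 ps; apply: (is_derive_root disp_slope_cts (fun s => disp_slope_sqr s x1) ps).
apply: (is_derive_ext (is_derive_scale (2 * l ^+ 4 / eps)
  (@is_derive_chain R (kinetic q) h _ _ s (is_derive_kinetic q (h s))
    (is_derive_profile L n0 aq s)))).
by rewrite /disp_slope; field; rewrite gt_eqF.
Qed.

End Solution.


Section Inequality.
Variable W : R -> R.
Hypothesis dwE : forall x, 0 <= x -> dWstar W x = dw x.
Variables (n : nat) (q : R * R) (L : R).
Hypothesis n0 : (0 < n)%N.
Hypothesis aq : admissible q.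
Hypothesis L0 : 0 <= L.
Hypothesis x01 : 0 <= q.2 < 1.
Hypothesis LX : L = 0 \/ q.2 = 0.
Hypothesis m1 : mass q (n%:R * pi) = 1.
Notation T := (clock q (n%:R * pi)).
Notation l := (load n q L).
Notation p := (disp_slope n q L).
Notation U := (disp n q L).
Notation h := (fun s => strain q (phase n q L s)).

Let l0 : 0 < l := load_gt0 n0 aq L0.
Let x01' : 0 <= q.2 <= 1. Proof. by have /andP[-> /ltW ->] := x01. Qed.
Let x1' : q.2 != 1. Proof. by have /andP[_ /lt_eqF ->] := x01. Qed.
Let mD := @measurable_unit_itv R.
Let ID : forall s, D s -> 0 <= s <= 1.
Proof. by move=> s; rewrite /= in_itv/= => /andP[/ltW -> /ltW ->]. Qed.

Lemma time_before_end s : s <= 1 -> time n q L s = Num.max (l * s - L) 0.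
Proof.
move=> s1; rewrite /time min_l//.
by rewrite lerBlDr -[leRHS]/l -[leRHS]mulr1 ler_pM2l.
Qed.

Lemma strain_rest : 0 < L -> strain q 0 = 0.
Proof.
move=> Lp; have x0 : q.2 = 0 by case: LX => // Le; rewrite Le ltxx in Lp.
by rewrite /strain cos0 /height /lo x0; field.
Qed.

(** Resting adds no mass, since it occurs only at zero strain. *)
Lemma disp_mean : \int[mu]_(s in D) U s = 0.
Proof.
pose M y := mass q (angle q y); pose f y := strain q (angle q y).
have dM y : is_derive y (1 : R) M (f y).
  apply: (is_derive_ext (@is_derive_chain R (mass q) (angle q) _ _ y
    (is_derive_mass _ aq) (is_derive_angle y aq))).
  by rewrite /f mulrAC mulVf ?mul1r// gt_eqF// speed_gt0.
have M0 : M 0 = 0 by rewrite /M angle0// mass0.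
have MT : M T = 1 by rewrite /M clockK.
pose G y := if L == 0 then M y else M (Num.max y 0).
pose g y := if L == 0 then f y else f (Num.max y 0).
have dG y : is_derive y (1 : R) G (g y).
  rewrite /G /g; case: ifPn => [_|Ln]; first exact: dM.
  apply: is_derive_max => //; rewrite /f angle0// strain_rest//.
  by rewrite lt_neqAle eq_sym Ln.
have dF (s : R) : is_derive s (1 : R) (fun s => G (l * s - L) - s) (l * g (l * s - L) - 1).
  have d1 := is_derive_sub (is_derive_linear l s) (is_derive_cst L s (1 : R)).
  apply: (is_derive_ext (is_derive_sub (@is_derive_chain R G (fun s => l * s - L) _ _ s
    (dG _) d1) (is_derive_id s (1 : R)))).
  by rewrite subr0 mulrC.
have cg : continuous (fun s : R => l * g (l * s - L) - 1).
  have cf : continuous f by move=> y; exact: is_derive_cts (is_derive_strain y aq).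
  have cgg : continuous g.
    have cm : continuous (fun y : R => f (Num.max y 0)).
      move=> y; apply: (@cts_comp _ _ _ (fun y : R => Num.max y 0) f); last exact: cf.
      by apply: (@cts_max _ _ id (cst 0)); [exact: cvg_id|exact: cts_cst].
    by rewrite /g; case: (L == 0).
  move=> s; apply: (@cts_sub _ _ (fun s : R => l * g (l * s - L)) (cst 1)); last exact: cts_cst.
  apply: (@cts_mul _ _ (cst l) (fun s : R => g (l * s - L))); first exact: cts_cst.
  apply: (@cts_comp _ _ _ (fun s : R => l * s - L) g); last exact: cgg.
  apply: (@cts_sub _ _ (fun s : R => l * s) (cst L)); last exact: cts_cst.
  by apply: (@cts_mul _ _ (cst l) id); [exact: cts_cst|exact: cvg_id].
transitivity (\int[mu]_(s in D) (l * g (l * s - L) - 1)).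
  apply: eq_Rintegral => s; rewrite inE => /ID /andP[s0 s1].
  rewrite /disp /phase time_before_end// /g /f.
  case: ifPn => // /eqP Le; have LN : L <= 0 by rewrite Le.
  by rewrite max_l// subr_ge0 (le_trans LN)// mulr_ge0// ltW.
rewrite (Rintegral_FTC cg dF) mulr1 mulr0 sub0r subr0.
have -> : l - L = T by rewrite /load addrK.
have -> : G T = 1 by rewrite /G; case: ifP => // _; rewrite max_l// ltW// (clock_gt0).
have -> : G (- L) = 0.
  rewrite /G; case: ifPn => [/eqP ->|_]; first by rewrite oppr0.
  by rewrite max_r// oppr_le0.
by rewrite !subrr.
Qed.


Notation vp := (vanishing_disp_slope n0 aq L0).
Notation sig := (dd (lo q) q.1).

Lemma disp_val s : 0 <= s <= 1 -> h1m_fun (h1_of_der p) s = U s.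
Proof.
exact: (h1m_val_of_der vp (fun s => is_derive_disp L n0 aq s) disp_mean).
Qed.

Lemma strain_cts : continuous h.
Proof. exact: (profile_cts n0 aq). Qed.

(* At all but countably many points where the slope vanishes the profile is at
   rest on the obstacle. *)
Let turning : set (measurableTypeR R) := [set s : R | exists k, s = (clock q (k%:R * pi) + L) / l].

Let turning_null : {ae mu, forall s : measurableTypeR R, D s -> ~ turning s}.
Proof.
have ct : countable turning.
  have -> : turning = range (fun k : nat => (clock q (k%:R * pi) + L) / l).
    by apply/seteqP; split => s /= [k]; [move=> ->; exists k|move=> _ <-; exists k].
  exact: card_image_le.
exists turning; split.
- by apply: countable_measurable => // t; exact: measurable_set1.
- exact: countable_lebesgue_measure0.
- by move=> s /= ns; apply: contrapT => ts; apply: ns.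
Qed.

Let rest_or_turn s : D s -> p s = 0 -> turning s \/
  [/\ h s = 0, U s = -1 & sig < dw (h s)].
Proof.
move=> Ds ps; have /andP[s0 s1] := ID Ds; have [b0 _] := aq.
have st : sin (phase n q L s) = 0.
  apply/eqP; move/eqP: ps; rewrite /disp_slope /strain_slope.
  rewrite !mulf_eq0 (gt_eqF l0) (gt_eqF (speed_gt0 _ aq)) orbF/=.
  by rewrite (gap_neq0 b0) (negbTE x1') invr_eq0 pnatr_eq0/= orbF.
have tE := time_before_end s1.
have [y0|y0] := ltP 0 (time n q L s); last first.
  right; have t0 : time n q L s = 0.
    by apply/eqP; rewrite eq_le y0; have /andP[] := time_itv L n0 aq s.
  have Lp : 0 < L.
    have ls : 0 < l * s by rewrite mulr_gt0//; move: Ds; rewrite /= in_itv/= => /andP[].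
    apply: (lt_le_trans ls); rewrite -subr_le0.
    by move: y0; rewrite tE ge_max => /andP[].
  have h0 : h s = 0 by rewrite /phase t0 angle0// strain_rest.
  have x0 : q.2 = 0 by case: LX => // Le; rewrite Le ltxx in Lp.
  rewrite h0; split => //; first by rewrite /disp h0 mulr0 sub0r.
  by have := slope_lo_gt aq; rewrite /lo x0 mul0r; apply.
left; have /andP[_ yT] := time_itv L n0 aq s.
have [||k e] := @sin_eq0_multiple R n (phase n q L s); last 1 first.
- exists k; have : clock q (phase n q L s) = l * s - L.
    rewrite angleK//; move: y0; rewrite tE lt_max ltxx orbF => h0.
    by rewrite max_l// ltW.
  by rewrite e => ->; rewrite subrK mulrAC mulfV ?mul1r// gt_eqF.
- have mono := le_mono (clock_incr aq).
  apply/andP; split; rewrite -mono angleK// clock0//.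
  exact: ltW.
- exact: st.
Qed.

(** Integration by parts leaves a multiple of the mean of v - u, which is zero,
    and the integral over the contact set of a positive multiple of
    (dw 0 - sig) (v - u), where v - u is nonnegative as u = -1. *)
Lemma profile_solution : VI_solution eps W l (h1_of_der p).
Proof.
have Uh s : (1 + U s) / l = h s.
  by rewrite /disp addrC subrK mulrC mulKf// gt_eqF.
split => //.
  move=> s s01; rewrite disp_val// /disp lerBrDr addNr.
  by rewrite mulr_ge0 ?(ltW l0)// (strain_ge0 _ aq x01').
move=> v hv; pose g := repr v; pose f := repr (h1_of_der p).
pose d s := h1val g s - h1val f s.
have fU s : 0 <= s <= 1 -> h1val f s = U s by exact: disp_val.
have cp : continuous p by case: vp.
have cdh : continuous (fun s => l ^+ 3 * dw (h s)).
  move=> s; apply: (@cts_mul _ _ (cst (l ^+ 3)) (fun s => dw (h s))); first exact: cts_cst.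
  by apply: (@cts_comp _ _ _ h dw); [exact: strain_cts|exact: cdw].
pose r s := l ^+ 3 / eps * (dw (h s) - sig).
have cr : continuous r.
  move=> s; apply: (@cts_mul _ _ (cst (l ^+ 3 / eps)) (fun s => dw (h s) - sig)).
    exact: cts_cst.
  apply: (@cts_sub _ _ (fun s => dw (h s)) (cst sig)); last exact: cts_cst.
  by apply: (@cts_comp _ _ _ h dw); [exact: strain_cts|exact: cdw].
have dp s : p s != 0 -> is_derive s (1 : R) p (r s).
  by move=> ps; exact: (is_derive_disp_slope n0 aq x1' ps).
have p0 s : ~~ (0 < s < 1) -> p s = 0 by case: vp => _; exact.
pose chi s := if p s == 0 then 0 else r s.
have [Ig Eg] := h1_by_parts g cp cr p0 dp.
have [If Ef] := h1_by_parts f cp cr p0 dp.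
have Igp := integrable_mul_cts (h1der_integrable g) cp.
have Ifp := integrable_mul_cts (h1der_integrable f) cp.
have Id : mu.-integrable D (EFin \o d).
  exact: (integrableB mD (h1val_integrable g) (h1val_integrable f)).
have Idh := integrable_mul_cts Id cdh.
pose K s := if p s == 0 then l ^+ 3 * (dw (h s) - sig) * d s else 0.
have KE s : K s = d s * (l ^+ 3 * dw (h s)) - (l ^+ 3 * sig * d s +
    eps * (h1val g s * chi s - h1val f s * chi s)).
  rewrite /K /chi; case: ifP => _; first by ring.
  by rewrite /r /d; field; rewrite gt_eqF.
have IZ (c : R) (F : R -> R) : mu.-integrable D (EFin \o F) ->
    mu.-integrable D (EFin \o (fun s => c * F s)).
  by move=> IF; exact: (integrableZl mD c IF).
have Igf : mu.-integrable D (EFin \o (fun s => h1val g s * chi s - h1val f s * chi s)).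
  exact: (integrableB mD Ig If).
have IR := integrableD mD (IZ (l ^+ 3 * sig) d Id) (IZ eps _ Igf).
have IK : mu.-integrable D (EFin \o K).
  have := integrableB mD Idh IR; apply: eq_integrable => // s _ /=.
  by rewrite KE.
have intK : \int[mu]_(s in D) K s = \int[mu]_(s in D) (d s * (l ^+ 3 * dw (h s))) +
    eps * (\int[mu]_(s in D) (h1der g s * p s) - \int[mu]_(s in D) (h1der f s * p s)).
  under eq_Rintegral do rewrite KE.
  rewrite (RintegralB mD Idh IR) (RintegralD mD (IZ (l ^+ 3 * sig) d Id) (IZ eps _ Igf)).
  rewrite (RintegralZl _ mD Id) (RintegralZl _ mD Igf) (RintegralB mD Ig If) Eg Ef.
  rewrite (RintegralB mD (h1val_integrable g) (h1val_integrable f)) !h1val_mean_open.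
  by ring.
pose I1 s := eps * h1der f s * (h1der g s - h1der f s) + l ^+ 3 * dw (h s) * d s.
have mI1 : measurable_fun D (I1 : measurableTypeR R -> R).
  have mf := h1der_measurable f; have mg := h1der_measurable g.
  apply: measurable_funD; apply: measurable_funM.
  - by apply: measurable_funM.
  - exact: measurable_funB.
  - exact: (cts_measurable mD).
  - exact: integrable_measurable.
have -> : \int[mu]_(s in `[0, 1]) (eps * h1m_der (h1_of_der p) s *
    (h1m_der v s - h1m_der (h1_of_der p) s) +
    l ^+ 3 * dWstar W ((1 + h1m_fun (h1_of_der p) s) / l) *
    (h1m_fun v s - h1m_fun (h1_of_der p) s)) = \int[mu]_(s in D) K s.
  transitivity (\int[mu]_(s in `[0, 1]) I1 s).
    apply: eq_Rintegral => s; rewrite inE/= in_itv/= => s01.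
    by rewrite disp_val// Uh dwE ?(strain_ge0 _ aq x01')// /I1 /d fU.
  rewrite (Rintegral_closed_open mI1) intK.
  transitivity (\int[mu]_(s in D) (d s * (l ^+ 3 * dw (h s)) +
      eps * (h1der g s * p s - h1der f s * p s))).
    have I2 : mu.-integrable D (EFin \o (fun s => d s * (l ^+ 3 * dw (h s)) +
        eps * (h1der g s * p s - h1der f s * p s))).
      exact: (integrableD mD Idh (IZ eps _ (integrableB mD Igp Ifp))).
    apply: Rintegral_ae_eq => //; first exact: integrable_measurable.
    have := h1m_der_of_der vp; apply: filterS => s hs Ds.
    by have := hs Ds; rewrite /h1m_der -/f /I1 => ->; ring.
  rewrite (RintegralD mD Idh (IZ eps _ (integrableB mD Igp Ifp))).
  by rewrite (RintegralZl _ mD (integrableB mD Igp Ifp)) (RintegralB mD Igp Ifp).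
have cK : measurable_fun D (K : measurableTypeR R -> R) by exact: integrable_measurable.
have -> : \int[mu]_(s in D) K s = \int[mu]_(s in D) Num.max (K s) 0.
  apply: Rintegral_ae_eq => //.
    by apply: measurable_maxr => //; exact: measurable_cst.
  have := turning_null; apply: filterS => s /[swap] Ds /(_ Ds) ns; apply/esym/max_l.
  rewrite /K; case: ifPn => // /eqP ps.
  have [//|[h0 Us hs]] := rest_or_turn Ds ps.
  rewrite mulr_ge0 ?mulr_ge0 ?exprn_ge0 ?(ltW l0) ?subr_ge0 ?(ltW hs)//.
  by rewrite fU ?ID// Us; exact/hv/ID.
by apply: Rintegral_ge0 => s _; rewrite le_max lexx orbT.
Qed.

End Inequality.

Lemma profile_nontrivial n q L : (0 < n)%N -> admissible q -> 0 <= L ->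
  0 <= q.2 < 1 -> L = 0 \/ q.2 = 0 -> mass q (n%:R * pi) = 1 ->
  h1_of_der (disp_slope n q L) <> h1m_zero.
Proof.
move=> n0 aq L0 x01 LX m1 u0.
have l0 := load_gt0 n0 aq L0; have mono := le_mono (clock_incr aq).
have c0 := clock0 aq.
have pin : pi <= n%:R * pi :> R by rewrite -[leLHS]mul1r ler_wpM2r ?pi_ge0// ler1n.
have at_phase t : 0 <= t <= n%:R * pi -> strain q t = (load n q L)^-1.
  move=> /andP[t0 tn]; pose s := (clock q t + L) / load n q L.
  have ct : 0 <= clock q t by rewrite -c0 mono.
  have ctn : clock q t <= clock q (n%:R * pi) by rewrite mono.
  have s01 : 0 <= s <= 1.
    apply/andP; split; first by apply: divr_ge0; [exact: addr_ge0|exact: ltW].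
    by rewrite /s ler_pdivrMr// mul1r lerD2r.
  have := disp_val n0 aq L0 LX m1 s01.
  rewrite u0 h1m_zero_val// /disp /phase.
  have -> : time n q L s = clock q t.
    rewrite /time /s mulrC divfK ?gt_eqF// addrK min_l// max_l//.
  rewrite clockK// => /esym/eqP; rewrite subr_eq0 => /eqP e.
  by apply: (mulfI (negbT (gt_eqF l0))); rewrite e mulfV// gt_eqF.
have h0 := at_phase 0; have hpi := at_phase pi.
have e : strain q 0 = strain q pi.
  by rewrite h0 ?hpi ?lexx ?mulr_ge0 ?pi_ge0 ?pin.
have [b0 _] := aq; have /andP[_ x1] := x01.
have : q.1 - lo q = 0.
  by move: e; rewrite /strain cos0 cospi /height; lra.
by apply/eqP; rewrite (gap_neq0 b0) lt_eqF.
Qed.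

(** The pair of load and displacement; the rest time enters through its
    absolute value, so as to make the map continuous on the whole line. *)
Definition branch_map n (u : R * R * R) : R * H1m R :=
  (load n u.1 `|u.2|, h1_of_der (disp_slope n u.1 `|u.2|)).

Lemma branch_map_cts n (u : R * R * R) : (0 < n)%N -> admissible u.1 ->
  {for u, continuous (branch_map n)}.
Proof.
move=> n0 au; apply: cts_pair.
  apply: (@cts_comp _ _ _ (fun u : R * R * R => (u.1, `|u.2|))
    (fun v : R * R * R => load n v.1 v.2)); last exact: load_cts2.
  by apply: cts_pair; [exact: cts_fst|apply: cts_norm; exact: cts_snd].
pose F (u : R * R * R) (s : R) := disp_slope n u.1 `|u.2| s.
have cF s : {for (u, s), continuous (fun z : R * R * R * R => F z.1 z.2)}.
  apply: (@cts_comp _ _ _ (fun z : R * R * R * R => (z.1.1, `|z.1.2|, z.2))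
    (fun v : R * R * R * R => disp_slope n v.1.1 v.1.2 v.2)); last first.
    exact: disp_slope_cts3.
  have c1 : {for (u, s), continuous (fun z : R * R * R * R => z.1)} by exact: cts_fst.
  apply: cts_pair; last exact: cts_snd.
  apply: cts_pair.
    by apply: (@cts_comp _ _ _ (fun z : R * R * R * R => z.1) (fun u => u.1));
      [exact: c1|exact: cts_fst].
  apply: (@cts_norm _ _ (fun z : R * R * R * R => z.1.2)).
  by apply: (@cts_comp _ _ _ (fun z : R * R * R * R => z.1) (fun u => u.2));
    [exact: c1|exact: cts_snd].
apply/cvg_ballP => e e0; have e2 : 0 < e / 2 by rewrite divr_gt0.
have h1 := near_uniform (@segment_compact R 0 1) (fun s _ => cF s) e2.
have h2 : \forall v \near u, admissible v.1.
  by have /(_ _ (admissible_near au)) := @cts_fst _ _ u.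
apply: filterS2 h1 h2 => v hv av; rewrite /ball /=.
apply: (@le_lt_trans _ _ (e / 2)); last by rewrite ltr_pdivrMr// ltr_pMr// ltr1n.
apply: h1m_dist_of_der.
- exact: (vanishing_disp_slope n0 au (normr_ge0 _)).
- exact: (vanishing_disp_slope n0 av (normr_ge0 _)).
- exact: ltW.
- by move=> s s01; rewrite distrC ltW// hv//= in_itv.
Qed.

Lemma branch_map_diag n (b : R) :
  branch_map n (b, 1, 0) = (clock (b, 1) (n%:R * pi), h1m_zero).
Proof.
rewrite /branch_map normr0 /load addr0 -h1_of_der0; congr (_, h1_of_der _).
by apply/funext => s; rewrite /disp_slope /strain_slope /lo /= mul1r subrr !mul0r mulr0.
Qed.

Section GlobalBranch.
Variable W : R -> R.
Hypothesis dwE : forall x, 0 <= x -> dWstar W x = dw x.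
Variable n : nat.
Hypothesis n0 : (0 < n)%N.

Let del : R := H (3 * n) / 2.
Let p0 : R * R := (H n, 1).

(** The bound b >= del keeps away from b = 0, where divided differences of the
    slope need not be continuous. *)
Definition profiles : set (R * R) :=
  [set q | rectangle del 1 q /\ admissible q /\ mass q (n%:R * pi) = 1].

Let del0 : 0 < del.
Proof.
have m0 : (0 < 3 * n)%N by rewrite muln_gt0.
by have /andP[h _] := bp_H hp m0; rewrite divr_gt0.
Qed.

Let del1 : del < 1.
Proof.
have m0 : (0 < 3 * n)%N by rewrite muln_gt0.
by have /andP[h1 h2] := bp_H hp m0; rewrite /del; lra.
Qed.

Let near_mass z : admissible z -> {for z, continuous (fun q => mass q (n%:R * pi))}.
Proof.
move=> az; apply: (@cts_comp _ _ _ (fun q : R * R => (q, n%:R * pi : R))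
  (fun u : R * R * R => mass u.1 u.2)); last exact: mass_cts2.
by apply: cts_pair; [exact: cvg_id|exact: cts_cst].
Qed.

Let rect_pos z : rectangle del 1 z -> 0 < z.1 /\ 0 <= z.2 <= 1.
Proof.
move=> [] /=; rewrite !in_itv/= => /andP[dz _] ->; split => //.
exact: lt_le_trans dz.
Qed.

Let plane_hausdorff : hausdorff_space (R * R)%type.
Proof. exact: norm_hausdorff. Qed.

Lemma profiles_closed : closed profiles.
Proof.
move=> z clz.
have rz : rectangle del 1 z.
  have := compact_closed plane_hausdorff (@compact_rectangle R del 1).
  move=> /closure_id ->; move: clz; apply: closure_subset.
  by move=> q [].
have [b0 x01] := rect_pos rz.
have az : admissible z.
  apply: contrapT => naz; have [q [[rq [aq mq]] hq]] := clz _ (escape n0 b0 x01 naz).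
  have [_ xq] := rect_pos rq.
  by have := hq xq aq; rewrite mq ltxx.
split => //; split => //; apply/eqP/negPn/negP => mz.
have : \forall q \near z, mass q (n%:R * pi) != 1.
  have : {for z, continuous (fun q => `|mass q (n%:R * pi) - 1|)}.
    apply: cts_norm; apply: (@cts_sub _ _ (fun q => mass q (n%:R * pi)) (cst 1)).
      exact: near_mass.
    exact: cts_cst.
  move=> /cvgr_gt /(_ 0); rewrite normr_gt0 subr_eq0 => /(_ mz).
  by apply: filterS => q; rewrite normr_gt0 subr_eq0.
by move=> /clz[q [[_ [_ ->]]]]; rewrite eqxx.
Qed.

Lemma profiles_compact : compact profiles.
Proof.
apply: (subclosed_compact profiles_closed (@compact_rectangle R del 1)).
by move=> q [].
Qed.

Lemma profiles_at_diag z : profiles z -> z.2 = 1 -> z = p0.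
Proof.
case: z => b x [rz [az mz]] /= x1; rewrite {}x1 in rz az mz *.
have [b0 _] := rect_pos rz; rewrite /p0; congr (_, _).
have [bH|Hb|//] := ltgtP b (H n).
  have bH' : 0 < b < H n by rewrite b0.
  by have [_] := diag_below n0 bH'; rewrite mz ltxx.
by have := diag_above n0 Hb az; rewrite mz ltxx.
Qed.

Lemma profiles_p0 : profiles p0.
Proof.
have [a0 m0 _] := diag_root n0; split => //.
have /andP[H0 H1] := bp_H hp n0.
split => /=; rewrite in_itv/= ?ler01 ?lexx// (ltW H1) andbT leNgt; apply/negP => Hd.
have x1 : 0 <= (1 : R) <= 1 by rewrite ler01 lexx.
have [ad md] := left_side n0 x1.
by have := diag_above n0 Hd ad; rewrite ltNge ltW.
Qed.

(** By escape, the set where the mass is below one has its frontier among the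
    parameters of mass one. *)
Lemma profiles_reach_contact :
  exists2 z, connected_component profiles p0 z & z.2 = 0.
Proof.
apply: (@component_crosses R del 1
  [set q | admissible q /\ mass q (n%:R * pi) < 1] profiles) => //.
- exact: profiles_compact.
- exact: profiles_closed.
- by move=> q [].
- by move=> x x01; exact: (left_side n0 x01).
- by move=> x x01 [a1 m1]; have := right_side n0 x01 a1; rewrite ltNge ltW.
- move=> z rz cl1 cl2; have [b0 x01] := rect_pos rz.
  have az : admissible z.
    apply: contrapT => naz.
    have [q [[rq [aq mq]] hq]] := cl1 _ (escape n0 b0 x01 naz).
    have [_ xq] := rect_pos rq.
    by have := hq xq aq; rewrite ltNge ltW.
  split => //; split => //.
  have cm := near_mass az; have na := admissible_near az.
  have [m1|m1|//] := ltgtP (mass z (n%:R * pi)) 1.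
    have nm : \forall q \near z, mass q (n%:R * pi) < 1 by move/cvgr_lt : cm; apply.
    by have [q [[_ nA] [aq mq]]] := cl2 _ (filterI na nm); case: nA.
  have nm : \forall q \near z, 1 < mass q (n%:R * pi) by move/cvgr_gt : cm; apply.
  by have [q [[_ [_ mq]] mq']] := cl1 _ nm; move: mq'; rewrite ltNge ltW.
- exact: profiles_p0.
- exact: profiles_at_diag.
Qed.

Lemma nontrivial_profile q L : profiles q -> 0 <= L -> q.2 < 1 -> L = 0 \/ q.2 = 0 ->
  nontrivial_solutions eps W (branch_map n (q, L)).
Proof.
move=> [rq [aq mq]] L0 x1 LX; have [_ /andP[x0 _]] := rect_pos rq.
have x01 : 0 <= q.2 < 1 by rewrite x0.
rewrite /branch_map /= ger0_norm//; split.
  exact: (profile_solution dwE n0 aq L0 x01 LX mq).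
exact: (profile_nontrivial n0 aq L0 x01 LX mq).
Qed.

Let start : branch_map n (p0, 0) = ((H n)^-1, h1m_zero).
Proof. by rewrite branch_map_diag; have [_ _ ->] := diag_root n0. Qed.

(** The component of the diagonal point in the set of profiles, followed by the
    ray of rest times issued from a point of it on the axis x = 0. *)
Lemma branch_unbounded : unbounded
  (connected_component (solution_set eps W) ((H n)^-1, h1m_zero)).
Proof.
have [z0 Cz0 z00] := profiles_reach_contact.
set C := connected_component profiles p0 in Cz0.
have Cp0 : C p0 by exact/connected_component_refl/profiles_p0.
have CZ : C `<=` profiles by exact: connected_component_sub.
have connC : connected C by exact: component_connected.
pose f1 q := branch_map n (q, 0); pose f2 (L : R) := branch_map n (z0, L).
have cf1 q : C q -> {for q, continuous f1}.
  move=> /CZ[_ [aq _]]; apply: (@cts_comp _ _ _ (fun q : R * R => (q, 0 : R)) (branch_map n)).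
    by apply: cts_pair; [exact: cvg_id|exact: cts_cst].
  exact: branch_map_cts.
have Zz0 := CZ _ Cz0; have [_ [az0 _]] := Zz0.
have cf2 : continuous f2.
  move=> L; apply: (@cts_comp _ _ _ (fun L : R => (z0, L)) (branch_map n)).
    by apply: cts_pair; [exact: cts_cst|exact: cvg_id].
  exact: branch_map_cts.
have conn1 : connected (f1 @` C).
  apply: connected_continuous_connected connC _.
  apply/subspace_continuousP => q Cq; apply: cvg_within_filter; exact: cf1.
have conn2 : connected (f2 @` `[0, +oo[%classic).
  apply: connected_continuous_connected.
    by apply/connected_intervalP; exact: interval_is_interval.
  exact: continuous_subspaceT.
have connS : connected (f1 @` C `|` f2 @` `[0, +oo[%classic).
  apply: connectedU conn1 conn2; exists (f1 z0); split; first by exists z0.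
  by exists 0 => //=; rewrite in_itv/= lexx.
have nt1 q : C q -> q <> p0 -> nontrivial_solutions eps W (f1 q).
  move=> /CZ Zq qp; apply: nontrivial_profile => //; last by left.
  have [rq _] := Zq; have [_ /andP[_ x1]] := rect_pos rq.
  rewrite lt_neqAle x1 andbT; apply/eqP => xq; apply: qp.
  exact: profiles_at_diag.
have nt2 L : 0 <= L -> nontrivial_solutions eps W (f2 L).
  move=> L0; apply: nontrivial_profile => //; last by right.
  by rewrite z00.
have sol p : nontrivial_solutions eps W p -> solution_set eps W p.
  move=> np; split; first exact: subset_closure.
  by case: np => -[l0 ob _] _; split.
(* The diagonal point is not isolated in the connected set C. *)
have cl0 : closure (nontrivial_solutions eps W) (f1 p0).
  move=> B nB; apply: contrapT => nex.
  have nV : nbhs p0 (f1 @^-1` B) by exact: cf1.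
  have [N [oN Np0 NV]] : exists N, [/\ open N, N p0 & N `<=` f1 @^-1` B].
    by move: nV; rewrite nbhsE => -[N [oN Np] NV]; exists N.
  have only q : C q -> N q -> q = p0.
    move=> Cq Nq; apply: contrapT => qp; apply: nex; exists (f1 q); split; last exact: NV.
    exact: nt1.
  have e : [set p0] = C.
    apply: connC; first by exists p0.
      exists N => //; apply/seteqP; split => q /= [].
        by move=> ->.
      by move=> Cq Nq; exact: only.
    exists [set p0]; first exact: (accessible_closed_set1 (hausdorff_accessible plane_hausdorff)).
    by apply/seteqP; split => q /= => [->|[]].
  have : [set p0] z0 by rewrite e.
  by move=> /= zp; move: z00; rewrite zp /= => /eqP; rewrite oner_eq0.
have Ssub : f1 @` C `|` f2 @` `[0, +oo[%classic `<=` solution_set eps W.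
  move=> p [[q Cq <-]|[L + <-]]; last by rewrite /= in_itv/= andbT => /nt2/sol.
  have [->|/eqP qp] := eqVneq q p0; last exact/sol/nt1.
  split => //; rewrite /f1 start; split => /=.
    by rewrite invr_gt0; have /andP[] := bp_H hp n0.
  by move=> s s01; rewrite h1m_zero_val// lerN10.
have Sp : (f1 @` C `|` f2 @` `[0, +oo[%classic) ((H n)^-1, h1m_zero).
  by left; exists p0 => //; exact: start.
have sub := connected_component_max Sp Ssub connS.
move=> [M hM].
have L0 : 0 <= `|M| + 1 :> R by rewrite addr_ge0.
have [|+ _] := hM (f2 (`|M| + 1)).
  by apply: sub; right; exists (`|M| + 1) => //=; rewrite in_itv/= L0.
rewrite /f2 /branch_map /= (ger0_norm L0) => h.
have := clock_gt0 n0 az0; have := ler_norm (clock z0 (n%:R * pi) + (`|M| + 1)).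
have := ler_norm M; move: h; rewrite /load; lra.
Qed.

End GlobalBranch.

End TimeMap.

Theorem theorem3p1 (R : realType) (W : R -> R) (gam kap eps : R)
    (lam : nat -> R)
    (hW : energy_density W gam kap)
    (heps : 0 < eps)
    (hlam : char_roots eps kap W lam) :
  forall n : nat, (0 < n)%N ->
    unbounded (branch eps W (lam n)) \/
    (exists k : nat, [/\ (0 < k)%N, k <> n &
       branch eps W (lam n) (lam k, h1m_zero)]).
Proof.
move=> n n0; left; rewrite /branch -[lam n]invrK.
apply: (branch_unbounded heps (energy_potential hW heps hlam) _ n0) => x x0.
by rewrite /wslope max_l.
Qed.
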